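(* Let $d\ge 2$ and $0<\alpha<d$, and let $\mathcal P$ be a simple point process on $\mathbb R^d$ satisfying Assumptions (A1) and (A2). Then there exists $C<\infty$ such that for every $i\in\{1,2,3\}$, $\mathcal P$-a.s., $\tau^i(L)\le CL^2$ for all $L$ sufficiently large.
   Context: $\Omega$ is the set of locally finite subsets $\xi\subset\mathbb R^d$, with the $\sigma$-algebra generated by counting variables; a simple point process is a probability measure $\mathcal P$ on $\Omega$, $\xi(\Lambda):=\#(\xi\cap\Lambda)$. For $L\in\mathbb N$, $\Lambda_L=[-L/2,L/2]^d$, $\xi_L=\xi\cap\Lambda_L$. Models: for $x\in\xi_L$ let $w^1_x=1$, $w^2_x=\sum_{z\in\xi_L,z\ne x}e^{-|x-z|^\alpha}$, $w^3_x=\max\{1,w^2_x\}$. For $i=1,2,3$, $X^i_t$ is the continuous-time Markov chain on $\xi_L$ with generator $\mathcal L^i(x,y)=e^{-|x-y|^\alpha}/w^i_x$ for $x\ne y$ and $\mathcal L^i(x,x)=-\sum_{z\ne x}\mathcal L^i(x,z)$; its reversible probability is $\nu^i(x)=w^i_x/\sum_{z\in\xi_L}w^i_z$. With $H^i_t=\exp(t\mathcal L^i)$ the transition kernel, the mixing time is $\tau^i(L)=\inf\{t>0:\ \sup_{x,y\in\xi_L}|H^i_t(x,y)-\nu^i(y)|/\nu^i(y)\le 1/e\}$. Convention: ''$\mathcal P$-a.s. for $L$ sufficiently large'' means there is a full-measure set $\Omega_0$ such that for each $\xi\in\Omega_0$ the property holds for all integers $L\ge L_0(\xi)$. Assumption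 (A1): for every $0<p<1$ there exists $K>0$ such that the field $\sigma_x(\xi)=\chi(\xi(xK+[0,K)^d)\ge1)$, $x\in\mathbb Z^d$, stochastically dominates i.i.d. Bernoulli($p$) on $\mathbb Z^d$. Assumption (A2): with $R_A(\xi)=\sum_{x\in\xi\cap A}\sum_{y\in\xi}e^{-|x-y|^\alpha}$, for every $\varepsilon\in(0,1)$ there is $C<\infty$ such that, $\mathcal P$-a.s., for $L$ sufficiently large, $R_{V_x}\le CL^{\varepsilon d}$ for all $x\in\mathbb Z^d$ with $V_x\cap\Lambda_L\ne\emptyset$, where $V_x=L^\varepsilon x+[0,L^\varepsilon)^d$. *)

(* Defs.v *)
From HB Require Import structures.
From mathcomp Require Import all_boot all_order all_algebra.
From mathcomp Require Import all_classical all_reals all_analysis.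
Import Order.TTheory GRing.Theory Num.Theory numFieldNormedType.Exports.

Set Implicit Arguments.
Unset Strict Implicit.
Unset Printing Implicit Defensive.

Local Open Scope classical_set_scope.
Local Open Scope ring_scope.

Section PointProcess.
Variables (R : realType) (d : nat).

Definition enorm (x : 'rV[R]_d) : R := Num.sqrt (\sum_(j < d) x ord0 j ^+ 2).

Definition eopen (A : set 'rV[R]_d) : Prop :=
  forall x, A x -> exists r : R, 0 < r /\ forall y, enorm (y - x) < r -> A y.
Definition borel (A : set 'rV[R]_d) : Prop := <<s eopen >> A.
Definition ebounded (A : set 'rV[R]_d) : Prop :=
  exists r : R, forall x, A x -> enorm x <= r.

Definition loc_finite (xi : set 'rV[R]_d) : Prop :=
  forall A, ebounded A -> finite_set (xi `&` A).

Definition card_is (A : set 'rV[R]_d) (n : nat) : Prop :=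
  exists s : seq 'rV[R]_d, [/\ uniq s, [set` s] = A & size s = n].

Record config := Config { cpts : set 'rV[R]_d ; cpts_lf : loc_finite cpts }.

Lemma loc_finite0 : loc_finite set0.
Proof. by move=> A _; rewrite set0I; exact: finite_set0. Qed.

HB.instance Definition _ := gen_eqMixin config.
HB.instance Definition _ := gen_choiceMixin config.
HB.instance Definition _ := isPointed.Build config (Config loc_finite0).

Definition counting_events : set (set config) :=
  [set E | exists (Lam : set 'rV[R]_d) (n : nat),
     [/\ borel Lam, ebounded Lam & E = [set xi | card_is (cpts xi `&` Lam) n]]].

Definition Omega := g_sigma_algebraType counting_events.

Definition LamL (L : nat) : set 'rV[R]_d :=
  [set y | forall j, - (L%:R / 2) <= y ord0 j <= L%:R / 2].

Definition cube (s : R) (x : 'rV[int]_d) : set 'rV[R]_d :=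
  [set y | forall j, s * (x ord0 j)%:~R <= y ord0 j < s * (x ord0 j)%:~R + s].

Definition as_large (P : probability Omega R) (Q : config -> nat -> Prop) : Prop :=
  exists Om0 : set Omega, [/\ measurable Om0, P Om0 = 1%E &
    forall xi : config, Om0 xi -> exists L0 : nat, forall L : nat, (L0 <= L)%N -> Q xi L].

Definition field01 : Type := 'rV[int]_d -> bool.
Definition cylinders : set (set field01) :=
  [set E | exists (x : 'rV[int]_d) (b : bool), E = [set eta | eta x = b]].
Definition Field01 := g_sigma_algebraType cylinders.

Definition iid_bernoulli (p : R) (mu : probability Field01 R) : Prop :=
  forall (s : seq 'rV[int]_d) (b : 'rV[int]_d -> bool), uniq s ->
    mu [set eta : Field01 | forall x, x \in s -> eta x = b x]
    = (\prod_(x <- s) (if b x then p else 1 - p))%:E.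

Definition increasing_event (A : set Field01) : Prop :=
  forall eta eta' : Field01, (forall x, eta x ==> eta' x) -> A eta -> A eta'.

Definition occ_field (K : R) (xi : Omega) : Field01 :=
  fun x => `[< exists y, cpts xi y /\ cube K x y >].

Definition st_dominates (P : probability Omega R) (sigma : Omega -> Field01)
  (mu : probability Field01 R) : Prop :=
  forall A : set Field01, measurable A -> increasing_event A ->
    (mu A <= P (sigma @^-1` A))%E.

Definition A1 (P : probability Omega R) : Prop :=
  forall p : R, 0 < p < 1 -> exists K : R, 0 < K /\
    forall mu : probability Field01 R, iid_bernoulli p mu ->
      st_dominates P (occ_field K) mu.

Definition kern (alpha : R) (x y : 'rV[R]_d) : R := expR (- (enorm (x - y) `^ alpha)).

Definition RA (alpha : R) (xi : set 'rV[R]_d) (A : set 'rV[R]_d) : \bar R :=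
  \esum_(x in xi `&` A) \esum_(y in xi) (kern alpha x y)%:E.

Definition A2 (alpha : R) (P : probability Omega R) : Prop :=
  forall eps : R, 0 < eps < 1 -> exists C : R,
    as_large P (fun xi L => forall x : 'rV[int]_d,
      (exists y, cube (L%:R `^ eps) x y /\ LamL L y) ->
      (RA alpha (cpts xi) (cube (L%:R `^ eps) x) <= (C * L%:R `^ (eps * d%:R))%:E)%E).

(* xi_L is given by an enumeration s (uniq, [set` s] = xi_L); states are 'I_(size s) *)
Section Chain.
Variables (i : nat) (alpha : R) (s : seq 'rV[R]_d).
Local Notation n := (size s).
Definition pt (k : 'I_n) : 'rV[R]_d := nth 0 s k.

Definition w2 (k : 'I_n) : R := \sum_(z < n | z != k) kern alpha (pt k) (pt z).
Definition wt (k : 'I_n) : R :=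
  if i == 1%N then 1 else if i == 2%N then w2 k else Num.max 1 (w2 k).

Definition gen : 'M[R]_n := \matrix_(k, l)
  if k == l then - \sum_(z < n | z != k) kern alpha (pt k) (pt z) / wt k
  else kern alpha (pt k) (pt l) / wt k.

Definition nu (l : 'I_n) : R := wt l / \sum_(z < n) wt z.

Definition heat (t : R) : 'M[R]_n := \matrix_(k, l)
  limn (fun N => (\sum_(m < N) (t ^+ m / (m`!)%:R) * (gen ^+ m) k l : R)).

(* mixing time (an extended real; inf of the empty set is +oo) *)
Definition mixing_time : \bar R :=
  ereal_inf [set t%:E | t in [set t : R | 0 < t /\
     forall k l : 'I_n, `|heat t k l - nu l| / nu l <= (expR 1)^-1]].
End Chain.

End PointProcess.

(* Main.v *)
(** Cut the box of side [L] into [2^(k d)] cells of bounded side, so that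
    [2^k] is of order [L], and attach to each cell a nearby point of [xi],
    found in the smallest dyadic cube around the cell that is not vacant. If
    this cube has side [2^j], jumps between the representatives of adjacent
    cells have rate at least [expR (- c 2^(j alpha))], while by (A1) the
    density of the cells whose cube of side [2^j] is vacant is at most [expR
    (- delta 2^(j d))]. As [alpha < d], the inverse rates have bounded
    averages over the dyadic cubes of side [L ^ eps], although not pointwise.
    Moving along lines parallel to the axes, this compares the averages of a
    function over dyadic cubes at two successive scales with its Dirichlet
    energy; the loss below scale [L ^ eps], and the weights [w^i] through
    (A2), cost only powers of [L ^ eps]. Hence a Nash inequality with constant
    [4^J] at every scale between [2^(k/2)] and [2^k], and a Poincare
    inequality with constant [4^k]. Spending a time of order [4^J] at scale
    [2^J], the heat kernel is bounded in [L^2] as on a torus after a time of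
    order [4^k], i.e. [L^2], and the Poincare inequality finishes the mixing.
    *)
Require Import Defs.
From HB Require Import structures.
From mathcomp Require Import all_boot all_order all_algebra.
From mathcomp Require Import all_classical all_reals all_analysis.
From mathcomp Require Import zify ring lra.
Import Order.TTheory GRing.Theory Num.Theory numFieldNormedType.Exports.
Set Implicit Arguments.
Unset Strict Implicit.
Unset Printing Implicit Defensive.
Local Open Scope ring_scope.

(** * Averages over dyadic boxes *)

(** Inverse rates are unbounded: vacant regions may have diameters growing with [L], so a path
    argument with worst-case rates would lose an unbounded factor. The gradient is therefore split
    by Cauchy-Schwarz into a cost that does not depend on the function and has bounded averages, and
    an energy density whose sum is at most twice the energy; both carry powers of [2 ^ lev], because
    several cells may share a representative.

    Averages of the cost are controlled only over cubes of side at least [2 ^ jm], with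
    [jm = k %/ B]. Below that, one crude step loses [2 ^ (jm * (3 * d + 2))], which [4 ^ J] absorbs
    from [J = k %/ 2] on; hence the starting scale of the Nash inequality. Waiting there costs
    [4 ^ (k %/ 2)] times the logarithm of a crude bound on [1 / w], of order [k], which is at most
    of order [4 ^ k].

    Nash is kept in linear form, one inequality per scale, so that each scale yields a linear
    differential inequality. The three models enter only through [w <= row_sum] and lower bounds on
    [w], hence one constant for all. *)

Section Dyadic.
Variables (R : realType) (d k : nat).
Local Notation N := (2 ^ k)%N.
Local Notation T := {ffun 'I_d -> 'I_N}.
Implicit Types (x y z : T) (e : 'I_d -> nat) (i : 'I_d) (f h : T -> R).

(** Kernel of the conditional expectation given the dyadic interval of length [2 ^ j]; it has total
    mass 1 only for [j <= k]. *)
Definition ker1 (j : nat) (u v : 'I_N) : R :=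
  if (u %/ 2 ^ j == v %/ 2 ^ j)%N then (2 ^+ j)^-1 else 0.

Lemma ker1_ge0 j u v : 0 <= ker1 j u v.
Proof. by rewrite /ker1; case: ifP => // _; rewrite invr_ge0 exprn_ge0. Qed.

Lemma ker1C j u v : ker1 j u v = ker1 j v u.
Proof. by rewrite /ker1 eq_sym. Qed.

Lemma card_dyadic j (u : 'I_N) : (j <= k)%N ->
  #|[pred v : 'I_N | (u %/ 2 ^ j == v %/ 2 ^ j)%N]| = (2 ^ j)%N.
Proof.
move=> jk.
have bnd (t : 'I_(2 ^ j)) : (u %/ 2 ^ j * 2 ^ j + t < N)%N.
  have h1 : (u %/ 2 ^ j < 2 ^ (k - j))%N.
    by rewrite ltn_divLR ?expn_gt0// -expnD subnK.
  rewrite -[in X in (_ < X)%N](subnK jk) expnD.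
  apply: (@leq_trans ((u %/ 2 ^ j).+1 * 2 ^ j)%N).
    by rewrite mulSn addnC ltn_add2r.
  by rewrite leq_mul2r h1 orbT.
pose F t : 'I_N := Ordinal (bnd t).
have Finj : injective F.
  by move=> s t /(congr1 val)/= /eqP; rewrite eqn_add2l => /eqP/val_inj.
rewrite -[RHS]card_ord -(card_imset _ Finj); apply: eq_card => v; rewrite inE.
apply/idP/idP.
  move=> /eqP uv; apply/imsetP; exists (Ordinal (ltn_pmod v (expn_gt0 2 j))) => //.
  by apply: val_inj; rewrite /= uv -divn_eq.
move/imsetP; case=> t tT e.
by rewrite e /F/= divnMDl ?expn_gt0// (divn_small (ltn_ord t)) addn0.
Qed.

Lemma ker1_sum j u : (j <= k)%N -> \sum_v ker1 j u v = 1.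
Proof.
move=> jk; rewrite -big_mkcond/=.
rewrite (eq_bigl [in [pred v : 'I_N | (u %/ 2 ^ j == v %/ 2 ^ j)%N]])//.
rewrite sumr_const card_dyadic//.
by rewrite -[X in X *+ _]mulr1 -mulrnAr natrX mulVf// expf_neq0// pnatr_eq0.
Qed.

Lemma dyadic_mono a b (u v : nat) : (a <= b)%N ->
  (u %/ 2 ^ a = v %/ 2 ^ a -> u %/ 2 ^ b = v %/ 2 ^ b)%N.
Proof. by move=> ab h; rewrite -(subnKC ab) expnD !divnMA h. Qed.

(** Inside the finer interval of [u] the coarser kernel does not depend on [v], so the finer average
    has no effect. *)
Lemma ker1_comp a b u w : (a <= k)%N -> (b <= k)%N ->
  \sum_v ker1 a u v * ker1 b v w = ker1 (maxn a b) u w.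
Proof.
wlog ab : a b u w / (a <= b)%N => [hw ak bk|].
  case: (leqP a b) => [ab|/ltnW ba]; first by rewrite hw// (maxn_idPr ab).
  have := hw b a w u ba bk ak; rewrite (maxn_idPr ba) ker1C => <-.
  by apply: eq_bigr => v _; rewrite mulrC (ker1C _ v) (ker1C _ u).
move=> ak bk; rewrite (maxn_idPr ab) -[RHS]mul1r -(ker1_sum u ak) big_distrl/=.
apply: eq_bigr => v _; rewrite {1 3}/ker1; case: ifP => [/eqP uv|]; last by rewrite !mul0r.
by rewrite /ker1 (dyadic_mono ab uv).
Qed.

Lemma ker1_dom a b u v : (a <= b)%N -> ker1 a u v <= 2 ^+ (b - a) * ker1 b u v.
Proof.
move=> ab; rewrite {1}/ker1; case: ifP => [/eqP uv|_]; last first.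
  by rewrite mulr_ge0// ?exprn_ge0// ker1_ge0.
rewrite /ker1 (dyadic_mono ab uv) eqxx -[in X in _ <= _ * X^-1](subnKC ab) exprD.
by rewrite invfM mulrCA mulfV ?mulr1// expf_neq0// pnatr_eq0.
Qed.

(** Each axis has its own exponent because [av_diff_le] enlarges a cube axis by axis. *)
Definition kerT e x y : R := \prod_i ker1 (e i) (x i) (y i).

Lemma kerT_ge0 e x y : 0 <= kerT e x y.
Proof. by apply: prodr_ge0 => i _; exact: ker1_ge0. Qed.

Lemma kerTC e x y : kerT e x y = kerT e y x.
Proof. by apply: eq_bigr => i _; exact: ker1C. Qed.

Lemma kerT_sum e x : (forall i, e i <= k)%N -> \sum_y kerT e x y = 1.
Proof.
move=> ek; rewrite /kerT -(bigA_distr_bigA (fun i v => ker1 (e i) (x i) v)).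
by rewrite big1// => i _; rewrite ker1_sum.
Qed.

Lemma kerT_comp e e' x z : (forall i, e i <= k)%N -> (forall i, e' i <= k)%N ->
  \sum_y kerT e x y * kerT e' y z = kerT (fun i => maxn (e i) (e' i)) x z.
Proof.
move=> ek ek'; rewrite (eq_bigr (fun y : T =>
  \prod_i (ker1 (e i) (x i) (y i) * ker1 (e' i) (y i) (z i)))) /kerT; last first.
  by move=> y _; rewrite big_split.
rewrite -(bigA_distr_bigA (fun i v => ker1 (e i) (x i) v * ker1 (e' i) v (z i))).
by apply: eq_bigr => i _; rewrite ker1_comp.
Qed.

Lemma kerT_dom e e' x y : (forall i, e i <= e' i)%N ->
  kerT e x y <= 2 ^+ (\sum_i (e' i - e i)) * kerT e' x y.
Proof.
move=> ee; rewrite /kerT expr_sum -big_split/=.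
by apply: ler_prod => i _; rewrite ker1_ge0 ker1_dom.
Qed.

Definition av e f x : R := \sum_y kerT e x y * f y.

Lemma av_comp e e' f x : (forall i, e i <= k)%N -> (forall i, e' i <= k)%N ->
  av e (av e' f) x = av (fun i => maxn (e i) (e' i)) f x.
Proof.
move=> ek ek'; rewrite /av; under eq_bigr do rewrite big_distrr/=.
rewrite exchange_big/=; apply: eq_bigr => z _; rewrite -kerT_comp// big_distrl/=.
by apply: eq_bigr => y _; rewrite mulrA.
Qed.

Lemma av_const e c x : (forall i, e i <= k)%N -> av e (fun=> c) x = c.
Proof. by move=> ek; rewrite /av -big_distrl/= kerT_sum// mul1r. Qed.

Lemma le_av e f h x : (forall y, f y <= h y) -> av e f x <= av e h x.
Proof. by move=> fh; apply: ler_sum => y _; rewrite ler_wpM2l// kerT_ge0. Qed.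

Lemma av_ge0 e f x : (forall y, 0 <= f y) -> 0 <= av e f x.
Proof. by move=> f0; apply: sumr_ge0 => y _; rewrite mulr_ge0// kerT_ge0. Qed.

Lemma avB e f h x : av e (fun y => f y - h y) x = av e f x - av e h x.
Proof. by rewrite /av -sumrB; apply: eq_bigr => y _; rewrite mulrBr. Qed.

Lemma avZ e c f x : av e (fun y => c * f y) x = c * av e f x.
Proof. by rewrite /av big_distrr/=; apply: eq_bigr => y _; rewrite mulrCA. Qed.

Lemma ler_norm_av e f x : `|av e f x| <= av e (fun y => `|f y|) x.
Proof.
apply: le_trans (ler_norm_sum _ _ _) _; apply: ler_sum => y _.
by rewrite normrM ger0_norm// kerT_ge0.
Qed.

Lemma sum_av e f : (forall i, e i <= k)%N -> \sum_x av e f x = \sum_x f x.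
Proof.
move=> ek; rewrite /av exchange_big/=; apply: eq_bigr => y _.
by rewrite -big_distrl/= (eq_bigr (fun x => kerT e y x)) ?kerT_sum ?mul1r// => x _; exact: kerTC.
Qed.

Lemma av_dom e e' f x : (forall y, 0 <= f y) -> (forall i, e i <= e' i)%N ->
  av e f x <= 2 ^+ (\sum_i (e' i - e i)) * av e' f x.
Proof.
move=> f0 ee; rewrite /av big_distrr/=; apply: ler_sum => y _.
by rewrite mulrA ler_wpM2r// kerT_dom.
Qed.

End Dyadic.

(** * Oscillation along coordinate lines *)

Section Lines.
Variables (R : realType) (d k : nat).
Local Notation N := (2 ^ k)%N.
Local Notation T := {ffun 'I_d -> 'I_N}.
Implicit Types (x y z : T) (e : 'I_d -> nat) (i : 'I_d) (f h : T -> R).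

Definition upd x i (v : 'I_N) : T := [ffun i' => if i' == i then v else x i'].

Definition unit_exp i (j : nat) : 'I_d -> nat := fun i' => if i' == i then j else 0%N.

Lemma ker10 (u v : 'I_N) : ker1 R 0 u v = (u == v)%:R.
Proof.
rewrite /ker1 expn0 !divn1 expr0 invr1.
by rewrite (_ : (u == v :> nat) = (u == v))//; case: ifP.
Qed.

Lemma av_unit i j f x :
  av (unit_exp i j) f x = \sum_v ker1 R j (x i) v * f (upd x i v).
Proof.
rewrite /av (bigID (fun y => upd x i (y i) == y))/= [X in _ + X]big1 ?addr0; last first.
  move=> y ny; rewrite [kerT _ _ _ _](_ : _ = 0) ?mul0r//.
  have /existsP[i' /andP[i'i nyi]] : [exists i', (i' != i) && (x i' != y i')].
    apply: contraNT ny => /existsPn H; apply/eqP/ffunP => i'.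
    rewrite ffunE; case: eqP => [->//|/eqP i'i].
    by have := H i'; rewrite i'i/= negbK => /eqP.
  by rewrite /kerT (bigD1 i')//= {1}/unit_exp (negbTE i'i) ker10 (negbTE nyi) mul0r.
rewrite (reindex_onto (upd x i) (fun y => y i))/=; last by move=> y /eqP.
rewrite (eq_bigl predT) => [|v]; last first.
  by rewrite /= ffunE eqxx !eqxx.
apply: eq_bigr => v _; congr (_ * _).
rewrite /kerT (bigD1 i)//= big1 ?mulr1; last first.
  by move=> i' i'i; rewrite /unit_exp (negbTE i'i) ffunE (negbTE i'i) ker10 eqxx.
by rewrite /unit_exp eqxx ffunE eqxx.
Qed.

Lemma chain_le (F H : 'I_N -> R) : (forall u, 0 <= H u) ->
  (forall u v : 'I_N, v = u.+1 :> nat -> `|F u - F v| <= H u + H v) ->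
  forall a b : 'I_N, (a <= b)%N ->
    `|F a - F b| <= 2 * \sum_(w : 'I_N | (a <= w <= b)%N) H w.
Proof.
move=> H0 Hn a b ab.
(* Interior points occur in two consecutive steps, the last one in a single step; subtracting [H b]
   lets the induction close. *)
suff: `|F a - F b| <= 2 * \sum_(w : 'I_N | (a <= w <= b)%N) H w - H b.
  by move/le_trans; apply; rewrite lerBlDr lerDl.
have [n Hb] : exists n, b = (a + n)%N :> nat by exists (b - a)%N; rewrite subnKC.
elim: n b {ab} Hb => [|n IH] b Hb.
  have -> : b = a by apply: val_inj; rewrite /= Hb addn0.
  rewrite subrr normr0 (big_pred1 a) => [|w]; first by rewrite mulr2n mulrDl !mul1r addrK.
  by rewrite -eqn_leq eq_sym.
have b'N : (a + n < N)%N by apply: leq_trans (ltn_ord b); rewrite Hb addnS.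
pose b' := Ordinal b'N.
have bb' : b = b'.+1 :> nat by rewrite Hb addnS.
have h1 := IH b' erefl; have h2 := Hn b' b bb'.
rewrite (bigD1 b)/=; last by rewrite leqnn andbT Hb leq_addr.
rewrite (eq_bigl (fun w : 'I_N => (a <= w <= b')%N)) => [|w]; last first.
  by rewrite -val_eqE /= bb' /=; lia.
have -> : F a - F b = (F a - F b') + (F b' - F b) by rewrite addrA subrK.
apply: le_trans (ler_normD _ _) _; lra.
Qed.

(** Any two points of a dyadic segment are joined inside it, so their values differ by at most twice
    the sum of [h] over the segment, which is [2 ^ j] times its average. *)
Lemma av_line i j f h x : (j <= k)%N -> (forall y, 0 <= h y) ->
  (forall y z, (forall i', i' != i -> y i' = z i') -> z i = (y i).+1 :> nat ->
     `|f y - f z| <= h y + h z) ->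
  `|f x - av (unit_exp i j) f x| <= 2 ^+ j.+1 * av (unit_exp i j) h x.
Proof.
move=> jk h0 Hn; rewrite !av_unit.
set S := 2 ^+ j.+1 * _.
have upd_line v : v = x i -> upd x i v = x.
  by move=> ->; apply/ffunP => i'; rewrite ffunE; case: eqP => [->|].
have key (v : 'I_N) : (x i %/ 2 ^ j = v %/ 2 ^ j)%N -> `|f x - f (upd x i v)| <= S.
  move=> xv.
  have Hn' (u w : 'I_N) : w = u.+1 :> nat ->
      `|f (upd x i u) - f (upd x i w)| <= h (upd x i u) + h (upd x i w).
    move=> uw; apply: Hn => [i' i'i|]; first by rewrite !ffunE (negbTE i'i).
    by rewrite !ffunE eqxx.
  have main (a b : 'I_N) : (a <= b)%N -> (x i %/ 2 ^ j = a %/ 2 ^ j)%N ->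
      (x i %/ 2 ^ j = b %/ 2 ^ j)%N -> `|f (upd x i a) - f (upd x i b)| <= S.
    move=> ab xa xb.
    apply: le_trans (chain_le (fun _ => h0 _) Hn' ab) _.
    rewrite /S exprS -mulrA ler_pM2l// big_distrr/= big_mkcond/=.
    apply: ler_sum => w _; case: ifP => [/andP[aw wb]|_]; last first.
      by rewrite !mulr_ge0 ?exprn_ge0// ker1_ge0.
    rewrite /ker1 [(_ == _)%N](_ : _ = true); last first.
      apply/eqP/anti_leq; rewrite {1}xa xb !leq_div2r//.
    by rewrite mulrA mulfV ?mul1r// expf_neq0// pnatr_eq0.
  rewrite -{1}(upd_line (x i) erefl).
  by case/orP: (leq_total (x i) v) => xiv; [|rewrite distrC]; apply: main.
have -> : f x = \sum_v ker1 R j (x i) v * f x by rewrite -big_distrl/= ker1_sum// mul1r.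
rewrite -sumrB; apply: le_trans (ler_norm_sum _ _ _) _.
rewrite -[S]mul1r -(ker1_sum R (x i) jk) big_distrl/=; apply: ler_sum => v _.
rewrite -mulrBr normrM ger0_norm ?ker1_ge0//.
rewrite /ker1; case: ifP => [/eqP/key kv|_]; last by rewrite !mul0r.
by rewrite ler_wpM2l// invr_ge0 exprn_ge0.
Qed.

(** One axis is enlarged at a time: [av_line] bounds each change, and the average of [h] over the
    mixed box is compared with that over the full cube at the price of the volume ratio, at most
    [2 ^ ((j' - j) * d)]. *)
Lemma av_diff_le j j' f h x : (j <= j')%N -> (j' <= k)%N -> (forall y, 0 <= h y) ->
  (forall i y z, (forall i', i' != i -> y i' = z i') -> z i = (y i).+1 :> nat ->
     `|f y - f z| <= h y + h z) ->
  `|av (fun=> j) f x - av (fun=> j') f x|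
    <= d%:R * (2 ^+ (j'.+1 + (j' - j) * d) * av (fun=> j') h x).
Proof.
move=> jj' j'k h0 Hn.
(* Intermediate boxes, with side [2 ^ j'] along the first [n] axes and [2 ^ j] along the others. *)
pose e n (i : 'I_d) := if (i < n)%N then j' else j.
have ek n i : (e n i <= k)%N by rewrite /e; case: ifP => // _; exact: leq_trans j'k.
have av_ext e1 e2 (g : T -> R) : e1 =1 e2 -> av e1 g x = av e2 g x.
  by move=> ee; apply: eq_bigr => y _; congr (_ * _); apply: eq_bigr => i _; rewrite ee.
have -> : av (fun=> j) f x = av (e 0%N) f x by exact: av_ext.
have -> : av (fun=> j') f x = av (e d) f x by apply: av_ext => i; rewrite /e ltn_ord.
have step n : (n < d)%N -> `|av (e n) f x - av (e n.+1) f x|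
    <= 2 ^+ (j'.+1 + (j' - j) * d) * av (fun=> j') h x.
  move=> nd; pose i := Ordinal nd.
  have uk i' : (unit_exp i j' i' <= k)%N by rewrite /unit_exp; case: ifP.
  have comp (g : T -> R) : av (e n.+1) g x = av (e n) (av (unit_exp i j') g) x.
    rewrite av_comp//; apply: av_ext => i'; rewrite /e /unit_exp.
    case: (eqVneq i' i) => [->|i'i]/=; first by rewrite ltnSn ltnn (maxn_idPr jj').
    by rewrite maxn0 ltnS leq_eqVlt (_ : (i' == n :> nat) = false)//; apply/negbTE.
  rewrite comp -avB; apply: le_trans (ler_norm_av _ _ _) _.
  apply: (@le_trans _ _ (av (e n) (fun y => 2 ^+ j'.+1 * av (unit_exp i j') h y) x)).
    by apply: le_av => y; apply: av_line => // y' z; exact: Hn.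
  rewrite avZ -comp exprD -mulrA ler_pM2l ?exprn_gt0//.
  apply: le_trans (av_dom x h0 (_ : forall i, e n.+1 i <= j')%N) _.
    by move=> i'; rewrite /e; case: ifP.
  rewrite ler_wpM2r ?av_ge0// ler_weXn2l ?ler1n//.
  apply: (@leq_trans (\sum_(i' < d) (j' - j))%N).
    by apply: leq_sum => i' _; rewrite /e; case: ifP => // _; rewrite subnn.
  by rewrite sum_nat_const card_ord mulnC.
suff H n : (n <= d)%N -> `|av (e 0%N) f x - av (e n) f x|
    <= n%:R * (2 ^+ (j'.+1 + (j' - j) * d) * av (fun=> j') h x) by exact: H.
elim: n => [|n IH] nd; first by rewrite subrr normr0 mul0r.
have -> : av (e 0%N) f x - av (e n.+1) f x
  = (av (e 0%N) f x - av (e n) f x) + (av (e n) f x - av (e n.+1) f x).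
  by rewrite addrA subrK.
apply: le_trans (ler_normD _ _) _.
by rewrite -natr1 mulrDl mul1r lerD ?step// IH// ltnW.
Qed.

End Lines.

(** * Poincare and Nash inequalities *)

(** Cauchy-Schwarz with a termwise hypothesis, so that no square roots of [u] and [v] appear; cross
    terms are bounded by the inequality of arithmetic and geometric means. *)
Lemma sum_sqr_le (R : realFieldType) (I : finType) (x u v : I -> R) :
  (forall i, 0 <= u i) -> (forall i, 0 <= v i) -> (forall i, x i ^+ 2 <= u i * v i) ->
  (\sum_i x i) ^+ 2 <= (\sum_i u i) * (\sum_i v i).
Proof.
move=> u0 v0 xuv.
have key i j : x i * x j <= (u i * v j + u j * v i) / 2.
  have s0 : 0 <= u i * v j + u j * v i by rewrite addr_ge0 ?mulr_ge0.
  rewrite ler_pdivlMr//; apply: le_trans (ler_norm _) _.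
  rewrite -ler_sqr ?nnegrE// -normrX ger0_norm ?exprn_even_ge0//.
  apply: (@le_trans _ _ (4 * ((u i * v i) * (u j * v j)))).
    rewrite !exprMn mulrC (_ : 2 ^+ 2 = 4); last by rewrite -natrX.
    by rewrite ler_pM2l// ler_pM ?sqr_ge0.
  rewrite -subr_ge0 (_ : _ - _ = (u i * v j - u j * v i) ^+ 2); last by ring.
  exact: sqr_ge0.
rewrite expr2 !big_distrl/=.
apply: (@le_trans _ _ (\sum_i \sum_j (u i * v j + u j * v i) / 2)).
  by apply: ler_sum => i _; rewrite big_distrr/=; apply: ler_sum.
rewrite (_ : \sum_i \sum_j _ = (\sum_i \sum_j u i * v j) / 2 + (\sum_i \sum_j u j * v i) / 2).
  rewrite [X in _ + X / _]exchange_big/= -mulrDl -mulr2n -[X in X / _]mulr_natr mulfK ?pnatr_eq0//.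
  by rewrite le_eqVlt; apply/orP; left; apply/eqP/eq_bigr => i _; rewrite big_distrr.
by rewrite !big_distrl/= -big_split/=; apply: eq_bigr => i _;
  rewrite !big_distrl/= -big_split/=; apply: eq_bigr => j _; rewrite mulrDl.
Qed.

Lemma sqrD3_le (R : realFieldType) (x y z : R) :
  (x + y + z) ^+ 2 <= 3 * (x ^+ 2 + y ^+ 2 + z ^+ 2).
Proof.
have := sqr_ge0 (x - y); have := sqr_ge0 (y - z); have := sqr_ge0 (x - z).
rewrite !expr2; nra.
Qed.

Lemma sqrD2_le (R : realFieldType) (x y : R) : (x + y) ^+ 2 <= 2 * (x ^+ 2 + y ^+ 2).
Proof. have := sqr_ge0 (x - y); rewrite !expr2; nra. Qed.

Section Energy.
Variables (R : realType) (d k : nat).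
Local Notation N := (2 ^ k)%N.
Local Notation T := {ffun 'I_d -> 'I_N}.
Local Notation cst j := (fun _ : 'I_d => j).

Definition same_cube (j : nat) (x y : T) := [forall i, x i %/ 2 ^ j == y i %/ 2 ^ j]%N.

Lemma same_cubeC j x y : same_cube j x y = same_cube j y x.
Proof. by apply: eq_forallb => i; rewrite eq_sym. Qed.

Lemma same_cubexx j x : same_cube j x x.
Proof. by apply/forallP. Qed.

Lemma same_cube_trans j x y z : same_cube j x y -> same_cube j y z -> same_cube j x z.
Proof.
by move=> /forallP xy /forallP yz; apply/forallP => i; rewrite (eqP (xy i)).
Qed.

Lemma same_cube_mono j j' x y : (j <= j')%N -> same_cube j x y -> same_cube j' x y.
Proof.
move=> jj' /forallP xy; apply/forallP => i.
exact/eqP/(dyadic_mono jj')/eqP.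
Qed.

Lemma same_cube_top x y : same_cube k x y.
Proof. by apply/forallP => i; rewrite !divn_small. Qed.

Lemma kerT_cst j x y :
  kerT R (cst j) x y = if same_cube j x y then (2 ^+ (j * d))^-1 else 0.
Proof.
rewrite /kerT; case: ifPn => [/forallP xy|/forallPn[i nxy]].
  rewrite (eq_bigr (fun=> (2 ^+ j)^-1)) => [|i _]; last by rewrite /ker1 xy.
  by rewrite prodr_const card_ord exprVn -exprM.
by rewrite (bigD1 i)//= /ker1 (negbTE nxy) mul0r.
Qed.

Lemma kerT_eq j x y z : same_cube j x y -> kerT R (cst j) x z = kerT R (cst j) y z.
Proof.
move=> xy; rewrite !kerT_cst (_ : same_cube j x z = same_cube j y z)//.
apply/idP/idP; first by apply: same_cube_trans; rewrite same_cubeC.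
exact: same_cube_trans.
Qed.

Lemma av_eq j (f : T -> R) x y : same_cube j x y -> av (cst j) f x = av (cst j) f y.
Proof. by move=> xy; apply: eq_bigr => z _; rewrite (kerT_eq _ xy). Qed.

Lemma av_cst_comp a b (f : T -> R) x : (a <= b)%N -> (b <= k)%N ->
  av (cst b) (av (cst a) f) x = av (cst b) f x.
Proof.
by move=> ab bk; rewrite av_comp ?(maxn_idPl ab)// => i; exact: leq_trans bk.
Qed.

Lemma av0 (f : T -> R) x : av (cst 0) f x = f x.
Proof.
rewrite /av (bigD1 x)//= big1 ?addr0 => [|y yx].
  by rewrite kerT_cst same_cubexx mul0n expr0 invr1 mul1r.
rewrite kerT_cst; case: ifPn; last by rewrite mul0r.
move=> /forallP h; case/eqP: yx; apply/ffunP => i.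
by apply: val_inj; have /eqP := h i; rewrite expn0 !divn1.
Qed.

(* [X a] is the cell of the point [a], and [p x] is a point of the dyadic cube of
   level [lev x] around the cell [x]; [g0 j] bounds inverse jump rates at level [j]. *)
Variables (I : finType) (X : I -> T) (r : I -> I -> R) (w : I -> R).
Variables (lev : T -> nat) (p : T -> I) (g0 : nat -> R) (jm : nat) (C1 C2 c0 : R).

Definition adj (x y : T) := exists i, (forall i', i' != i -> x i' = y i') /\
  (y i = (x i).+1 :> nat \/ x i = (y i).+1 :> nat).

Hypothesis r_ge0 : forall a b, 0 <= r a b.
Hypothesis w_ge0 : forall a, 0 <= w a.
Hypothesis g0_ge1 : forall j, 1 <= g0 j.
Hypothesis jm_le : (jm <= k)%N.
Hypothesis p_cube : forall x, same_cube (lev x) (X (p x)) x.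
Hypothesis p_adj : forall x y, adj x y -> (lev y <= lev x)%N ->
  1 <= g0 (lev x) * r (p x) (p y).
Hypothesis p_own : forall a, 1 <= g0 (lev (X a)) * r a (p (X a)).
Hypothesis lev_le : forall x, (lev x <= jm)%N.
Hypothesis C1_ge1 : 1 <= C1.
Hypothesis C2_ge0 : 0 <= C2.
Hypothesis c0_gt0 : 0 < c0.
(* At most [2 ^ (d j)] cells of level [j] share a representative; the additional
   factor [2 ^ j] makes the sum over [j] in [multiplicity_le] converge. *)
Definition Gw x : R := 2 ^+ (d.+1 * lev x) * g0 (lev x).
Hypothesis av_Gw : forall x, av (cst jm) Gw x <= C1.
Hypothesis mass_le : forall x, \sum_a w a * kerT R (cst jm) (X a) x <= C2.
Hypothesis w_rep : forall x, c0 <= w (p x).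

Let g0_ge0 j : 0 <= g0 j. Proof. exact: le_trans (g0_ge1 j). Qed.

Lemma Gw_ge0 x : 0 <= Gw x.
Proof. by rewrite mulr_ge0 ?exprn_ge0. Qed.

(** A cell of level [j] represented by [a] lies in the dyadic cube of side [2 ^ j] around [X a], so
    its weight is [2 ^ -j] times the averaging kernel of that level, and kernels sum to 1. *)
Lemma multiplicity_le a : \sum_(z | p z == a) (2 ^+ (d.+1 * lev z))^-1 <= 2 :> R.
Proof.
apply: (@le_trans _ _ (\sum_z \sum_(j < k.+1) (2 ^+ j)^-1 * kerT R (cst j) (X a) z)).
  rewrite big_mkcond/=; apply: ler_sum => z _.
  have pos (j : 'I_k.+1) : 0 <= (2 ^+ j)^-1 * kerT R (cst j) (X a) z.
    by rewrite mulr_ge0 ?kerT_ge0// invr_ge0 exprn_ge0.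
  case: ifP => [/eqP pz|_]; last exact: sumr_ge0.
  have lk : (lev z < k.+1)%N by rewrite ltnS (leq_trans (lev_le z) jm_le).
  rewrite -pz in pos *; rewrite (bigD1 (Ordinal lk))//= kerT_cst p_cube -invfM -exprD.
  rewrite (_ : lev z + lev z * d = d.+1 * lev z)%N; last by rewrite mulSn mulnC.
  by rewrite lerDl; apply: sumr_ge0.
rewrite exchange_big/=.
rewrite (eq_bigr (fun j : 'I_k.+1 => (2 ^+ j)^-1 : R)) => [|j _]; last first.
  by rewrite -big_distrr/= kerT_sum ?mulr1// => _; rewrite -ltnS.
suff -> n : \sum_(j < n.+1) (2 ^+ j)^-1 = 2 - (2 ^+ n)^-1 :> R.
  by rewrite lerBlDr lerDl invr_ge0 exprn_ge0.
elim: n => [|n IH]; first by rewrite big_ord1 expr0 invr1; ring.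
rewrite big_ord_recr/= IH -addrA; congr (_ + _).
by rewrite exprS invfM; field; rewrite expf_neq0// pnatr_eq0.
Qed.

Section Function.
Variable f : I -> R.

Definition loc_energy a : R := \sum_b r a b * (f a - f b) ^+ 2.
(** Ordered pairs are summed: this is twice the Dirichlet form, and exactly minus the time
    derivative in [is_derive_l2]. *)
Definition energy : R := \sum_a loc_energy a.
Definition trace_fun x : R := f (p x).
Local Notation fh := trace_fun.
Definition grad x : R := Num.sqrt (g0 (lev x) * loc_energy (p x)).
Definition Ww x : R := (2 ^+ (d.+1 * lev x))^-1 * loc_energy (p x).

Lemma loc_energy_ge0 a : 0 <= loc_energy a.
Proof. by apply: sumr_ge0 => b _; rewrite mulr_ge0 ?sqr_ge0. Qed.

Lemma energy_ge0 : 0 <= energy.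
Proof. by apply: sumr_ge0 => b _; exact: loc_energy_ge0. Qed.

Lemma grad_ge0 x : 0 <= grad x. Proof. exact: sqrtr_ge0. Qed.

Lemma Ww_ge0 x : 0 <= Ww x.
Proof. by rewrite mulr_ge0 ?loc_energy_ge0// invr_ge0 exprn_ge0. Qed.

(** The split on which the averaging rests: [Gw] has bounded averages and does not involve [f],
    while [Ww] has its sum bounded by the energy. *)
Lemma grad_sqr x : grad x ^+ 2 = Gw x * Ww x.
Proof.
rewrite sqr_sqrtr ?mulr_ge0 ?loc_energy_ge0//.
by rewrite /Gw /Ww; field; rewrite expf_neq0// pnatr_eq0.
Qed.

Lemma sum_Ww : \sum_x Ww x <= 2 * energy.
Proof.
rewrite (partition_big p predT)//= /energy big_distrr/=; apply: ler_sum => a _.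
rewrite (eq_bigr (fun z => (2 ^+ (d.+1 * lev z))^-1 * loc_energy a)) => [|z /eqP<-//].
by rewrite -big_distrl/= ler_wpM2r ?loc_energy_ge0// multiplicity_le.
Qed.

Lemma jump_le c a b : 0 <= c -> 1 <= c * r a b -> (f a - f b) ^+ 2 <= c * loc_energy a.
Proof.
move=> cge0 crab; rewrite /loc_energy (bigD1 b)//= mulrDr mulrA.
apply: (@le_trans _ _ (c * r a b * (f a - f b) ^+ 2)).
  by rewrite ler_peMl ?sqr_ge0.
by rewrite lerDl mulr_ge0//; apply: sumr_ge0 => b' _; rewrite mulr_ge0 ?sqr_ge0.
Qed.

Lemma fh_adj x y : adj x y -> `|fh x - fh y| <= grad x + grad y.
Proof.
wlog yx : x y / (lev y <= lev x)%N => [hw|] xy.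
  case/orP: (leq_total (lev y) (lev x)) => yx; first exact: hw.
  rewrite distrC [leRHS]addrC; apply: hw => //.
  by case: xy => i [H1 H2]; exists i; split => [i' /H1//|]; case: H2; [right|left].
apply: (@le_trans _ _ (grad x)); last by rewrite lerDl grad_ge0.
rewrite -ler_sqr ?nnegrE ?grad_ge0// -normrX ger0_norm ?sqr_ge0//.
rewrite sqr_sqrtr ?mulr_ge0 ?loc_energy_ge0//.
by apply: jump_le => //; exact: p_adj.
Qed.

Lemma av_Gw_le J x : (jm <= J <= k)%N -> av (cst J) Gw x <= C1.
Proof.
move=> /andP[jJ Jk]; rewrite -(av_cst_comp _ _ jJ Jk) -[C1](av_const C1 x (fun=> Jk)).
exact: le_av.
Qed.

(** By Cauchy-Schwarz the squared average of [grad] is at most [av Gw * av Ww], so inverse rates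
    enter through their average over the larger cube only. *)
Lemma sum_av_diff_le j j' : (j <= j')%N -> (jm <= j' <= k)%N ->
  \sum_x (av (cst j) fh x - av (cst j') fh x) ^+ 2 <=
  (d%:R * 2 ^+ (j'.+1 + (j' - j) * d)) ^+ 2 * (2 * C1 * energy).
Proof.
move=> jj' j'P; have /andP[jj j'k] := j'P.
set c := d%:R * _.
have pt x : (av (cst j) fh x - av (cst j') fh x) ^+ 2 <= c ^+ 2 * (C1 * av (cst j') Ww x).
  apply: (@le_trans _ _ ((c * av (cst j') grad x) ^+ 2)).
    rewrite -[leLHS]ger0_norm ?sqr_ge0// normrX ler_sqr ?nnegrE ?normr_ge0//; last first.
      by rewrite mulr_ge0 ?av_ge0// => [|y]; [rewrite mulr_ge0 ?exprn_ge0|exact: grad_ge0].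
    rewrite -mulrA; apply: av_diff_le => // [y|i y z yz zi]; first exact: grad_ge0.
    by apply: fh_adj; exists i; split => //; left.
  rewrite exprMn ler_wpM2l ?sqr_ge0//.
  apply: (@le_trans _ _ (av (cst j') Gw x * av (cst j') Ww x)).
    apply: sum_sqr_le => y.
    - by rewrite mulr_ge0 ?kerT_ge0 ?Gw_ge0.
    - by rewrite mulr_ge0 ?kerT_ge0 ?Ww_ge0.
    - by rewrite exprMn grad_sqr expr2 mulrACA.
  by rewrite ler_wpM2r ?av_Gw_le// av_ge0// => y; exact: Ww_ge0.
apply: le_trans (ler_sum _ (fun x _ => pt x)) _.
rewrite -big_distrr -big_distrr/= sum_av//.
rewrite ler_wpM2l ?sqr_ge0// -[leRHS]mulrA [leRHS]mulrCA ler_wpM2l ?sum_Ww//.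
exact: le_trans C1_ge1.
Qed.

Let Dc : R := d%:R ^+ 2 * 4 ^+ (d + 2) * (2 * C1 * energy).

Let Dc_ge0 : 0 <= Dc.
Proof.
rewrite !mulr_ge0 ?exprn_ge0 ?energy_ge0//; exact: le_trans C1_ge1.
Qed.

(** Scales are added one by one: the factor 2 of [sqrD2_le], applied to two terms of size
    [4 ^ J * Dc], gives exactly [4 ^ J.+1 * Dc]. *)
Lemma sum_av_macro J : (jm <= J <= k)%N ->
  \sum_x (av (cst jm) fh x - av (cst J) fh x) ^+ 2 <= 4 ^+ J * Dc.
Proof.
move=> /andP[jJ]; rewrite -(subnKC jJ); move: (J - jm)%N => n {J jJ}.
elim: n => [|n IH] nk.
  rewrite addn0 big1 => [|x _]; first by rewrite mulr_ge0 ?exprn_ge0.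
  by rewrite subrr expr0n.
have nk' : (jm + n <= k)%N by apply: leq_trans nk; rewrite addnS.
have IH' := IH nk'.
apply: (@le_trans _ _ (\sum_x 2 * ((av (cst jm) fh x - av (cst (jm + n)) fh x) ^+ 2 +
    (av (cst (jm + n)) fh x - av (cst (jm + n.+1)) fh x) ^+ 2))).
  apply: ler_sum => x _.
  rewrite (_ : _ - _ = (av (cst jm) fh x - av (cst (jm + n)) fh x) +
    (av (cst (jm + n)) fh x - av (cst (jm + n.+1)) fh x)); last by rewrite addrA subrK.
  exact: sqrD2_le.
rewrite -big_distrr/= big_split/=.
have : \sum_x (av (cst (jm + n)) fh x - av (cst (jm + n.+1)) fh x) ^+ 2 <= 4 ^+ (jm + n) * Dc.
  have h1 : (jm + n <= jm + n.+1)%N by rewrite leq_add2l.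
  have h2 : (jm <= jm + n.+1 <= k)%N by rewrite leq_addr nk.
  apply: le_trans (sum_av_diff_le h1 h2) _.
  rewrite (_ : (jm + n.+1).+1 + _ = (jm + n) + (d + 2))%N; last by rewrite addnS subSnn; lia.
  rewrite exprMn -exprM mulnC exprM (_ : 2 ^+ 2 = 4); last by rewrite -natrX.
  by rewrite le_eqVlt; apply/orP; left; apply/eqP; rewrite /Dc exprD; ring.
rewrite addnS exprS; lra.
Qed.

(** [mass_le] controls mass only per cube of side [2 ^ jm]; it may all sit in one cell, hence the
    loss of the volume of the cube. *)
Lemma sum_w_le (u : T -> R) : (forall x, 0 <= u x) ->
  \sum_a w a * u (X a) <= C2 * 2 ^+ (jm * d) * \sum_x u x.
Proof.
move=> u0; rewrite big_distrr/= (partition_big X predT)//=; apply: ler_sum => x _.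
rewrite (eq_bigr (fun a => w a * u x)) => [|a /eqP<-//]; rewrite -big_distrl/=.
rewrite ler_wpM2r//.
have -> : \sum_(a | X a == x) w a = 2 ^+ (jm * d) * \sum_(a | X a == x) w a * kerT R (cst jm) (X a) x.
  rewrite big_distrr/=; apply: eq_bigr => a /eqP ->.
  by rewrite kerT_cst same_cubexx mulrCA mulfV ?mulr1// expf_neq0// pnatr_eq0.
rewrite [leRHS]mulrC ler_wpM2l ?exprn_ge0//; apply: le_trans (mass_le x).
rewrite big_mkcond/=; apply: ler_sum => a _; case: ifP => // _.
by rewrite mulr_ge0 ?kerT_ge0.
Qed.

(** When [u] is constant on cubes of side [2 ^ jm], the position of the mass inside a cube is
    irrelevant and the volume factor of [sum_w_le] disappears. *)
Lemma sum_w_cst_le J (u : T -> R) : (jm <= J)%N -> (forall x, 0 <= u x) ->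
  (forall x, av (cst jm) u x = u x) -> \sum_a w a * u (X a) <= C2 * \sum_x u x.
Proof.
move=> jJ u0 uE; rewrite (eq_bigr (fun a => \sum_x w a * kerT R (cst jm) (X a) x * u x)).
  rewrite exchange_big/= big_distrr/=; apply: ler_sum => x _.
  by rewrite -big_distrl/= ler_wpM2r.
by move=> a _; rewrite -uE /av big_distrr/=; apply: eq_bigr => x _; rewrite mulrA.
Qed.

(** The 3 comes from [sqrD3_le]; the summands belong, in order, to the three pieces of
    [local_poincare]. *)
Definition C3 : R := 3 * C1 * C2 * (1 + 8 * d%:R ^+ 2 + 2 * d%:R ^+ 2 * 4 ^+ (d + 2)).

(** From [f a] one passes to the value at the representative, to its average at scale [jm], then to
    scale [J]. The first two pieces lose powers of [2 ^ jm], absorbed in [4 ^ J] by the second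
    hypothesis; the third loses nothing, being constant on cubes of side [2 ^ jm]. *)
Lemma local_poincare J : (jm <= J <= k)%N -> (jm * (3 * d + 2) <= 2 * J)%N ->
  \sum_a w a * (f a - av (cst J) fh (X a)) ^+ 2 <= C3 * 4 ^+ J * energy.
Proof.
move=> JP jmJ; have /andP[jJ Jk] := JP.
have C10 : 0 <= C1 by exact: le_trans C1_ge1.
have E0 := energy_ge0.
pose t1 a := w a * (f a - fh (X a)) ^+ 2.
pose t2 a := w a * (fh (X a) - av (cst jm) fh (X a)) ^+ 2.
pose t3 a := w a * (av (cst jm) fh (X a) - av (cst J) fh (X a)) ^+ 2.
apply: (@le_trans _ _ (\sum_a 3 * (t1 a + t2 a + t3 a))).
  apply: ler_sum => a _; rewrite /t1 /t2 /t3 -!mulrDr [leRHS]mulrCA ler_wpM2l//.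
  apply: le_trans (sqrD3_le _ _ _); rewrite le_eqVlt; apply/orP; left; apply/eqP; congr (_ ^+ 2); ring.
rewrite -big_distrr/= !big_split/=.
have pow4 : 4 ^+ J = 2 ^+ (2 * J) :> R.
  by rewrite exprM (_ : 2 ^+ 2 = 4)// -natrX.
have small n : (n <= jm * (3 * d + 2))%N -> 2 ^+ n <= 4 ^+ J :> R.
  by move=> nm; rewrite pow4 ler_weXn2l ?ler1n// (leq_trans nm).
(* The weight of one point and the cost of one cell are each bounded by the total over a cube of
   side [2 ^ jm], whose volume is thus lost twice. *)
have b1 : \sum_a t1 a <= C1 * C2 * 4 ^+ J * energy.
  rewrite /energy big_distrr/=; apply: ler_sum => a _.
  have h1 : w a <= C2 * 2 ^+ (jm * d).
    rewrite -ler_pdivrMr ?exprn_gt0//; apply: le_trans (mass_le (X a)).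
    rewrite (bigD1 a)//= kerT_cst same_cubexx lerDl sumr_ge0// => b _.
    by rewrite mulr_ge0 ?kerT_ge0.
  have h2 : g0 (lev (X a)) <= C1 * 2 ^+ (jm * d).
    rewrite -ler_pdivrMr ?exprn_gt0//; apply: le_trans (av_Gw (X a)).
    rewrite /av (bigD1 (X a))//= kerT_cst same_cubexx.
    apply: (@le_trans _ _ ((2 ^+ (jm * d))^-1 * Gw (X a))).
      rewrite mulrC ler_wpM2l ?invr_ge0 ?exprn_ge0// /Gw ler_peMl// exprn_ege1// ler1n//.
    by rewrite lerDl sumr_ge0// => b _; rewrite mulr_ge0 ?kerT_ge0 ?Gw_ge0.
  apply: (@le_trans _ _ ((C2 * 2 ^+ (jm * d)) * (C1 * 2 ^+ (jm * d) * loc_energy a))).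
    rewrite ler_pM ?sqr_ge0//; apply: le_trans (jump_le _ (p_own a)) _ => //.
    by rewrite ler_wpM2r ?loc_energy_ge0.
  rewrite mulrA ler_wpM2r ?loc_energy_ge0//.
  rewrite (_ : C2 * _ * _ = C1 * C2 * (2 ^+ (jm * d) * 2 ^+ (jm * d))); last by ring.
  by rewrite ler_wpM2l ?mulr_ge0// -exprD small//; nia.
have b2 : \sum_a t2 a <= C1 * C2 * (8 * d%:R ^+ 2) * 4 ^+ J * energy.
  apply: le_trans (sum_w_le (fun x => sqr_ge0 (fh x - av (cst jm) fh x))) _.
  have jmP : (jm <= jm <= k)%N by rewrite leqnn.
  have := sum_av_diff_le (leq0n jm) jmP.
  under eq_bigr do rewrite av0; rewrite subn0 => h.
  apply: le_trans (ler_wpM2l _ h) _; first by rewrite mulr_ge0 ?exprn_ge0.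
  (* The worst loss: exponent [jm * d] from the mass and twice [jm + jm * d] from the square, in
     total [jm * (3 * d + 2)]. *)
  rewrite (_ : C2 * _ * _ = C1 * C2 * (8 * d%:R ^+ 2) *
    (2 ^+ (jm * d) * (2 ^+ (jm + jm * d)) ^+ 2) * energy); last first.
    by rewrite addSn (exprS _ (jm + jm * d)); move: (2 ^+ (jm * d)) (2 ^+ (jm + jm * d)) => y z; ring.
  rewrite ler_wpM2r// ler_wpM2l ?mulr_ge0 ?sqr_ge0//.
  by rewrite -exprM -exprD small//; nia.
have b3 : \sum_a t3 a <= C2 * (4 ^+ J * Dc).
  have u0 x : 0 <= (av (cst jm) fh x - av (cst J) fh x) ^+ 2 by exact: sqr_ge0.
  apply: le_trans (sum_w_cst_le jJ u0 _) _ => [x|].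
    rewrite -[RHS](av_const _ x (fun=> jm_le)); apply: eq_bigr => y _.
    rewrite kerT_cst; case: ifP => xy; last by rewrite !mul0r.
    by rewrite (av_eq _ xy) (av_eq _ (same_cube_mono jJ xy)).
  by rewrite ler_wpM2l// sum_av_macro.
apply: (@le_trans _ _ (3 * (C1 * C2 * 4 ^+ J * energy +
   C1 * C2 * (8 * d%:R ^+ 2) * 4 ^+ J * energy + C2 * (4 ^+ J * Dc)))).
  by rewrite ler_pM2l// !lerD.
by rewrite le_eqVlt; apply/orP; left; apply/eqP; rewrite /C3 /Dc; ring.
Qed.

(** At scale [k] there is a single cube, so the local average is a constant. *)
Lemma poincare : (jm * (3 * d + 2) <= 2 * k)%N ->
  exists c, \sum_a w a * (f a - c) ^+ 2 <= C3 * 4 ^+ k * energy.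
Proof.
move=> jmk; have := local_poincare (_ : jm <= k <= k)%N jmk; rewrite jm_le leqnn => /(_ isT).
have [a0 _|noI h] := pickP I; last first.
  by exists 0; rewrite big1 ?mulr_ge0 ?energy_ge0// => [|a]; [|have := noI a]; 
   rewrite ?mulr_ge0 ?exprn_ge0 ?addr_ge0 ?mulr_ge0// ?exprn_ge0// (le_trans _ C1_ge1).
move=> h; exists (av (cst k) fh (X a0)); apply: le_trans h.
by apply: ler_sum => a _; rewrite (av_eq _ (same_cube_top (X a0) (X a))).
Qed.

End Function.

Definition clow : R := c0 / (2 * C1).

Lemma clow_gt0 : 0 < clow.
Proof. by rewrite divr_gt0// mulr_gt0// (lt_le_trans _ C1_ge1). Qed.

(** The product of [2 ^ -(d.+1 * lev)] and [Gw] is [g0 >= 1], so by Cauchy-Schwarz the former has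
    average at least [1 / C1]. Grouping cells by representative turns this into mass: each
    representative weighs at least [c0] and is counted with total weight at most 2. *)
Lemma mass_ge_jm x : clow <= \sum_a w a * kerT R (cst jm) (X a) x.
Proof.
have C10 : 0 < C1 by exact: lt_le_trans C1_ge1.
have inv_av : C1^-1 <= av (cst jm) (fun z => (2 ^+ (d.+1 * lev z))^-1) x.
  rewrite -[leLHS]mul1r ler_pdivrMr//.
  apply: (@le_trans _ _ (av (cst jm) (fun z => (2 ^+ (d.+1 * lev z))^-1) x * av (cst jm) Gw x)); last first.
    by rewrite ler_wpM2l ?av_ge0// => y; rewrite invr_ge0 exprn_ge0.
  apply: (@le_trans _ _ ((\sum_y kerT R (cst jm) x y) ^+ 2)); first by rewrite kerT_sum ?expr1n.
  apply: sum_sqr_le => y.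
  - by rewrite mulr_ge0 ?kerT_ge0// invr_ge0 exprn_ge0.
  - by rewrite mulr_ge0 ?kerT_ge0 ?Gw_ge0.
  - have nz : 2 ^+ (d.+1 * lev y) != 0 :> R by rewrite expf_neq0// pnatr_eq0.
    by rewrite mulrACA -expr2 ler_peMr ?sqr_ge0// /Gw mulrA mulVf ?mul1r.
rewrite /clow invfM [2^-1 * _]mulrC mulrA ler_pdivrMr//.
apply: (@le_trans _ _ (c0 * av (cst jm) (fun z => (2 ^+ (d.+1 * lev z))^-1) x)).
  by rewrite ler_wpM2l// ltW.
rewrite /av (partition_big p predT)//= big_distrr big_distrl/=; apply: ler_sum => a _.
have [z0 /eqP pz0|noz] := pickP (fun z => p z == a); last first.
  by rewrite big_pred0 ?mulr0// !mulr_ge0 ?kerT_ge0.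
rewrite (eq_bigr (fun z => kerT R (cst jm) (X a) x * (2 ^+ (d.+1 * lev z))^-1)); last first.
  move=> z /eqP<-; congr (_ * _); rewrite kerTC; apply: kerT_eq.
  by apply: same_cube_mono (lev_le z) _; rewrite same_cubeC.
rewrite -big_distrr/= mulrA; apply: ler_pM.
- by rewrite mulr_ge0 ?kerT_ge0 ?ltW.
- by apply: sumr_ge0 => z _; rewrite invr_ge0 exprn_ge0.
- by rewrite ler_wpM2r ?kerT_ge0// -pz0.
- exact: multiplicity_le.
Qed.

Lemma mass_ge J x : (jm <= J <= k)%N -> clow <= \sum_a w a * kerT R (cst J) (X a) x.
Proof.
move=> /andP[jJ Jk].
have kE a : kerT R (cst J) (X a) x = \sum_z kerT R (cst jm) (X a) z * kerT R (cst J) z x.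
  by rewrite kerT_comp// (maxn_idPr jJ).
under eq_bigr do rewrite kE big_distrr/=.
rewrite exchange_big/= -[clow](av_const _ x (fun=> Jk)) /av; apply: ler_sum => z _.
under eq_bigr do rewrite mulrA; rewrite -big_distrl/= mulrC kerTC.
by rewrite ler_wpM2r ?kerT_ge0// mass_ge_jm.
Qed.

Lemma total_mass_le : \sum_a w a <= C2 * 2 ^+ (k * d).
Proof.
rewrite (eq_bigr (fun a => \sum_x w a * kerT R (cst jm) (X a) x)) => [|a _]; last first.
  by rewrite -big_distrr/= kerT_sum ?mulr1.
rewrite exchange_big/=; apply: (@le_trans _ _ (\sum_(x : T) C2)); first exact: ler_sum.
by rewrite sumr_const card_ffun !card_ord -expnM -[leLHS]mulr_natr natrX.
Qed.

(** [f] is split around [u], the average at scale [J] of its trace on cells. As [u] is not the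
    [w]-average of [f], the discrepancy [A] is bounded by [local_poincare]; what remains is [B], a
    local [L^1] norm, and [mass_ge] allows division by the mass [m] of the cube. *)
Lemma nash (f : I -> R) J : (jm <= J <= k)%N -> (jm * (3 * d + 2) <= 2 * J)%N ->
  \sum_a w a * f a ^+ 2 <= 6 * C3 * 4 ^+ J * energy f +
    4 / clow * (2 ^+ (J * d))^-1 * (\sum_a w a * `|f a|) ^+ 2.
Proof.
move=> JP jmJ; have LP := local_poincare f JP jmJ; have /andP[jJ Jk] := JP.
have c_gt0 := clow_gt0.
set u := av (cst J) (trace_fun f) in LP *; set S := \sum_a _ in LP.
pose K a x := kerT R (cst J) (X a) x; have K0 a x : 0 <= K a x := kerT_ge0 _ _ _ _.
have KS a : \sum_x K a x = 1 by rewrite kerT_sum.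
pose m x := \sum_a w a * K a x.
pose A x := \sum_a w a * K a x * (u (X a) - f a).
pose B x := \sum_a w a * K a x * `|f a|.
have wK a x : 0 <= w a * K a x by rewrite mulr_ge0.
have m_ge x : clow <= m x by exact: mass_ge.
have B0 x : 0 <= B x by apply: sumr_ge0 => a _; rewrite mulr_ge0.
have muAB x : (m x * u x) ^+ 2 <= 2 * (A x ^+ 2 + B x ^+ 2).
  have -> : m x * u x = A x + \sum_a w a * K a x * f a.
    rewrite -big_split/= big_distrl/=; apply: eq_bigr => a _.
    rewrite -mulrDr subrK /K kerT_cst; case: ifP => Xx; last by rewrite !(mulr0, mul0r).
    by rewrite /u (av_eq _ Xx).
  apply: le_trans (sqrD2_le _ _) _; rewrite ler_pM2l// lerD2l.
  rewrite -[leLHS]ger0_norm ?sqr_ge0// normrX ler_sqr ?nnegrE//.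
  apply: le_trans (ler_norm_sum _ _ _) _; apply: ler_sum => a _.
  by rewrite normrM ger0_norm.
have Asq x : A x ^+ 2 <= m x * \sum_a w a * K a x * (f a - u (X a)) ^+ 2.
  apply: sum_sqr_le => a; [exact: wK|exact: mulr_ge0 (wK a x) (sqr_ge0 _)|].
  by rewrite le_eqVlt; apply/orP; left; apply/eqP; ring.
have mu2 x : m x * u x ^+ 2 <= 2 * (\sum_a w a * K a x * (f a - u (X a)) ^+ 2) + 2 / clow * B x ^+ 2.
  have mx0 : 0 < m x by exact: lt_le_trans (m_ge x).
  rewrite -(ler_pM2l mx0).
  rewrite [leLHS](_ : _ = (m x * u x) ^+ 2); last by rewrite exprMn mulrA -expr2.
  apply: le_trans (muAB x) _; rewrite !mulrDr lerD//.
    by rewrite [leRHS]mulrCA ler_pM2l.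
  rewrite [leRHS]mulrA ler_wpM2r ?sqr_ge0// [leRHS]mulrCA ler_peMr// ler_pdivlMr// mul1r//.
have sum_u : \sum_a w a * u (X a) ^+ 2 <= 2 * S + 2 / clow * ((2 ^+ (J * d))^-1 * (\sum_a w a * `|f a|) ^+ 2).
  have -> : \sum_a w a * u (X a) ^+ 2 = \sum_x m x * u x ^+ 2.
    under [RHS]eq_bigr do rewrite big_distrl/=; rewrite exchange_big/=.
    apply: eq_bigr => a _; rewrite -[in LHS](mulr1 (w a)) -(KS a) big_distrr big_distrl/=.
    apply: eq_bigr => x _; rewrite /K kerT_cst; case: ifP => Xx; last by rewrite !(mulr0, mul0r).
    by rewrite /u (av_eq _ Xx).
  apply: le_trans (ler_sum _ (fun x _ => mu2 x)) _; rewrite big_split/= -!big_distrr/= lerD//.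
    rewrite ler_pM2l// exchange_big/=; apply: ler_sum => a _.
    by rewrite -big_distrl -big_distrr/= KS mulr1.
  have kc0 : 0 <= 2 / clow by apply/ltW/divr_gt0.
  rewrite ler_wpM2l//.
  (* [B] is at most [2 ^ -(J * d)] times the [L^1] norm and sums to that norm, which bounds the sum
     of its squares. *)
  have Ble x : B x <= (2 ^+ (J * d))^-1 * \sum_a w a * `|f a|.
    rewrite big_distrr/=; apply: ler_sum => a _; rewrite mulrAC mulrC ler_wpM2r ?mulr_ge0//.
    by rewrite /K kerT_cst; case: ifP => // _; rewrite invr_ge0 exprn_ge0.
  have sB : \sum_x B x = \sum_a w a * `|f a|.
    by rewrite exchange_big/=; apply: eq_bigr => a _; rewrite -big_distrl -big_distrr/= KS mulr1.
  apply: (@le_trans _ _ (\sum_x (2 ^+ (J * d))^-1 * (\sum_a w a * `|f a|) * B x)).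
    by apply: ler_sum => x _; rewrite expr2 ler_wpM2r.
  by rewrite -big_distrr/= sB expr2 mulrA.
(* Together with twice [sum_u] this produces the constants 6 and [4 / clow]. *)
apply: (@le_trans _ _ (2 * S + 2 * \sum_a w a * u (X a) ^+ 2)).
  rewrite /S !big_distrr -big_split/=; apply: ler_sum => a _.
  rewrite (_ : _ + _ = w a * (2 * ((f a - u (X a)) ^+ 2 + u (X a) ^+ 2))); last by ring.
  by rewrite ler_wpM2l//; apply: le_trans (sqrD2_le _ _); rewrite subrK.
rewrite [X in _ <= _ + X](_ : _ =
  2 * (2 / clow * ((2 ^+ (J * d))^-1 * (\sum_a w a * `|f a|) ^+ 2))); last by ring.
move: sum_u; move: (2 / clow * _) => y; lra.
Qed.

End Energy.

(** * Matrix exponentials *)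

Section ScalarDerivatives.
Variable R : realType.
Implicit Types f g : R -> R.

Lemma is_derive1M f g (t df dg : R) : is_derive t (1 : R) f df -> is_derive t (1 : R) g dg ->
  is_derive t (1 : R) (fun s => f s * g s) (df * g t + f t * dg).
Proof.
move=> hf hg; have h := is_deriveM hf hg.
by apply: is_derive_eq h _; rewrite addrC; congr (_ + _); rewrite mulrC.
Qed.

Lemma is_derive1_sum n (h : 'I_n -> R -> R) (t : R) (dh : 'I_n -> R) :
  (forall i, is_derive t (1 : R) (h i) (dh i)) ->
  is_derive t (1 : R) (fun s => \sum_i h i s) (\sum_i dh i).
Proof.
move=> hd; have := is_derive_sum hd.
by rewrite (_ : \sum_i h i = fun s => \sum_i h i s)//; apply/funext => s; rewrite fct_sumE.
Qed.

Lemma is_derive1Z (c : R) f (t df : R) : is_derive t (1 : R) f df ->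
  is_derive t (1 : R) (fun s => c * f s) (c * df).
Proof. by move=> hf; exact: (is_deriveZ c hf). Qed.

Lemma is_derive1_flip (c : R) f (t df : R) : is_derive (c - t) (1 : R) f df ->
  is_derive t (1 : R) (fun s => f (c - s)) (- df).
Proof.
move=> hf; have hg : is_derive t (1 : R) (fun s => c - s) (0 - 1).
  exact: (is_deriveB (is_derive_cst c t 1) (is_derive_id t 1)).
have h := @is_derive1_comp _ f (fun s => c - s) _ _ _ hf hg.
by apply: is_derive_eq h _; rewrite sub0r mulrN1.
Qed.

Lemma is_derive1_shift (c : R) f (t df : R) : is_derive (t + c) (1 : R) f df ->
  is_derive t (1 : R) (fun s => f (s + c)) df.
Proof.
move=> hf; have hg : is_derive t (1 : R) (fun s => s + c) (1 + 0).
  exact: (is_deriveD (is_derive_id t 1) (is_derive_cst c t 1)).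
have h := @is_derive1_comp _ f (fun s => s + c) _ _ _ hf hg.
by apply: is_derive_eq h _; rewrite addr0 mulr1.
Qed.

Lemma is_derive1_expZ (c t : R) :
  is_derive t (1 : R) (fun s => expR (c * s)) (c * expR (c * t)).
Proof.
have h := @is_derive1_comp _ expR ( *%R c) _ _ _ (is_derive_expR (c * t)) (is_derive1Z c (is_derive_id t 1)).
by apply: is_derive_eq h _; rewrite mulr1 mulrC.
Qed.

Lemma is_derive_le0_nonincr f (df : R -> R) (a b : R) : a <= b ->
  (forall t, is_derive t (1 : R) f (df t)) ->
  (forall t, a <= t -> df t <= 0) -> f b <= f a.
Proof.
move=> ab hf df0; have [|c] := MVT_segment ab (fun t _ => hf t).
  apply/continuous_subspaceT => r; exact/differentiable_continuous/derivable1_diffP.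
rewrite in_itv/= => /andP[ac cb] fE; rewrite -subr_le0 fE.
by rewrite mulr_le0_ge0 ?subr_ge0// df0.
Qed.

End ScalarDerivatives.

Section MatrixExponential.
Variables (R : realType) (n : nat).
Implicit Types (A B : 'M[R]_n) (k l z : 'I_n) (s t : R).

(** Written with [pseries] so that termwise differentiation of power series applies; [heatE]
    identifies it with [heat]. *)
Definition mexp A t k l : R := limn (pseries (fun m => (A ^+ m) k l / m`!%:R) t).

Lemma mxpow_le A : exists2 C, 0 <= C & forall m k l, `|(A ^+ m) k l| <= C ^+ m.
Proof.
pose C := \sum_k \sum_l `|A k l|.
exists C; first by apply: sumr_ge0 => k _; apply: sumr_ge0 => l _.
elim=> [|m IH] k l.
  by rewrite expr0 mxE normr_nat lern1 leq_b1.
rewrite exprS -mulmxE mxE; apply: le_trans (ler_norm_sum _ _ _) _.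
rewrite exprS; apply: (@le_trans _ _ (\sum_z `|A k z| * C ^+ m)).
  by apply: ler_sum => z _; rewrite normrM ler_wpM2l.
rewrite -big_distrl/= ler_wpM2r ?exprn_ge0//.
  by apply: sumr_ge0 => k' _; apply: sumr_ge0 => l' _.
rewrite [leRHS](bigD1 k)//= lerDl; apply: sumr_ge0 => k' _; exact: sumr_ge0.
Qed.

(** The shift [q] covers formal derivatives: [q] differentiations turn [A ^+ m] into [A ^+ (m + q)],
    and [is_derive_mexp] needs [q] up to 2. *)
Lemma is_cvg_mexp A q t k l :
  cvgn (pseries (fun m => (A ^+ (m + q)) k l / m`!%:R) t).
Proof.
have [C C0 hC] := mxpow_le A.
apply: normed_cvg; rewrite /normed_series_of /=.
apply: (@series_le_cvg _ _ (fun m => C ^+ q *: exp_coeff (C * `|t|) m)) => [m|m|m|].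
- by [].
- by rewrite mulr_ge0 ?exprn_ge0// exp_coeff_ge0 ?mulr_ge0.
- rewrite normrM normrM normfV normr_nat normrX /exp_coeff/= exprMn.
  rewrite [leRHS](_ : _ = (C ^+ (m + q) / m`!%:R) * `|t| ^+ m); last first.
    by rewrite exprD /GRing.scale/=; ring.
  by rewrite ler_wpM2r ?exprn_ge0// ler_wpM2r ?invr_ge0.
- exact/is_cvg_seriesZ/is_cvg_series_exp_coeff.
Qed.

Lemma is_derive_mexp A t k l : is_derive t (1 : R) (fun s => mexp A s k l)
  (limn (pseries (fun m => (A ^+ m.+1) k l / m`!%:R) t)).
Proof.
have pd q : pseries_diffs (fun m => (A ^+ (m + q)) k l / m`!%:R) =
    (fun m => (A ^+ (m + q.+1)) k l / m`!%:R).
  apply/funext => m; rewrite /pseries_diffs factS natrM invfM addSnnS.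
  by rewrite mulrCA; congr (_ * _); rewrite mulrA mulfV ?pnatr_eq0// mul1r.
have e0 : (fun m => (A ^+ m) k l / m`!%:R) = (fun m => (A ^+ (m + 0)) k l / m`!%:R).
  by apply/funext => m; rewrite addn0.
have e1 : (fun m => (A ^+ m.+1) k l / m`!%:R) = (fun m => (A ^+ (m + 1)) k l / m`!%:R).
  by apply/funext => m; rewrite addn1.
rewrite /mexp e0 e1 -pd; apply: (@pseries_snd_diffs _ _ (`|t| + 1)); rewrite ?pd.
- exact: is_cvg_mexp.
- exact: is_cvg_mexp.
- exact: is_cvg_mexp.
- by rewrite [ltRHS]ger0_norm ?addr_ge0// ltrDl.
Qed.

Lemma lim_pseries_sum (c : 'I_n -> R) (u : 'I_n -> nat -> R) t :
  (forall z, cvgn (pseries (u z) t)) ->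
  limn (pseries (fun m => \sum_z c z * u z m) t) = \sum_z c z * limn (pseries (u z) t).
Proof.
move=> cu; apply/cvg_lim => //.
rewrite (_ : pseries _ t = fun N => \sum_z c z * pseries (u z) t N).
  apply: cvg_big => [|z _]; first exact: add_continuous.
  by apply: cvgM; [exact: cvg_cst|exact: cu].
apply/funext => N; rewrite /pseries /series/=.
under eq_bigr do rewrite big_distrl/=; rewrite exchange_big/=.
by apply: eq_bigr => z _; rewrite big_distrr/=; apply: eq_bigr => m _; rewrite mulrA.
Qed.

Lemma is_derive_mexp_l A t k l :
  is_derive t (1 : R) (fun s => mexp A s k l) (\sum_z A k z * mexp A t z l).
Proof.
apply: is_derive_eq (is_derive_mexp A t k l) _.
rewrite -lim_pseries_sum => [|z].
  congr (limn (pseries _ t)); apply/funext => m.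
  by rewrite exprS -mulmxE mxE big_distrl/=; apply: eq_bigr => z _; rewrite mulrA.
by have := @is_cvg_mexp A 0 t z l; under eq_fun do rewrite addn0.
Qed.

Lemma is_derive_mexp_r A t k l :
  is_derive t (1 : R) (fun s => mexp A s k l) (\sum_z mexp A t k z * A z l).
Proof.
apply: is_derive_eq (is_derive_mexp A t k l) _.
rewrite (eq_bigr (fun z => A z l * mexp A t k z)) => [|z _]; last by rewrite mulrC.
rewrite -lim_pseries_sum => [|z].
  congr (limn (pseries _ t)); apply/funext => m.
  rewrite exprSr -mulmxE mxE big_distrl/=; apply: eq_bigr => z _.
  by rewrite mulrAC mulrC.
by have := @is_cvg_mexp A 0 t k z; under eq_fun do rewrite addn0.
Qed.

Lemma mexp0 A k l : mexp A 0 k l = (k == l)%:R.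
Proof.
apply: lim_near_cst => //; near=> N.
have [m ->] : exists m, N = m.+1.
  by exists N.-1; rewrite prednK //; near: N; exists 1%N.
rewrite /pseries /series/= big_nat_recl//= expr0 mxE fact0 invr1 !mulr1.
by rewrite big1 ?addr0// => i _; rewrite (expr0n _ i.+1) mulr0.
Unshelve. all: by end_near. Qed.

(** The product of [mexp A (t - s)] and [Y s] has zero derivative in [s]; its values at [s = t] and
    [s = 0] are the two sides. *)
Lemma mexp_unique A (Y : R -> 'I_n -> R) :
  (forall t k, is_derive t (1 : R) (fun s => Y s k) (\sum_z A k z * Y t z)) ->
  forall t k, Y t k = \sum_z mexp A t k z * Y 0 z.
Proof.
move=> hY t k.
pose g s := \sum_z mexp A (t - s) k z * Y s z.
have g' s : is_derive s (1 : R) g 0.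
  apply: is_derive_eq (is_derive1_sum (fun z => is_derive1M
    (is_derive1_flip (is_derive_mexp_r A (t - s) k z)) (hY s z))) _.
  rewrite big_split/=; apply/eqP; rewrite addr_eq0; apply/eqP.
  rewrite (eq_bigr (fun z => - \sum_z' mexp A (t - s) k z' * A z' z * Y s z)).
    rewrite sumrN; congr (- _); rewrite exchange_big/=; apply: eq_bigr => z _.
    by rewrite big_distrr/=; apply: eq_bigr => z' _; rewrite mulrA.
  by move=> z _; rewrite mulNr big_distrl.
have -> : Y t k = g t.
  rewrite /g subrr (bigD1 k)//= mexp0 eqxx mul1r big1 ?addr0// => z zk.
  by rewrite mexp0 eq_sym (negbTE zk) mul0r.
by rewrite (is_derive_0_is_cst t 0 g') /g subr0.
Qed.

Lemma mexpD A s t k l : mexp A (t + s) k l = \sum_z mexp A t k z * mexp A s z l.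
Proof.
pose Y u k' := mexp A (u + s) k' l.
have hY u k' : is_derive u (1 : R) (fun r => Y r k') (\sum_z A k' z * Y u z).
  apply: (is_derive1_shift (f := fun u => mexp A u k' l)); exact: is_derive_mexp_l.
rewrite -/(Y t k) (mexp_unique hY); apply: eq_bigr => z _; by rewrite /Y add0r.
Qed.

(** Adding a large multiple [c] of the identity makes all powers entrywise nonnegative;
    [mexp_unique] shows that this multiplies the exponential by [expR (c * t)]. *)
Lemma mexp_ge0 A t k l : (forall k' l', k' != l' -> 0 <= A k' l') -> 0 <= t ->
  0 <= mexp A t k l.
Proof.
move=> A0 t0.
pose c := \sum_z `|A z z|.
pose B := A + c%:M.
have B0 m k' l' : 0 <= (B ^+ m) k' l'.
  elim: m k' l' => [|m IH] k' l'; first by rewrite expr0 mxE ler0n.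
  rewrite exprS -mulmxE mxE; apply: sumr_ge0 => z _; apply: mulr_ge0 => //.
  rewrite !mxE; case: eqVneq => [->|k'z]; last by rewrite mulr0n addr0 A0.
  rewrite mulr1n -lerBlDl sub0r; apply: (@le_trans _ _ `|A z z|).
    by rewrite -normrN ler_norm.
  by rewrite /c (bigD1 z)//= lerDl sumr_ge0.
have hB : 0 <= mexp B t k l.
  apply: limr_ge.
    by have := @is_cvg_mexp B 0 t k l; under eq_fun do rewrite addn0.
  near=> N; apply: sumr_ge0 => m _; rewrite !mulr_ge0 ?exprn_ge0// invr_ge0//.
suff -> : mexp A t k l = expR (- c * t) * mexp B t k l by rewrite mulr_ge0 ?expR_ge0.
pose Y s z := expR (- c * s) * mexp B s z l.
suff hY s z : is_derive s (1 : R) (fun r => Y r z) (\sum_z' A z z' * Y s z').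
  have := mexp_unique hY t k; rewrite -/(Y t k) => ->.
  rewrite (bigD1 l)//= /Y mulr0 expR0 mexp0 eqxx !mulr1 big1 ?addr0// => z zl.
  by rewrite mexp0 (negbTE zl) !mulr0.
apply: is_derive_eq (is_derive1M (is_derive1_expZ (- c) s) (is_derive_mexp_l B s z l)) _.
rewrite [X in _ + _ * X](eq_bigr (fun z' => A z z' * mexp B s z' l +
   c *+ (z == z') * mexp B s z' l)) => [|z' _]; last by rewrite !mxE mulrDl.
rewrite big_split/= [X in _ + _ * (_ + X)](bigD1 z)//= eqxx mulr1n.
rewrite [X in _ + _ * (_ + (_ + X))]big1 => [|z' zz']; last first.
  by rewrite eq_sym (negbTE zz') mulr0n mul0r.
rewrite [RHS](eq_bigr (fun z' => expR (- c * s) * (A z z' * mexp B s z' l))) => [|z' _].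
  by rewrite -big_distrr/=; ring.
by rewrite mulrCA.
Unshelve. all: by end_near. Qed.

Lemma mexp_row_sum A t k : (forall k', \sum_l A k' l = 0) -> \sum_l mexp A t k l = 1.
Proof.
move=> A0; pose g s := \sum_l mexp A s k l.
have g' s : is_derive s (1 : R) g 0.
  apply: is_derive_eq (is_derive1_sum (fun l => is_derive_mexp_r A s k l)) _.
  rewrite exchange_big/=; apply: big1 => z _.
  by rewrite -big_distrr/= A0 mulr0.
rewrite -/(g t) (is_derive_0_is_cst t 0 g') /g (bigD1 k)//= mexp0 eqxx.
by rewrite big1 ?addr0// => l lk; rewrite mexp0 eq_sym (negbTE lk).
Qed.

(** By detailed balance [v l / v z * mexp A s l z], as a function of [z], solves the backward
    equation of [mexp A s z l] with the same initial value. *)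
Lemma mexp_reversible A (v : 'I_n -> R) t k l : (forall z, v z != 0) ->
  (forall k' l', v k' * A k' l' = v l' * A l' k') -> v k * mexp A t k l = v l * mexp A t l k.
Proof.
move=> v0 vA; pose Y s z := v l / v z * mexp A s l z.
have hY s z : is_derive s (1 : R) (fun s => Y s z) (\sum_z' A z z' * Y s z').
  apply: is_derive_eq (is_derive1Z (v l / v z) (is_derive_mexp_r A s l z)) _.
  rewrite big_distrr/=; apply: eq_bigr => z' _; rewrite /Y.
  apply: (mulfI (v0 z)); rewrite [RHS]mulrA vA; field.
  by rewrite !v0.
have := mexp_unique hY t k; rewrite (bigD1 l)//= big1 ?addr0 => [|z zl].
  rewrite /Y mexp0 eqxx mulr1 mulfV// mulr1 => <-; field; exact: v0.
by rewrite /Y mexp0 eq_sym (negbTE zl) !mulr0.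
Qed.

End MatrixExponential.

(** * From the Nash inequality to mixing *)

(** Gronwall: [expR (s / S) * (u s - B)] is nonincreasing from [t0] on. *)
Lemma exp_decay (R : realType) (u du : R -> R) (S B t0 t : R) : 0 < S -> t0 <= t ->
  (forall s, is_derive s (1 : R) u (du s)) ->
  (forall s, t0 <= s -> u s - B <= - S * du s) ->
  u t - B <= expR (- (S^-1 * (t - t0))) * (u t0 - B).
Proof.
move=> S0 t0t hu dec.
pose F s := expR (S^-1 * s) * (u s - B).
have hF s : is_derive s (1 : R) F (S^-1 * expR (S^-1 * s) * (u s - B) + expR (S^-1 * s) * du s).
  apply: is_derive1M; first exact: is_derive1_expZ.
  by apply: is_derive_eq (is_deriveB (hu s) (is_derive_cst B s 1)) _; rewrite subr0.
have FF : F t <= F t0.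
  apply: (is_derive_le0_nonincr t0t hF) => s /dec h.
  rewrite (_ : _ + _ = S^-1 * expR (S^-1 * s) * ((u s - B) + S * du s)); last first.
    by field; rewrite gt_eqF.
  rewrite mulr_ge0_le0// ?mulr_ge0 ?invr_ge0 ?expR_ge0 ?(ltW S0)//.
  by rewrite -lerBrDr sub0r -mulNr.
rewrite -(ler_pM2l (expR_gt0 (S^-1 * t))); apply: le_trans FF _.
rewrite /F mulrA -expRD le_eqVlt; apply/orP; left; apply/eqP; congr (expR _ * _); ring.
Qed.

Section Decay.
Variables (R : realType) (n d k j0 : nat) (A : 'M[R]_n) (w : 'I_n -> R) (r : 'I_n -> 'I_n -> R).
Variables (S Q M Th La : R).
Hypothesis w_gt0 : forall a, 0 < w a.
Hypothesis r_ge0 : forall a b, 0 <= r a b.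
Hypothesis rC : forall a b, r a b = r b a.
Hypothesis A_off : forall a b, a != b -> A a b = r a b / w a.
Hypothesis A_row : forall a, \sum_b A a b = 0.
Hypothesis S_gt0 : 0 < S.
Hypothesis Q_gt0 : 0 < Q.
Hypothesis Th_ge0 : 0 <= Th.
Hypothesis La_ge0 : 0 <= La.
Hypothesis j0k : (j0 <= k)%N.
Hypothesis nash_ineq : forall (f : 'I_n -> R) J, (j0 <= J <= k)%N ->
  \sum_a w a * f a ^+ 2 <= S * 4 ^+ J * energy r f +
    Q * (2 ^+ (J * d))^-1 * (\sum_a w a * `|f a|) ^+ 2.
Hypothesis gap_ineq : forall f : 'I_n -> R,
  exists c, \sum_a w a * (f a - c) ^+ 2 <= S * 4 ^+ k * energy r f.
Hypothesis mass_ineq : \sum_a w a <= M * 2 ^+ (k * d).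
Hypothesis w_ineq : forall a, (w a)^-1 <= expR Th * (Q * (2 ^+ (k * d))^-1).
Hypothesis La_ineq : 2 * M * Q <= expR (La - 1).

Let Z := \sum_a w a.
Let E := energy r.

(** Density relative to the unnormalised weight; its equilibrium value is [Z^-1]. *)
Definition dens x t y := mexp A t x y / w y.
Definition l2 x t := \sum_y w y * dens x t y ^+ 2.

Let w_neq0 a : w a != 0. Proof. by rewrite gt_eqF. Qed.

Lemma gen_reversible a b : w a * A a b = w b * A b a.
Proof.
have [->//|ab] := eqVneq a b.
rewrite A_off// A_off 1?eq_sym// rC; field.
by rewrite !w_neq0.
Qed.

Lemma gen_form (g : 'I_n -> R) y :
  \sum_z w y * A y z * g z = \sum_z r y z * (g z - g y).
Proof.
have -> : \sum_z w y * A y z * g z = \sum_z w y * A y z * (g z - g y).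
  rewrite [RHS](eq_bigr (fun z => w y * A y z * g z - w y * g y * A y z)); last by move=> z _; ring.
  by rewrite sumrB -[X in _ - X]big_distrr/= A_row mulr0 subr0.
apply: eq_bigr => z _; have [->|yz] := eqVneq y z; first by rewrite subrr !mulr0.
by rewrite A_off//; congr (_ * _); rewrite mulrCA mulfV ?mulr1.
Qed.

Lemma is_derive_dens x t y :
  is_derive t (1 : R) (fun s => dens x s y) (\sum_z A y z * dens x t z).
Proof.
rewrite /dens; have h := is_derive1Z (w y)^-1 (is_derive_mexp_r A t x y).
have -> : (fun s => mexp A s x y / w y) = (fun s => (w y)^-1 * mexp A s x y).
  by apply/funext => s; rewrite mulrC.
apply: is_derive_eq h _; rewrite big_distrr/=; apply: eq_bigr => z _.
apply: (mulfI (w_neq0 y)); rewrite [RHS]mulrA gen_reversible; field.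
by rewrite !w_neq0.
Qed.

Lemma is_derive_l2 x t : is_derive t (1 : R) (l2 x) (- E (dens x t)).
Proof.
set g := dens x t.
have h := is_derive1_sum (fun y => is_derive1Z (w y)
   (is_derive1M (is_derive_dens x t y) (is_derive_dens x t y))).
apply: is_derive_eq h _; rewrite -/g.
have -> : \sum_y w y * ((\sum_z A y z * g z) * dens x t y + dens x t y * \sum_z A y z * g z)
  = \sum_y \sum_z 2 * g y * (r y z * (g z - g y)).
  apply: eq_bigr => y _; rewrite -big_distrr/= -gen_form.
  have -> : \sum_z w y * A y z * g z = w y * \sum_z A y z * g z.
    by rewrite big_distrr/=; apply: eq_bigr => z _; rewrite mulrA.
  by rewrite -/(g y); ring.
rewrite /E /energy /loc_energy -sumrN.
(* The double sum is taken twice, with [y] and [z] exchanged in one copy; symmetry of [r] then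
   produces the squares. *)
apply: (@mulfI _ 2); first by rewrite pnatr_eq0.
rewrite mulr_natl mulr2n {2}exchange_big/= -big_split/= mulr_sumr; apply: eq_bigr => y _.
rewrite -big_split/= mulrN mulr_sumr -sumrN; apply: eq_bigr => z _.
by rewrite (rC z y); ring.
Qed.

Lemma sum_dens x t : \sum_y w y * dens x t y = 1.
Proof.
rewrite -[RHS](mexp_row_sum t x A_row); apply: eq_bigr => y _.
by rewrite /dens mulrC divfK.
Qed.

Lemma dens_ge0 x t y : 0 <= t -> 0 <= dens x t y.
Proof.
move=> t0; apply: divr_ge0; last exact: ltW.
by apply: mexp_ge0 => // k' l' kl; rewrite A_off// divr_ge0// ltW.
Qed.

(** The density keeps [L^1] norm 1, so the linear Nash inequality at scale [J] is a differential
    inequality with relaxation time [S * 4 ^ J] towards an inverse volume. *)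
Lemma l2_decay_nash x t0 t J : 0 <= t0 <= t -> (j0 <= J <= k)%N ->
  l2 x t - Q * (2 ^+ (J * d))^-1 <=
    expR (- ((S * 4 ^+ J)^-1 * (t - t0))) * (l2 x t0 - Q * (2 ^+ (J * d))^-1).
Proof.
move=> /andP[t00 t0t] JP; apply: exp_decay => // [|s|s t0s].
- by rewrite mulr_gt0 ?exprn_gt0.
- exact: is_derive_l2.
have := nash_ineq (dens x s) JP.
have -> : \sum_y w y * `|dens x s y| = 1.
  rewrite -(sum_dens x s); apply: eq_bigr => y _.
  by rewrite ger0_norm// dens_ge0// (le_trans t00).
by rewrite expr1n mulr1 -lerBlDr mulNr mulrN opprK.
Qed.

Lemma Z_gt0 (x : 'I_n) : 0 < Z.
Proof.
apply: lt_le_trans (w_gt0 x) _; rewrite /Z (bigD1 x)//= lerDl sumr_ge0// => y _.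
exact: ltW.
Qed.

Let ball J : R := Q * (2 ^+ (J * d))^-1.

Lemma expRN_le (m : nat) : expR (- m%:R) <= (2 ^+ m)^-1 :> R.
Proof.
rewrite expRN lef_pV2 ?posrE ?expR_gt0 ?exprn_gt0//.
rewrite -[X in expR X]mulr1 mulrC expRM_natr lerXn2r ?nnegrE ?expR_ge0//.
by apply: le_trans (expR_ge1Dx 1).
Qed.

(* [S * 4 ^ j0 * Th] is the time needed at the starting scale [j0] to overcome the
   crude bound [w_ineq]; the rest sums the times [S * 4 ^ J' * d.+1], [J' <= J]. *)
Definition phase J : R := S * (4 ^+ j0 * Th + 2 * d.+1%:R * 4 ^+ J).

(** At scale [j0] the factor [expR (- Th)] brings the initial value [(w x)^-1] below
    [ball k <= ball j0]; from there the scale is doubled step by step. *)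
Lemma l2_phase x J t : (j0 <= J <= k)%N -> phase J <= t -> l2 x t <= 2 * ball J.
Proof.
move=> /andP[jJ]; rewrite -(subnKC jJ); move: (J - j0)%N => m {J jJ}.
have S0 := ltW S_gt0; have Q0 := ltW Q_gt0.
elim: m t => [|m IH] t Jk ht.
  rewrite addn0 in Jk ht *.
  have t0 : 0 <= t.
    by apply: le_trans ht; rewrite !mulr_ge0// addr_ge0 ?mulr_ge0 ?exprn_ge0.
  have := @l2_decay_nash x 0 t j0 _ _; rewrite lexx t0 leqnn j0k => /(_ isT isT).
  rewrite -/(ball j0) subr0 => h.
  have l20 : l2 x 0 = (w x)^-1.
    rewrite /l2 (bigD1 x)//= /dens mexp0 eqxx big1 ?addr0 => [|y yx].
      by rewrite mulr1n mul1r expr2 mulVKf.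
    by rewrite mexp0 eq_sym (negbTE yx) mul0r expr0n mulr0.
  have Bk : ball k <= ball j0.
    rewrite ler_wpM2l// lef_pV2 ?posrE ?exprn_gt0// ler_weXn2l ?ler1n//.
    by rewrite leq_mul2r j0k orbT.
  have B0 J : 0 <= ball J by rewrite mulr_ge0// invr_ge0 exprn_ge0.
  have e1 : expR (- ((S * 4 ^+ j0)^-1 * t)) <= expR (- Th).
    rewrite ler_expR lerN2 mulrC ler_pdivlMr ?mulr_gt0 ?exprn_gt0//.
    apply: le_trans ht; rewrite /phase mulrDr (_ : Th * _ = S * (4 ^+ j0 * Th)); last by ring.
    by rewrite lerDl !mulr_ge0 ?exprn_ge0.
  have e2 : expR (- Th) * (w x)^-1 <= ball k.
    by rewrite expRN mulrC ler_pdivrMr ?expR_gt0// mulrC.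
  have : expR (- ((S * 4 ^+ j0)^-1 * t)) * (l2 x 0 - ball j0) <= ball k.
    apply: le_trans e2; rewrite l20.
    apply: (@le_trans _ _ (expR (- ((S * 4 ^+ j0)^-1 * t)) * (w x)^-1)).
      by rewrite ler_wpM2l ?expR_ge0// lerBlDr lerDl.
    by rewrite ler_wpM2r// invr_ge0 ltW.
  by move: h; rewrite mulr2n mulrDl mul1r; lra.
set J := (j0 + m)%N; rewrite addnS -/J in Jk ht *.
have JP : (j0 <= J.+1 <= k)%N by rewrite Jk leqW// leq_addr.
(* During [tau] the excess shrinks by [expR (- d.+1)], at most [2 ^ - d.+1], which compensates
   [2 * ball J = 2 ^ d.+1 * ball J.+1]; [phase] grows by at least [tau]. *)
pose tau := S * 4 ^+ J.+1 * d.+1%:R.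
have h4 : 0 <= S * (4 ^+ j0 * Th) by rewrite !mulr_ge0 ?exprn_ge0.
have h5 : 0 <= S * 4 ^+ J * d.+1%:R by rewrite !mulr_ge0 ?exprn_ge0.
have tauE : tau = 4 * (S * 4 ^+ J * d.+1%:R) by rewrite /tau exprS; ring.
have phE J' : phase J' = S * (4 ^+ j0 * Th) + 2 * (S * 4 ^+ J' * d.+1%:R).
  by rewrite /phase; ring.
have ht' : phase J <= t - tau.
  move: ht; rewrite !phE tauE exprS.
  rewrite (_ : S * (4 * 4 ^+ J) * d.+1%:R = 4 * (S * 4 ^+ J * d.+1%:R)); last by ring.
  lra.
have tt0 : 0 <= t - tau <= t.
  rewrite lerBlDr lerDl tauE mulr_ge0// andbT -tauE.
  by apply: le_trans ht'; rewrite phE addr_ge0// mulr_ge0.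
have := l2_decay_nash x tt0 JP.
rewrite -/(ball J.+1) (_ : t - (t - tau) = tau); last by rewrite opprB addrC subrK.
rewrite (_ : (S * 4 ^+ J.+1)^-1 * tau = d.+1%:R); last first.
  by rewrite /tau mulKf// mulf_neq0 ?expf_neq0 ?gt_eqF.
have hI := IH (t - tau) (ltnW Jk) ht'.
have BJ : ball J = 2 ^+ d * ball J.+1.
  rewrite /ball mulSn exprD; field.
  by rewrite !expf_neq0// pnatr_eq0.
have B0 : 0 <= ball J.+1 by rewrite mulr_ge0// invr_ge0 exprn_ge0.
move=> h; rewrite mulr2n mulrDl mul1r -lerBlDr; apply: le_trans h _.
apply: (@le_trans _ _ (expR (- d.+1%:R) * (2 * ball J))).
  by rewrite ler_wpM2l ?expR_ge0// lerBlDr; apply: le_trans hI _; rewrite lerDl.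
apply: (@le_trans _ _ ((2 ^+ d.+1)^-1 * (2 * ball J))).
  by rewrite ler_wpM2r ?expRN_le// mulr_ge0// BJ mulr_ge0 ?exprn_ge0.
rewrite BJ exprS le_eqVlt; apply/orP; left; apply/eqP; field.
by rewrite expf_neq0// pnatr_eq0.
Qed.

Definition mixT : R := phase k + S * 4 ^+ k * La.

(** After [phase k] the squared norm is at most [2 * ball k], a bounded multiple of [Z^-1], so the
    Poincare inequality needs only a bounded number [La] of relaxation times. *)
Lemma var_small x : \sum_y w y * (dens x mixT y - Z^-1) ^+ 2 <= (expR 1)^-1 / Z.
Proof.
have Z0 := Z_gt0 x; have S0 := ltW S_gt0.
have varE t : \sum_y w y * (dens x t y - Z^-1) ^+ 2 = l2 x t - Z^-1.
  rewrite (eq_bigr (fun y => w y * dens x t y ^+ 2 - 2 * Z^-1 * (w y * dens x t y) +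
    Z^-1 * Z^-1 * w y)) => [|y _]; last by ring.
  rewrite big_split sumrB/= -!big_distrr/= sum_dens -/Z /l2.
  by field; rewrite gt_eqF.
have ph0 : 0 <= phase k by rewrite mulr_ge0// addr_ge0 ?mulr_ge0 ?exprn_ge0.
have phT : phase k <= mixT by rewrite lerDl !mulr_ge0 ?exprn_ge0.
rewrite varE.
have := @exp_decay _ (l2 x) (fun t => - E (dens x t)) (S * 4 ^+ k) Z^-1 _ _ _ phT
  (is_derive_l2 x).
rewrite mulr_gt0 ?exprn_gt0// => /(_ isT) h.
apply: le_trans (h _) _ => [s _|].
  rewrite -varE mulrNN; have [c hc] := gap_ineq (dens x s); apply: le_trans hc.
  (* The constant [c] is unspecified; the mean [Z^-1] does at least as well, the difference being
     [Z * (c - Z^-1) ^+ 2]. *)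
  rewrite -subr_ge0 -sumrB.
  rewrite (eq_bigr (fun y => (c ^+ 2 - Z^-1 * Z^-1) * w y + 2 * (Z^-1 - c) * (w y * dens x s y)));
    last by move=> y _; ring.
  rewrite big_split/= -!big_distrr/= sum_dens -/Z.
  rewrite [leRHS](_ : _ = Z * (c - Z^-1) ^+ 2) ; last by field; rewrite gt_eqF.
  exact: mulr_ge0 (ltW Z0) (sqr_ge0 _).
rewrite /mixT (_ : phase k + _ - phase k = S * 4 ^+ k * La); last by rewrite addrAC subrr add0r.
rewrite mulKf; last by rewrite mulf_neq0 ?expf_neq0 ?gt_eqF.
have kP : (j0 <= k <= k)%N by rewrite j0k leqnn.
have l2k := l2_phase x kP (lexx (phase k)).
apply: (@le_trans _ _ (expR (- La) * (2 * ball k))).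
  rewrite ler_wpM2l ?expR_ge0// lerBlDr; apply: le_trans l2k _.
  by rewrite lerDl invr_ge0 ltW.
rewrite ler_pdivlMr// -expRN.
apply: (@le_trans _ _ (expR (- La) * (2 * ball k) * (M * 2 ^+ (k * d)))).
  rewrite ler_wpM2l// !mulr_ge0 ?expR_ge0// ?invr_ge0 ?exprn_ge0//; exact: ltW.
rewrite (_ : _ * (M * _) = expR (- La) * (2 * M * Q)); last first.
  by rewrite /ball; field; rewrite expf_neq0// pnatr_eq0.
apply: (@le_trans _ _ (expR (- La) * expR (La - 1))); first by rewrite ler_wpM2l ?expR_ge0.
by rewrite -expRD addKr.
Qed.

(** The semigroup property and reversibility write the centred kernel at twice the time as a scalar
    product of two centred densities; Cauchy-Schwarz then turns the [L^2] bound into a uniform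
    one. *)
Lemma mixing x y : `|mexp A (mixT + mixT) x y - w y / Z| / (w y / Z) <= (expR 1)^-1.
Proof.
have Z0 := Z_gt0 x; have wy := w_gt0 y.
pose hx z := dens x mixT z - Z^-1; pose hy z := dens y mixT z - Z^-1.
have -> : mexp A (mixT + mixT) x y - w y / Z = w y * \sum_z w z * (hx z * hy z).
  rewrite mexpD.
  rewrite (eq_bigr (fun z => w y * (w z * (dens x mixT z * dens y mixT z)))); last first.
    move=> z _; have := mexp_reversible mixT z y w_neq0 gen_reversible.
    rewrite /dens => h; apply: (mulfI (w_neq0 z)).
    rewrite mulrCA h; field; exact: w_neq0.
  rewrite -big_distrr/= -mulrBr; congr (_ * _).
  rewrite /hx /hy [RHS](eq_bigr (fun z => w z * (dens x mixT z * dens y mixT z) +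
     (Z^-1 * Z^-1 * w z - Z^-1 * (w z * dens x mixT z) - Z^-1 * (w z * dens y mixT z))));
    last by move=> z _; ring.
  rewrite big_split/= !sumrB -!big_distrr/= !sum_dens -/Z; congr (_ + _).
  by field; rewrite gt_eqF.
rewrite normrM (gtr0_norm wy) invfM invrK mulrACA mulfV// mul1r.
rewrite -ler_pdivlMr//.
have e0 : 0 <= (expR 1)^-1 / Z :> R by rewrite divr_ge0 ?invr_ge0 ?expR_ge0// ltW.
rewrite -ler_sqr ?nnegrE ?normr_ge0// -normrX ger0_norm ?sqr_ge0//.
apply: (@le_trans _ _ ((\sum_z w z * hx z ^+ 2) * (\sum_z w z * hy z ^+ 2))).
  apply: sum_sqr_le => z; try exact: mulr_ge0 (ltW (w_gt0 z)) (sqr_ge0 _).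
  by rewrite le_eqVlt; apply/orP; left; apply/eqP; ring.
have sq0 x' : 0 <= \sum_z w z * (dens x' mixT z - Z^-1) ^+ 2.
  by apply: sumr_ge0 => z _; rewrite mulr_ge0 ?sqr_ge0// ltW.
by rewrite [leRHS]expr2 ler_pM ?sq0 ?var_small.
Qed.

End Decay.

(** * Empty dyadic cubes *)

Section Blocks.
Variables (R : realType) (d k : nat).
Local Notation N := (2 ^ k)%N.
Local Notation T := {ffun 'I_d -> 'I_N}.
Local Notation cst j := (fun _ : 'I_d => j).
Variable occ : pred T.

Definition empty (j : nat) (x : T) : bool := [forall y, same_cube j x y ==> ~~ occ y].

Lemma empty_eq j x y : same_cube j x y -> empty j x = empty j y.
Proof.
have imp u v : same_cube j u v -> empty j u -> empty j v.
  move=> uv /forallP eu; apply/forallP => z; apply/implyP => vz.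
  by apply: (implyP (eu z)); exact: same_cube_trans vz.
by move=> xy; apply/idP/idP; apply: imp => //; rewrite same_cubeC.
Qed.

Definition cube_set (j : nat) (x : T) : {set T} := [set y | same_cube j x y].

Lemma card_cube_set j x : (j <= k)%N -> #|cube_set j x| = (2 ^ (j * d))%N.
Proof.
move=> jk; have := kerT_sum R x (e := cst j) (fun=> jk).
rewrite (eq_bigr (fun y => if y \in cube_set j x then (2 ^+ (j * d))^-1 else 0)); last first.
  by move=> y _; rewrite kerT_cst inE.
rewrite -big_mkcond/= sumr_const => h.
apply/eqP; rewrite -(eqr_nat R) natrX; apply/eqP.
have p0 : 2 ^+ (j * d) != 0 :> R by rewrite expf_neq0// pnatr_eq0.
by apply: (mulIf (invr_neq0 p0)); rewrite mulfV// mulr_natl h.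
Qed.

Lemma cube_set_eq j x y : y \in cube_set j x -> cube_set j y = cube_set j x.
Proof.
rewrite inE => xy; apply/setP => z; rewrite !inE; apply/idP/idP.
  exact: same_cube_trans.
by apply: same_cube_trans; rewrite same_cubeC.
Qed.

Definition blocks (j m : nat) (x0 : T) : {set {set T}} := cube_set j @: cube_set m x0.

Lemma trivIset_blocks j m x0 (Q : {set {set T}}) : Q \subset blocks j m x0 -> finset.trivIset Q.
Proof.
move=> /fintype.subsetP QB; apply/finset.trivIsetP => A B /QB /imsetP[x _ ->] /QB /imsetP[y _ ->].
apply: contraNT => /fintype.pred0Pn[z /andP[/= /cube_set_eq <- /cube_set_eq <-]]; exact: eqxx.
Qed.

Lemma card_cover_blocks j m x0 (Q : {set {set T}}) : (j <= k)%N -> Q \subset blocks j m x0 ->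
  #|finset.cover Q| = (#|Q| * 2 ^ (j * d))%N.
Proof.
move=> jk QB; have /eqP <- := trivIset_blocks QB.
rewrite (eq_bigr (fun=> 2 ^ (j * d))%N) ?sum_nat_const// => A /(fintype.subsetP QB) /imsetP[x _ ->].
exact: card_cube_set.
Qed.

Lemma cover_blocks j m x0 : (j <= m)%N -> finset.cover (blocks j m x0) = cube_set m x0.
Proof.
move=> jm; apply/setP => y; apply/bigcupP/idP => [[_ /imsetP[x xm ->]]|ym].
  rewrite !inE in xm * => xy; apply: same_cube_trans xm _.
  exact: same_cube_mono xy.
by exists (cube_set j y); [exact: imset_f|rewrite inE same_cubexx].
Qed.

Lemma card_blocks j m x0 : (j <= m <= k)%N -> #|blocks j m x0| = (2 ^ ((m - j) * d))%N.
Proof.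
move=> /andP[jm mk]; have jk := leq_trans jm mk.
have := card_cover_blocks jk (fintype.subxx (blocks j m x0)).
rewrite cover_blocks// card_cube_set// => h.
apply/eqP; rewrite -(eqn_pmul2r (expn_gt0 2 (j * d))) -h -expnD -mulnDl subnK//.
Qed.

(** The deterministic sets over which the union bound runs: all unions of [h] blocks of side [2 ^ j]
    in the cube of side [2 ^ m] around [x0]. *)
Definition vacant_family (j m : nat) (x0 : T) (h : nat) : {set {set T}} :=
  [set finset.cover Q | Q : {set {set T}} in [set Q : {set {set T}} | Q \subset blocks j m x0 & #|Q| == h]].

Lemma card_vacant_family j m x0 h : (j <= m <= k)%N ->
  (#|vacant_family j m x0 h| <= 'C(2 ^ ((m - j) * d), h))%N.
Proof. by move=> jm; apply: leq_trans (leq_imset_card _ _) _; rewrite cards_draws card_blocks. Qed.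

Lemma vacant_family_card j m x0 h V : (j <= k)%N -> V \in vacant_family j m x0 h ->
  #|V| = (h * 2 ^ (j * d))%N.
Proof.
move=> jk /imsetP[Q]; rewrite inE => /andP[QB /eqP <-] ->.
exact: card_cover_blocks QB.
Qed.

(** The empty blocks fill a proportion above [b] of the cube, so there are at least
    [truncn (b * M) + 1] of them out of [M]; exactly that many are selected, to get a set of
    prescribed size. *)
Lemma many_empty j m x0 (b : R) : (j <= m <= k)%N -> 0 <= b ->
  b < av (cst m) (fun x => (empty j x)%:R) x0 ->
  exists2 V, V \in vacant_family j m x0 (Num.truncn (b * 2 ^+ ((m - j) * d))).+1 &
    forall x, x \in V -> ~~ occ x.
Proof.
move=> /andP[jm mk] b0 hb; have jk := leq_trans jm mk.
pose E := [set B in blocks j m x0 | [forall x in B, ~~ occ x]].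
have EB : E \subset blocks j m x0 by apply/fintype.subsetP => B; rewrite inE => /andP[].
have covE : finset.cover E = [set x in cube_set m x0 | empty j x].
  apply/setP => x; rewrite inE; apply/bigcupP/andP => [[B]|[xm ex]].
    rewrite inE => /andP[/imsetP[y ym ->] /forall_inP hB] xB; split.
      rewrite !inE in ym xB *; apply: same_cube_trans ym _; exact: same_cube_mono xB.
    apply/forallP => z; apply/implyP => xz; apply: hB; rewrite !inE in xB *.
    exact: same_cube_trans xB xz.
  exists (cube_set j x); last by rewrite inE same_cubexx.
  rewrite inE imset_f//=; apply/forall_inP => z; rewrite inE => xz.
  by have /forallP/(_ z)/implyP := ex; apply.
have avE : av (cst m) (fun x => (empty j x)%:R) x0 = #|finset.cover E|%:R / 2 ^+ (m * d) :> R.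
  rewrite covE -sum1_card natr_sum big_distrl/= [RHS]big_mkcond/=; apply: eq_bigr => x _.
  by rewrite kerT_cst !inE; case: same_cube; case: empty; rewrite ?(mulr1, mulr0, mul1r, mul0r).
have hE : (Num.truncn (b * 2 ^+ ((m - j) * d)) < #|E|)%N.
  rewrite -(ltr_nat R); have /andP[h1 _] := truncn_itv (mulr_ge0 b0 (exprn_ge0 ((m - j) * d) (ler0n R 2))).
  apply: le_lt_trans h1 _.
  move: hb; rewrite avE ltr_pdivlMr ?exprn_gt0// (card_cover_blocks jk EB) natrM natrX.
  rewrite -[in 2 ^+ (m * d)](subnK jm) mulnDl exprD mulrA ltr_pM2r ?exprn_gt0//.
have : (0 < #|[set Q : {set {set T}} | Q \subset E & #|Q| == (Num.truncn (b * 2 ^+ ((m - j) * d))).+1]|)%N.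
  by rewrite cards_draws bin_gt0.
move=> /card_gt0P[Q]; rewrite inE => /andP[QE cQ].
exists (finset.cover Q); first by apply: imset_f; rewrite inE cQ andbT (fintype.subset_trans QE EB).
move=> x /bigcupP[B /(fintype.subsetP QE)]; rewrite inE => /andP[_ /forall_inP hB]; exact: hB.
Qed.

(** The default of [find] is [k.+1], taken when even the whole box is empty; [level_le] excludes
    it. *)
Definition level (x : T) : nat := find (fun j => ~~ empty j x) (iota 0 k.+1).

Lemma level_le m x : (m <= k)%N -> ~~ empty m x -> (level x <= m)%N.
Proof.
move=> mk nem; rewrite leqNgt; apply/negP => h.
have := before_find 0%N h; rewrite (nth_iota _ _ (mk : m < k.+1)%N) => /negbFE.
by rewrite (negbTE nem).
Qed.

Lemma level_nonempty m x : (m <= k)%N -> ~~ empty m x -> ~~ empty (level x) x.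
Proof.
move=> mk nem.
have hh : has (fun j => ~~ empty j x) (iota 0 k.+1).
  by apply/hasP; exists m => //; rewrite mem_iota.
have lk : (level x < k.+1)%N by rewrite ltnS (leq_trans (level_le mk nem)).
by have := nth_find 0%N hh; rewrite -/(level x) (nth_iota _ _ lk).
Qed.

Lemma level_empty j x : (j < level x)%N -> empty j x.
Proof.
move=> h; have bf := before_find 0%N h; move: bf.
have jk : (j < k.+1)%N.
  apply: leq_trans h _; have := find_size (fun j => ~~ empty j x) (iota 0 k.+1).
  by rewrite size_iota.
by rewrite (nth_iota _ _ jk) => /negbFE.
Qed.

(** Level [j.+1] forces the cube of side [2 ^ j] to be empty, so [g (level x)] is at most [g 0] plus
    the sum of the [g j.+1] over the empty levels. *)
Lemma av_level_le (g : nat -> R) (m : nat) (b : nat -> R) x0 : (m <= k)%N ->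
  (forall j, 0 <= g j) -> (forall x, (level x <= m)%N) ->
  (forall j, (j < m)%N -> av (cst m) (fun x => (empty j x)%:R) x0 <= b j) ->
  av (cst m) (fun x => g (level x)) x0 <= g 0%N + \sum_(j < m) g j.+1 * b j.
Proof.
move=> mk g0 lm hb.
apply: (@le_trans _ _ (av (cst m) (fun x => g 0%N + \sum_(j < m) g j.+1 * (empty j x)%:R) x0)).
  apply: le_av => x; have := lm x; case lx: (level x) => [|j] jm.
    by rewrite lerDl sumr_ge0// => j _; rewrite mulr_ge0.
  rewrite (bigD1 (Ordinal jm))//= level_empty ?lx// mulr1 addrCA lerDl addr_ge0//.
  by apply: sumr_ge0 => i _; rewrite mulr_ge0.
have -> : av (cst m) (fun x => g 0%N + \sum_(j < m) g j.+1 * (empty j x)%:R) x0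
   = g 0%N + \sum_(j < m) g j.+1 * av (cst m) (fun x => (empty j x)%:R) x0.
  rewrite -[g 0%N in RHS](av_const (g 0%N) x0 (fun=> mk)) /av.
  under [X in _ + X]eq_bigr do rewrite big_distrr/=.
  rewrite exchange_big/= -big_split/=; apply: eq_bigr => y _.
  rewrite mulrDr; congr (_ + _); rewrite big_distrr/=; apply: eq_bigr => j _.
  by rewrite mulrCA.
by rewrite lerD2l; apply: ler_sum => j _; rewrite ler_wpM2l// hb.
Qed.

End Blocks.

(** * Estimates for the union bound *)

Section Numeric.
Variable R : realType.

Lemma expR1_le4 : expR 1 <= 4 :> R.
Proof.
have h : expR (2^-1) <= 2 :> R.
  rewrite -[2^-1]opprK expRN -[leRHS]invrK lef_pV2 ?posrE ?invr_gt0 ?expR_gt0//.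
  by apply: le_trans (expR_ge1Dx _); lra.
have -> : expR 1 = expR (2^-1) * expR (2^-1) :> R by rewrite -expRD; congr expR; lra.
by have -> : 4 = 2 * 2 :> R; [lra|rewrite ler_pM ?expR_ge0].
Qed.

Lemma expR1_ge2 : 2 <= expR 1 :> R.
Proof. by apply: le_trans (expR_ge1Dx _). Qed.

Lemma ffact_le_exp n m : (n ^_ m <= n ^ m)%N.
Proof.
elim: m => [|m IH]; first by rewrite ffactn0.
by rewrite ffactnSr expnSr leq_mul// leq_subr.
Qed.

(** The usual bound by [(e * M / h) ^ h], from [h ^ h <= h! * e ^ h], a single term of the
    exponential series. *)
Lemma binomial_le (M h : nat) (b : R) : 0 < b -> (0 < h)%N -> b * M%:R <= h%:R ->
  ('C(M, h))%:R <= (expR 1 / b) ^+ h :> R.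
Proof.
move=> b0 h0 bM.
have f0 : 0 < h`!%:R :> R by rewrite ltr0n fact_gt0.
have e1 : h%:R ^+ h <= h`!%:R * expR 1 ^+ h :> R.
  rewrite -expRM_natr mul1r mulrC -ler_pdivrMr//.
  case: h h0 bM f0 => // h _ _ _.
  by apply: le_trans (expR_ge1Dxn h (ler0n R h.+1)); rewrite lerDr.
rewrite -(ler_pM2r f0) -natrM bin_ffact.
apply: (@le_trans _ _ (M%:R ^+ h)); first by rewrite -natrX ler_nat ffact_le_exp.
rewrite expr_div_n mulrAC ler_pdivlMr ?exprn_gt0// -exprMn [leRHS]mulrC.
apply: le_trans e1; rewrite lerXn2r ?nnegrE ?ler0n//; last by rewrite mulrC.
by rewrite mulr_ge0 ?ler0n// ltW.
Qed.

(* A union bound over the ['C(M, h)] ways to choose [h] empty blocks of [n] cells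
   beats the entropy because an empty block has probability [16 ^ -n]. *)
Lemma binomial_tail (n M h : nat) (delta : R) : (0 < n)%N -> 0 <= delta <= 2^-1 ->
  h = (Num.truncn (expR (- (delta * n%:R)) * M%:R)).+1 ->
  ('C(M, h))%:R * (16 ^+ (h * n))^-1 <= expR (- (n%:R * h%:R / 2)) :> R.
Proof.
move=> n0 /andP[d0 d1]; set b := expR (- (delta * n%:R)) => hE.
have b0 : 0 < b by exact: expR_gt0.
have hb : b * M%:R <= h%:R.
  by rewrite hE; have /andP[_ /ltW] := truncn_itv (mulr_ge0 (ltW b0) (ler0n R M)).
have hpos : (0 < h)%N by rewrite hE.
have hC := binomial_le b0 hpos hb.
have h16 : (16 ^+ (h * n))^-1 <= expR (- (2 * n%:R)) ^+ h :> R.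
  rewrite -expRM_natr mulNr expRN lef_pV2 ?posrE ?expR_gt0 ?exprn_gt0//.
  have -> : 2 * n%:R * h%:R = 1 * (2 * (h * n))%:R :> R by rewrite !natrM; ring.
  rewrite expRM_natr exprM lerXn2r ?nnegrE ?exprn_ge0 ?expR_ge0//.
  have -> : 16 = 4 ^+ 2 :> R by rewrite expr2; lra.
  by rewrite lerXn2r ?nnegrE ?expR_ge0// expR1_le4.
apply: le_trans (ler_pM (ler0n _ _) _ hC h16) _; first by rewrite invr_ge0 exprn_ge0.
(* Per unit of [h] the exponent is [1 + delta * n - 2 * n], at most [- n / 2] as [delta <= 1/2] and
   [n >= 1]. *)
rewrite -exprMn /b expRN invrK -!expRD -expRM_natr ler_expR.
have n1 : 1 <= n%:R :> R by rewrite ler1n.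
have dn : delta * n%:R <= 2^-1 * n%:R by rewrite ler_wpM2r.
have h0 : 0 <= h%:R :> R by rewrite ler0n.
rewrite [leRHS](_ : _ = (- (n%:R / 2)) * h%:R); last by ring.
rewrite ler_wpM2r//; lra.
Qed.

Lemma expR_beats_linear (c a : R) : 0 < c -> exists k0 : nat, forall k : nat, (k0 <= k)%N ->
  a * k%:R <= expR (c * k%:R).
Proof.
move=> c0; exists (Num.truncn (2 * `|a| / c ^+ 2)).+1 => k hk.
have c2 : 0 < c ^+ 2 by rewrite exprn_gt0.
have k1 : 2 * `|a| / c ^+ 2 <= k%:R.
  apply: (@le_trans _ _ (Num.truncn (2 * `|a| / c ^+ 2)).+1%:R); last by rewrite ler_nat.
  have q0 : 0 <= 2 * `|a| / c ^+ 2 by rewrite divr_ge0 ?mulr_ge0// ltW.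
  by have /andP[_ /ltW] := truncn_itv q0.
rewrite ler_pdivrMr// in k1.
apply: le_trans (expR_ge1Dxn 1 (mulr_ge0 (ltW c0) (ler0n R k))).
rewrite (_ : 2`!%:R = 2)//; apply: (@le_trans _ _ ((c * k%:R) ^+ 2 / 2)); last by rewrite lerDr.
rewrite ler_pdivlMr// exprMn expr2.
have a1 := ler_norm a; have kk : 0 <= k%:R :> R by rewrite ler0n.
have h1 : a * k%:R * 2 <= 2 * `|a| * k%:R by nra.
apply: le_trans h1 _.
by rewrite (_ : _ * _ * k%:R ^+ 2 = k%:R * c ^+ 2 * k%:R) ?ler_wpM2r//; ring.
Qed.

Lemma pow2_ge_expR (m : nat) : expR (m%:R / 2) <= 2 ^+ m :> R.
Proof.
rewrite -(@ler_sqr _ (expR _)) ?nnegrE ?expR_ge0 ?exprn_ge0// -expRM_natr divfK//.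
by rewrite -[m%:R]mul1r expRM_natr -exprM mulnC exprM lerXn2r ?nnegrE ?expR_ge0 ?exprn_ge0//;
  rewrite (_ : 2 ^+ 2 = 4) ?expR1_le4//; rewrite -natrX.
Qed.

(* [q] plays the role of [n * h], see [binomial_tail] *)
Lemma block_exponent (d B : nat) : (0 < d)%N -> (0 < B)%N ->
  let delta : R := d%:R / (8 * B%:R * (d + 4)%:R) in
  exists k0 : nat, forall k n : nat, (k0 <= k)%N -> forall q : R, n%:R <= q ->
    expR (- (delta * n%:R)) * 2 ^+ (k %/ B * d) <= q -> (2 * (d + 4) * k)%:R <= q.
Proof.
move=> d0 B0 delta.
have Bp : 0 < B%:R :> R by rewrite ltr0n.
have dp : 0 < d%:R :> R by rewrite ltr0n.
have d4 : 0 < (d + 4)%:R :> R by rewrite ltr0n addn_gt0 d0.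
pose c : R := d%:R / (4 * B%:R).
have c0 : 0 < c by rewrite divr_gt0// mulr_gt0.
have [k0 hk0] := expR_beats_linear (2 ^+ d * (2 * (d + 4))%:R) c0.
exists k0 => k n /hk0 hk q nq hq.
(* Large blocks suffice by themselves. For small ones [delta] is such that [delta * n <= c * k],
   while the number of cells is at least of order [expR (2 * c * k)]. *)
have [h|/ltW h] := leP (2 * (d + 4) * k)%:R (n%:R : R); first exact: le_trans nq.
apply: le_trans hq.
have delta0 : 0 <= delta by rewrite divr_ge0// !mulr_ge0// ltW.
have e1 : expR (- (c * k%:R)) <= expR (- (delta * n%:R)).
  rewrite ler_expR lerN2; apply: (@le_trans _ _ (delta * (2 * (d + 4) * k)%:R)).
    by rewrite ler_wpM2l.
  rewrite le_eqVlt; apply/orP; left; apply/eqP; rewrite /delta /c !natrM.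
  by field; rewrite !gt_eqF.
have e2 : expR (2 * c * k%:R) <= 2 ^+ d * 2 ^+ (k %/ B * d) :> R.
  rewrite -exprD; apply: le_trans (pow2_ge_expR _); rewrite ler_expR.
  have -> : 2 * c * k%:R = d%:R * k%:R / B%:R / 2 by rewrite /c; field; rewrite gt_eqF.
  rewrite ler_pM2r ?invr_gt0// ler_pdivrMr// -!natrM ler_nat.
  have := ltn_ceil k B0; nia.
have p2 : 0 < 2 ^+ d :> R by rewrite exprn_gt0.
rewrite -(ler_pM2l p2); apply: le_trans (_ : expR (c * k%:R) <= _).
  by rewrite (natrM _ (2 * (d + 4)) k) mulrA.
rewrite mulrCA.
apply: (@le_trans _ _ (expR (- (c * k%:R)) * expR (2 * c * k%:R))); last first.
  by rewrite ler_pM ?expR_ge0.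
by rewrite -expRD ler_expR; lra.
Qed.

End Numeric.

Local Open Scope classical_set_scope.
Local Open Scope ring_scope.

(** * Fair coins and vacant cubes *)

Lemma big_setUP (T : Type) (I : finType) (P : pred I) (F : I -> set T) (t : T) :
  (\big[setU/set0]_(i | P i) F i) t <-> exists2 i, P i & F i t.
Proof.
split.
  elim/big_rec: _ => // i A Pi IH [Fit|/IH//]; by exists i.
by case=> i Pi Fit; rewrite (bigD1 i)//=; left.
Qed.

Section DyadicDigits.
Variable R : realType.
Implicit Types om : R.

(** The guard confines the digit 1 to finitely many dyadic intervals of [[0, 1)], whence
    measurability. *)
Definition digit (n : nat) om : bool :=
  (0 <= om < 1) && odd (Num.truncn (2 ^+ n.+1 * om)).

Definition dyad (N i : nat) : set R := [set om | i%:R <= 2 ^+ N * om < i.+1%:R].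

Lemma dyadE N i : dyad N i = `[i%:R / 2 ^+ N, i.+1%:R / 2 ^+ N[%classic.
Proof.
apply/seteqP; split => om; rewrite /dyad/= in_itv/=.
  by rewrite ler_pdivrMr ?exprn_gt0// ltr_pdivlMr ?exprn_gt0// [om * _]mulrC.
by rewrite ler_pdivrMr ?exprn_gt0// ltr_pdivlMr ?exprn_gt0// [om * _]mulrC.
Qed.

Lemma measurable_dyad N i : measurable (dyad N i).
Proof. by rewrite dyadE; exact: measurable_itv. Qed.

Lemma lebesgue_dyad N i : lebesgue_measure (dyad N i) = ((2 ^+ N)^-1 : R)%:E.
Proof.
rewrite dyadE lebesgue_measure_itv/= lte_fin ltr_pM2r ?invr_gt0 ?exprn_gt0//.
by rewrite ltr_nat ltnSn -EFinB -mulrBl -natr1 addrAC subrr add0r mul1r.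
Qed.

Lemma trivIset_dyad N (A : set nat) : trivIset A (dyad N).
Proof.
move=> i j _ _ [om [/andP[a b] /andP[a' b']]].
have h1 := le_lt_trans a b'; have h2 := le_lt_trans a' b.
by move: h1 h2; rewrite !ltr_nat !ltnS => ij ji; apply/anti_leq; rewrite ij.
Qed.

Lemma dyad_digit N i n om : (i < 2 ^ N)%N -> dyad N i om -> (n < N)%N ->
  digit n om = odd (i %/ 2 ^ (N - n.+1)).
Proof.
move=> iN /andP[i1 i2] nN; rewrite /digit.
have p0 : 0 < 2 ^+ N :> R by rewrite exprn_gt0.
have -> : 0 <= om < 1.
  rewrite -(pmulr_rge0 _ p0) (le_trans _ i1) ?ler0n//= -(ltr_pM2l p0) mulr1.
  by apply: lt_le_trans i2 _; rewrite -natrX ler_nat.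
congr odd; apply: truncn_def.
have q0 : 0 < 2 ^+ (N - n.+1) :> R by rewrite exprn_gt0.
have e : 2 ^+ N * om = 2 ^+ (N - n.+1) * (2 ^+ n.+1 * om) by rewrite mulrA -exprD subnK.
apply/andP; split.
  rewrite -(ler_pM2l q0) -e; apply: le_trans i1.
  by rewrite -natrX -natrM ler_nat mulnC leq_trunc_div.
rewrite -(ltr_pM2l q0) -e; apply: lt_le_trans i2 _.
by rewrite -natrX -natrM ler_nat mulnC ltn_ceil// expn_gt0.
Qed.

Lemma unit_dyad N om : 0 <= om < 1 -> exists i : 'I_(2 ^ N), dyad N i om.
Proof.
move=> /andP[om0 om1].
have p0 : 0 < 2 ^+ N :> R by rewrite exprn_gt0.
have h := truncn_itv (mulr_ge0 (ltW p0) om0).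
have iN : (Num.truncn (2 ^+ N * om) < 2 ^ N)%N.
  rewrite -(ltr_nat R); have /andP[h1 _] := h; apply: le_lt_trans h1 _.
  by rewrite natrX gtr_pMr.
by exists (Ordinal iN).
Qed.

Lemma measurable_digit n : measurable [set om | digit n om].
Proof.
rewrite (_ : [set om | _] = \bigcup_(i in [set i | (i < 2 ^ n.+1)%N && odd i]) dyad n.+1 i).
  by apply: bigcup_measurable => i _; exact: measurable_dyad.
apply/seteqP; split => om /=.
  move=> dig; have /andP[h _] := dig; have [i hi] := unit_dyad n.+1 h.
  exists i => //=; rewrite ltn_ord/=.
  by rewrite (dyad_digit (ltn_ord i) hi)// subnn divn1 in dig.
move=> [i /= /andP[iN oi] hi].
by rewrite (dyad_digit iN hi)// subnn divn1.
Qed.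

Variable (C : choiceType) (code : C -> nat).
Hypothesis code_inj : injective code.

Definition good (s : seq C) (b : C -> bool) (N i : nat) : bool :=
  all (fun x => (code x < N)%N ==> (odd (i %/ 2 ^ (N - (code x).+1)) == b x)) s.

Lemma sum_double (F : nat -> nat) m :
  (\sum_(i < m.*2) F i = \sum_(i < m) (F i.*2 + F i.*2.+1))%N.
Proof.
elim: m => [|m IH]; first by rewrite !big_ord0.
by rewrite doubleS !big_ord_recr/= IH addnA.
Qed.

(** Induction on the number of digits: interval [i] splits into [2 i] and [2 i + 1], and the new
    digit is constrained by at most one element of [s], because [code] is injective. *)
Lemma good_count (s : seq C) (b : C -> bool) N : uniq s ->
  ((\sum_(i < 2 ^ N) good s b N i) * 2 ^ (count (fun x => code x < N)%N s) = 2 ^ N)%N.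
Proof.
move=> us; elim: N => [|N IH].
  rewrite expn0 big_ord1 (_ : good s b 0 0 = true); last by apply/allP => x _.
  by rewrite (eq_count (a2 := pred0)) ?count_pred0.
have goodS (i : nat) (e : bool) : good s b N.+1 (e + i.*2) =
    good s b N i && all (fun x => (code x == N) ==> (e == b x)) s.
  rewrite /good -all_predI; apply: eq_all => x /=.
  case: (ltngtP (code x) N) => [xN|xN|xN]/=.
  - rewrite (ltnW xN : code x < N.+1)%N/= andbT subSn// expnS divnMA.
    by rewrite divn2 halfD odd_double andbF add0n doubleK; case: e.
  - by rewrite ltnS leqNgt xN.
  - by rewrite xN ltnSn/= subnn divn1 oddD odd_double addbF; case: e.
rewrite expnS mul2n (sum_double (fun i => good s b N.+1 i : nat)).
rewrite (eq_bigr (fun i : 'I_(2 ^ N) => good s b N i *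
   (all (fun x => (code x == N) ==> (false == b x)) s +
    all (fun x => (code x == N) ==> (true == b x)) s))%N); last first.
  move=> i _; have := goodS i false; have := goodS i true; rewrite add0n add1n => -> ->.
  by rewrite mulnDr !mulnb.
rewrite -big_distrl/=.
have -> : count (fun x => (code x < N.+1)%N) s =
    (count (fun x => code x < N)%N s + count (fun x => code x == N) s)%N.
  rewrite -count_predUI (_ : count (predI _ _) s = 0%N) ?addn0.
    by apply: eq_count => x /=; rewrite ltnS leq_eqVlt orbC.
  rewrite (eq_count (a2 := pred0)) ?count_pred0// => x /=.
  by case: ltngtP.
rewrite expnD mulnACA IH -muln2; congr (_ * _)%N.
have [/hasP[x0 x0s /eqP x0N]|/hasPn noN] := boolP (has (fun x => code x == N) s).
  have allE e : all (fun x => (code x == N) ==> (e == b x)) s = (e == b x0).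
    apply/allP/idP => [/(_ _ x0s)|/eqP eb x xs]; first by rewrite x0N eqxx.
    apply/implyP => /eqP xN; rewrite eb.
    by have -> : x = x0 by apply: code_inj; rewrite xN.
  rewrite !allE (eq_count (a2 := pred1 x0)) => [|x/=].
    by rewrite count_uniq_mem// x0s; case: (b x0).
  by rewrite -x0N (inj_eq code_inj).
have allT e : all (fun x => (code x == N) ==> (e == b x)) s.
  by apply/allP => x /noN /negbTE ->.
rewrite !allT (_ : count _ s = 0%N)//.
by apply/eqP; rewrite -leqn0 leqNgt -has_count; apply/hasPn.
Qed.

(** With [N] above all codes of [s], the event is a disjoint union of dyadic intervals of length
    [2 ^ -N], counted by [good_count]. *)
Lemma lebesgue_digits (s : seq C) (b : C -> bool) : uniq s ->
  lebesgue_measure ([set om | forall x, x \in s -> digit (code x) om = b x] `&` `[0, 1[%classic)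
    = ((2 ^+ size s)^-1 : R)%:E.
Proof.
move=> us; pose N := (\max_(x <- s) (code x).+1)%N.
have codeN x : x \in s -> (code x < N)%N.
  by move=> xs; rewrite /N (big_rem x)/=; [exact: leq_maxl|].
pose F i := if good s b N i then dyad N i else set0.
have -> : [set om | forall x, x \in s -> digit (code x) om = b x] `&` `[0, 1[%classic
    = \big[setU/set0]_(i < 2 ^ N | good s b N i) dyad N i.
  apply/seteqP; split => [om [hs]|om].
    rewrite /= in_itv/= => om01; have [i hi] := unit_dyad N om01.
    apply/big_setUP; exists i => //; apply/allP => x xs; apply/implyP => _.
    by rewrite -(dyad_digit (ltn_ord i) hi) ?codeN// hs.
  move=> /big_setUP[i /allP gi hi]; split => [x xs|].
    by rewrite (dyad_digit (ltn_ord i) hi) ?codeN//; have := gi x xs; rewrite codeN// => /eqP.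
  have := hi => /andP[h1 h2]; rewrite /= in_itv/=.
  have p0 : 0 < 2 ^+ N :> R by rewrite exprn_gt0.
  rewrite -(pmulr_rge0 _ p0) (le_trans _ h1) ?ler0n//= -(ltr_pM2l p0) mulr1.
  by apply: lt_le_trans h2 _; rewrite -natrX ler_nat.
rewrite measure_bigsetU_ord_cond; last 2 first.
- by move=> i _; exact: measurable_dyad.
- move=> i j _ _ hij; apply: val_inj; exact: (@trivIset_dyad N setT i j).
rewrite (eq_bigr (fun=> ((2 ^+ N)^-1 : R)%:E)) => [|i _]; last exact: lebesgue_dyad.
rewrite sumEFin; congr EFin.
have cE : count (fun x => (code x < N)%N) s = size s.
  by apply/eqP; rewrite -all_count; apply/allP => x /codeN.
have := congr1 (fun m => m%:R : R) (good_count b N us).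
rewrite cE natrM !natrX natr_sum => h.
have -> : \sum_(i < 2 ^ N | good s b N i) (2 ^+ N)^-1 =
    (\sum_(i < 2 ^ N) (good s b N i)%:R) * (2 ^+ N)^-1 :> R.
  rewrite big_distrl/= big_mkcond/=; apply: eq_bigr => i _.
  by case: ifP; rewrite (mul1r, mul0r).
apply: (@mulIf _ (2 ^+ size s)); first by rewrite expf_neq0// pnatr_eq0.
by rewrite mulrAC h mulfV ?mulVf// expf_neq0// pnatr_eq0.
Qed.

End DyadicDigits.

Section FairCoins.
Variables (R : realType) (d : nat).

Let code (x : 'rV[int]_d) : nat := pickle x.

Let code_inj : injective code.
Proof. exact: pcan_inj (@pickleK 'rV[int]_d). Qed.

(* (A1) only speaks of Bernoulli measures that are given: the fair one is the law
   of the binary digits of a uniform point of [0, 1). *)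
Definition coin_field (om : R) : Field01 d := fun x => digit (code x) om.

Lemma measurable_coin_field : measurable_fun setT coin_field.
Proof.
apply: (@measurability _ _ _ (Field01 d) setT coin_field (@cylinders d) erefl).
move=> _ [_ [x [b ->]] <-]; rewrite setTI.
case: b.
  rewrite (_ : _ @^-1` _ = [set om | digit (code x) om]); first exact: measurable_digit.
  by apply/seteqP; split.
rewrite (_ : _ @^-1` _ = ~` [set om | digit (code x) om]).
  by apply: measurableC; exact: measurable_digit.
by apply/seteqP; split => om; rewrite /= /coin_field; [move=> -> |move=> /negP/negbTE].
Qed.

Let unit_itv : set R := `[0, 1[%classic.

Let measurable_unit_itv : measurable unit_itv. Proof. exact: measurable_itv. Qed.

Definition coin_measure : set (Field01 d) -> \bar R :=
  pushforward (mrestr (@lebesgue_measure R) measurable_unit_itv) coin_field.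

HB.instance Definition _ := Measure.copy coin_measure
  (measure_function_pushforward__canonical__measure_function_Measure
    (mrestr (@lebesgue_measure R) measurable_unit_itv) measurable_coin_field).

Let coin_setT : coin_measure setT = 1%E.
Proof.
rewrite /coin_measure /pushforward preimage_setT /mrestr setTI.
by rewrite /unit_itv lebesgue_measure_itv/= lte01 sube0.
Qed.

HB.instance Definition _ := Measure_isProbability.Build _ _ _ coin_measure coin_setT.

Lemma coin_bernoulli : iid_bernoulli 2^-1 (coin_measure : probability (Field01 d) R).
Proof.
move=> s b us; rewrite (eq_bigr (fun=> 2^-1)) => [|x _]; last first.
  by case: ifP => // _; lra.
rewrite big_const_seq count_predT iter_mulr_1 exprVn.
exact: (lebesgue_digits R code_inj b us).
Qed.

End FairCoins.

Section Occupation.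
Variables (R : realType) (d : nat).
Local Notation rV := 'rV[R]_d.

Lemma coord_le_enorm (x : rV) j : `|x ord0 j| <= enorm x.
Proof.
rewrite /enorm -sqrtr_sqr ler_sqrt; last by apply: sumr_ge0 => i _; exact: sqr_ge0.
by rewrite (bigD1 j)//= lerDl; apply: sumr_ge0 => i _; exact: sqr_ge0.
Qed.

Lemma enorm_le (x : rV) (M : R) : 0 <= M -> (forall j, `|x ord0 j| <= M) ->
  enorm x <= Num.sqrt d%:R * M.
Proof.
move=> M0 hM; rewrite -[M in leRHS]ger0_norm// -sqrtr_sqr -sqrtrM ?ler0n//.
rewrite /enorm ler_sqrt; last by rewrite mulr_ge0 ?sqr_ge0.
rewrite mulr_natl -[d in X in _ <= X]card_ord -sumr_const; apply: ler_sum => j _.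
by rewrite -real_normK ?num_real// lerXn2r ?nnegrE.
Qed.

Lemma borel_cube (s : R) (x : 'rV[int]_d) : borel (cube s x).
Proof.
have lt_open (c : R) j : @eopen R d [set y | y ord0 j < c].
  move=> y /= yc; exists (c - y ord0 j); split; first by rewrite subr_gt0.
  move=> z hz; have := le_lt_trans (coord_le_enorm (z - y) j) hz; rewrite !mxE => h.
  by have := le_lt_trans (ler_norm _) h; lra.
pose T := g_sigma_algebraType (@eopen R d).
have mlt (c : R) j : measurable ([set y | y ord0 j < c] : set T).
  by apply: sub_sigma_algebra; exact: lt_open.
have -> : cube s x = \bigcap_(j in [set: 'I_d])
    ([set y | y ord0 j < s * (x ord0 j)%:~R + s] `\` [set y | y ord0 j < s * (x ord0 j)%:~R]).
  apply/seteqP; split => y.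
    by move=> h j _; have /andP[h1 h2] := h j; split => //=; apply/negP; rewrite -leNgt.
  move=> h j; have [h1 h2] := h j Logic.I; apply/andP; split => //.
  by rewrite leNgt; apply/negP.
suff : measurable (\bigcap_(j in [set: 'I_d])
    ([set y | y ord0 j < s * (x ord0 j)%:~R + s] `\` [set y | y ord0 j < s * (x ord0 j)%:~R]) : set T) by [].
apply: fin_bigcap_measurable; first exact: finite_finset.
by move=> j _; apply: measurableD; exact: mlt.
Qed.

Lemma ebounded_cube (s : R) (x : 'rV[int]_d) : ebounded (cube s x).
Proof.
pose M := \sum_j (`|s * (x ord0 j)%:~R| + `|s * (x ord0 j)%:~R + s|).
have M0 : 0 <= M by apply: sumr_ge0 => j _; rewrite addr_ge0.
exists (Num.sqrt d%:R * M) => y hy; apply: enorm_le => // j.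
have /andP[h1 h2] := hy j.
apply: (@le_trans _ _ (`|s * (x ord0 j)%:~R| + `|s * (x ord0 j)%:~R + s|)).
  have n1 := ler_norm (s * (x ord0 j)%:~R + s); have n2 := ler_norm (- (s * (x ord0 j)%:~R)).
  rewrite normrN in n2; rewrite ler_norml.
  have := normr_ge0 (s * (x ord0 j)%:~R); have := normr_ge0 (s * (x ord0 j)%:~R + s).
  by move: n1 n2 h1 h2; move: (s * _) => z; move: `|z| `|z + s| => u v; lra.
rewrite /M (bigD1 j)//= lerDl; apply: sumr_ge0 => i _; rewrite addr_ge0//.
Qed.

Definition vacant (K : R) (x : 'rV[int]_d) : set (Omega R d) :=
  [set xi | ~ exists y, cpts xi y /\ cube K x y].

Lemma measurable_vacant (K : R) x : measurable (vacant K x).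
Proof.
apply: sub_sigma_algebra; exists (cube K x), 0%N; split.
- exact: borel_cube.
- exact: ebounded_cube.
apply/seteqP; split => xi /=.
  move=> h; exists [::]; split => //; apply/seteqP; split => y //= [y1 y2].
  by exfalso; apply: h; exists y.
move=> [s [_ sE /size0nil s0]] [y [y1 y2]].
have : [set` s] y by rewrite sE.
by rewrite s0.
Qed.

(** The complement of joint vacancy is an increasing event, so domination of fair coins bounds the
    probability of vacancy by that of [size s] tails. *)
Lemma vacant_prob (P : probability (Omega R d) R) (K : R) :
  st_dominates P (@occ_field R d K) (@coin_measure R d : probability (Field01 d) R) ->
  forall s : seq 'rV[int]_d, uniq s ->
  (P [set xi | forall x, x \in s -> vacant K x xi] <= ((2 ^+ size s)^-1)%:E)%E.
Proof.
move=> dom s us.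
pose E : set (Field01 d) := [set eta | forall x, x \in s -> eta x = false].
have mcyl (x : 'rV[int]_d) : measurable ([set eta | eta x = false] : set (Field01 d)).
  by apply: sub_sigma_algebra; exists x, false.
have sE (T : Type) (F : 'rV[int]_d -> set T) :
    [set t | forall x, x \in s -> F x t] = \bigcap_(x in [set` s]) F x.
  by apply/seteqP; split.
have mE : measurable E.
  rewrite /E (sE _ (fun x => [set eta : Field01 d | eta x = false])).
  by apply: fin_bigcap_measurable => [|x _]; [exact: finite_seq|exact: mcyl].
have mV : measurable [set xi : Omega R d | forall x, x \in s -> vacant K x xi].
  rewrite (sE _ (fun x => vacant K x)).
  by apply: fin_bigcap_measurable => [|x _]; [exact: finite_seq|exact: measurable_vacant].
pose mu : probability (Field01 d) R := @coin_measure R d.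
have muE : (mu E = ((2 ^+ size s)^-1 : R)%:E)%E.
  have := @coin_bernoulli R d s (fun=> false) us.
  rewrite (eq_bigr (fun=> 2^-1)) => [|x _]; last by lra.
  by rewrite big_const_seq count_predT iter_mulr_1 exprVn.
have inc : increasing_event (~` E).
  move=> eta eta' le nE hE; apply: nE => x xs.
  by have := le x; rewrite (hE x xs); case: (eta x).
have := dom (~` E) (measurableC mE) inc.
have occE : occ_field K @^-1` (~` E) = ~` [set xi : Omega R d | forall x, x \in s -> vacant K x xi].
  apply/seteqP; split => xi h h'; apply: h => x xs; last first.
    by have := h' x xs; rewrite /occ_field => /asboolPn.
  by apply/asboolPn; exact: h' x xs.
rewrite -/mu (probability_setC mu mE) muE.
rewrite occE (probability_setC P mV).
have Vfin : P [set xi : Omega R d | forall x, x \in s -> vacant K x xi] \is a fin_num.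
  by rewrite fin_num_measure.
rewrite -(fineK Vfin) -!EFinB !lee_fin; lra.
Qed.

End Occupation.

(** * Density of the empty dyadic cubes *)

Lemma measure_big_setU_le (disp : measure_display) (Om : measurableType disp) (R : realType)
    (P : probability Om R) (I : finType) (Q : pred I) (F : I -> set Om) (c : I -> R) :
  (forall i, measurable (F i)) -> (forall i, Q i -> (P (F i) <= (c i)%:E)%E) ->
  (P (\big[setU/set0]_(i | Q i) F i) <= (\sum_(i | Q i) c i)%:E)%E.
Proof.
move=> mF hc; rewrite -!(big_filter _ Q).
have : all Q [seq i <- index_enum I | Q i] by exact: filter_all.
elim: [seq i <- index_enum I | Q i] => [_|i s IH /= /andP[Qi Qs]].
  by rewrite !big_nil measure0.
rewrite !big_cons EFinD; apply: (@le_trans _ _ (P (F i) + P (\big[setU/set0]_(j <- s) F j))%E).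
  apply: measureU2; first exact: mF.
  by apply: bigsetU_measurable => j _; exact: mF.
by apply: leeD; [exact: hc|exact: IH].
Qed.

Section Percolation.
Variables (R : realType) (d : nat) (P : probability (Omega R d) R) (K : R).
Hypothesis d_gt0 : (0 < d)%N.
Hypothesis K_gt0 : 0 < K.
Hypothesis vac : forall s : seq 'rV[int]_d, uniq s ->
  (P [set xi | forall x, x \in s -> vacant K x xi] <= ((2 ^+ size s)^-1)%:E)%E.

Section Scale.
Variables (L k : nat).
Local Notation T := {ffun 'I_d -> 'I_(2 ^ k)}.
Definition side : R := L%:R / 2 ^+ k.
Hypothesis side_ge : 11 * K <= side.

(** Rounding the corner of the cell up to the lattice of step [K] costs less than [K], and ten cubes
    follow along the first axis; hence [11 * K] in [side_ge]. *)
Definition kcell (x : T) (t : nat) : 'rV[int]_d :=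
  \row_j (Num.ceil ((side * (x j)%:R - L%:R / 2) / K) + (if j == 0%N :> nat then t%:Z else 0)).

Lemma kcell_pos x t y : (t < 10)%N -> cube K (kcell x t) y ->
  forall j, side * (x j)%:R <= y ord0 j + L%:R / 2 < side * (x j)%:R + side.
Proof.
move=> t10 hy j; have /andP[h1 h2] := hy j; move: h1 h2; rewrite mxE.
set z := (_ / K); have /andP[c1 c2] := ceil_itv z.
have zK : z * K = side * (x j)%:R - L%:R / 2 by rewrite divfK// gt_eqF.
have t0 : 0 <= (if j == 0%N :> nat then t%:Z else 0)%:~R :> R by rewrite ler0z; case: ifP.
have t9 : (if j == 0%N :> nat then t%:Z else 0)%:~R <= 9 :> R.
  by case: ifP => // _; rewrite -pmulrn ler_nat.
rewrite intrD mulrDr; rewrite intrB in c1.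
have u1 := ler_wpM2l (ltW K_gt0) c2; have u2 : K * ((Num.ceil z)%:~R - 1) < K * z by rewrite ltr_pM2l.
have v1 := mulr_ge0 (ltW K_gt0) t0; have v2 := ler_wpM2l (ltW K_gt0) t9.
rewrite mulrBr mulr1 in u2; rewrite [K * z]mulrC zK in u1 u2.
move=> h1 h2; move: side_ge u1 u2 v1 v2 h1 h2.
move: (K * (Num.ceil z)%:~R) (K * _%:~R) (side * (x j)%:R) (L%:R / 2) side (y ord0 j) => u v p l q r.
by move=> *; apply/andP; split; lra.
Qed.

Lemma kcell_inj x x' t t' : (t < 10)%N -> (t' < 10)%N -> kcell x t = kcell x' t' ->
  x = x' /\ t = t'.
Proof.
move=> t10 t10' e.
pose y : 'rV[R]_d := \row_j (K * (kcell x t ord0 j)%:~R).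
have y1 : cube K (kcell x t) y by move=> j; rewrite /y !mxE lexx ltrDl.
have y2 : cube K (kcell x' t') y by rewrite -e.
have side0 : 0 < side by apply: lt_le_trans side_ge; rewrite mulr_gt0.
have xx' : x = x'.
  apply/ffunP => j; apply/val_inj/eqP.
  have /andP[a1 a2] := kcell_pos t10 y1 j; have /andP[b1 b2] := kcell_pos t10' y2 j.
  have l (u v : nat) : side * u%:R < side * v%:R + side -> (u <= v)%N.
    by rewrite -[X in _ + X]mulr1 -mulrDr ltr_pM2l// natr1 ltr_nat ltnS.
  by rewrite eqn_leq (l _ _ (le_lt_trans a1 b2)) (l _ _ (le_lt_trans b1 a2)).
split=> //; move: e; rewrite -xx' => /rowP/(_ (Ordinal d_gt0)).
by rewrite !mxE eqxx => /addrI [].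
Qed.

(* A cell contains ten cubes of side [K] in a row.  Two groups of five of them give
   two distinct points, since [w^2] of a lone point would be too small. *)
Definition group (x : T) (u : bool) : set (Omega R d) :=
  [set xi | forall t, (t < 5)%N -> vacant K (kcell x (t + u * 5)) xi].

Definition bad (x : T) : set (Omega R d) := group x false `|` group x true.

Lemma measurable_group x u : measurable (group x u).
Proof.
rewrite (_ : group x u = \bigcap_(t in [set t | (t < 5)%N]) vacant K (kcell x (t + u * 5))).
  by apply: bigcap_measurableType => t _; exact: measurable_vacant.
by apply/seteqP; split.
Qed.

Definition all_bad (V : {set T}) : set (Omega R d) := [set xi | forall x, x \in V -> bad x xi].

Lemma measurable_all_bad V : measurable (all_bad V).
Proof.
rewrite (_ : all_bad V = \bigcap_(x in [set x | x \in V]) bad x); last by apply/seteqP; split.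
apply: fin_bigcap_measurable; first exact: finite_finset.
by move=> x _; apply: measurableU; exact: measurable_group.
Qed.

(** [U] selects which group is vacant in each cell: there are [2 ^ #|V|] choices, each requiring
    five vacant cubes per cell, so of probability at most [2 ^ -(5 * #|V|)]. *)
Lemma all_bad_prob V : (P (all_bad V) <= ((16 ^+ #|V|)^-1)%:E)%E.
Proof.
pose F (U : {set T}) := \bigcap_(x in [set x | x \in V]) group x (x \in U).
have mF U : measurable (F U).
  apply: fin_bigcap_measurable; first exact: finite_finset.
  by move=> x _; exact: measurable_group.
have sub : all_bad V `<=` \big[setU/set0]_(U : {set T} | U \subset V) F U.
  move=> xi h; apply/big_setUP.
  exists [set x in V | `[< group x true xi >]]%SET.
    by apply/fintype.subsetP => x; rewrite inE => /andP[].
  move=> x xV; have [g|g] := h x xV; last first.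
    by rewrite inE xV (asboolT g).
  rewrite inE xV; case: asboolP => //.
have PF (U : {set T}) : (P (F U) <= ((2 ^+ (5 * #|V|))^-1)%:E)%E.
  pose s := [seq kcell x (t + (x \in U) * 5) | x <- enum V, t <- iota 0 5].
  have us : uniq s.
    apply: allpairs_uniq; [exact: enum_uniq|exact: iota_uniq|].
    move=> p1 p2 /allpairsP[[x1 t1] [_ t1P ->]] /allpairsP[[x2 t2] [_ t2P ->]] /=.
    move: t1P t2P; rewrite !mem_iota/= => t1P t2P /kcell_inj[||-> +].
    - by case: (x1 \in U); lia.
    - by case: (x2 \in U); lia.
    by move=> /eqP; rewrite eqn_add2r => /eqP ->.
  have ss : size s = (5 * #|V|)%N by rewrite size_allpairs size_iota -cardE mulnC.
  rewrite -ss; apply: le_trans (vac us).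
  apply: le_measure; rewrite ?inE.
  - exact: mF.
  - rewrite (_ : [set xi | _] = \bigcap_(x in [set` s]) vacant K x); last by apply/seteqP; split.
    by apply: fin_bigcap_measurable => [|x _]; [exact: finite_seq|exact: measurable_vacant].
  move=> xi h _ /allpairsP[[x t] [xV tP ->]].
  have tP' : (t < 5)%N by move: tP; rewrite mem_iota.
  by rewrite mem_enum in xV; exact: (h x xV t tP').
apply: (@le_trans _ _ (P (\big[setU/set0]_(U : {set T} | U \subset V) F U))).
  apply: le_measure => //; rewrite inE; first exact: measurable_all_bad.
  by apply: bigsetU_measurable => U _; exact: mF.
apply: le_trans (measure_big_setU_le mF (fun U _ => PF U)) _.
rewrite lee_fin (eq_bigl (fun U => U \in powerset V)); last by move=> U; rewrite powersetE.
rewrite sumr_const card_powerset.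
rewrite -[leLHS]mulr_natr natrX le_eqVlt; apply/orP; left; apply/eqP.
have -> : 16 ^+ #|V| = 2 ^+ (4 * #|V|) :> R.
  by rewrite exprM; congr (_ ^+ _); rewrite -natrX.
rewrite (_ : 5 * #|V| = 4 * #|V| + #|V|)%N; last by lia.
rewrite exprD invfM mulfVK// expf_neq0// pnatr_eq0.
Qed.

Definition occupied (xi : Omega R d) (x : T) : bool := `[< ~ bad x xi >].

Variables (jm : nat) (delta : R).

Definition threshold (j : nat) : R := expR (- (delta * (2 ^ (j * d))%:R)).

Definition nblocks (j : nat) : nat := (Num.truncn (threshold j * 2 ^+ ((jm - j) * d))).+1.

(** A finite union over deterministic sets, hence measurable and open to a union bound; outside it
    every density of empty cubes is below [threshold], see [not_fail]. *)
Definition fail : set (Omega R d) :=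
  \big[setU/set0]_(x0 : T) \big[setU/set0]_(j < jm.+1)
    \big[setU/set0]_(V in vacant_family j jm x0 (nblocks j)) all_bad V.

Lemma measurable_fail : measurable fail.
Proof.
do 2 (apply: bigsetU_measurable => ? _); apply: bigsetU_measurable => V _.
exact: measurable_all_bad.
Qed.

Lemma not_fail xi x0 j : (jm <= k)%N -> ~ fail xi -> (j <= jm)%N ->
  av (fun=> jm) (fun x => (empty (occupied xi) j x)%:R) x0 <= threshold j.
Proof.
move=> jk nf jjm; rewrite leNgt; apply/negP => h; apply: nf.
have jP : (j <= jm <= k)%N by rewrite jjm.
have [V VF hV] := many_empty jP (expR_ge0 _) h.
apply/big_setUP; exists x0 => //; apply/big_setUP.
exists (Ordinal (jjm : j < jm.+1)%N) => //; apply/big_setUP; exists V => // x xV.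
by have := hV x xV; rewrite /occupied => /asboolPn/contrapT.
Qed.

Lemma fail_prob (q : R) : (jm <= k)%N -> 0 <= delta <= 2^-1 ->
  (forall j, (j <= jm)%N -> q <= (2 ^ (j * d))%:R * (nblocks j)%:R) ->
  (P fail <= (2 ^+ (k * d) * jm.+1%:R * expR (- (q / 2)))%:E)%E.
Proof.
move=> jk dP hq.
pose c (x0 : T) : R := jm.+1%:R * expR (- (q / 2)).
have -> : 2 ^+ (k * d) * jm.+1%:R * expR (- (q / 2)) = \sum_(x0 : T) c x0.
  by rewrite sumr_const card_ffun !card_ord -expnM -[RHS]mulr_natl natrX mulrA.
apply: measure_big_setU_le => [x0|x0 _].
  apply: bigsetU_measurable => j _; apply: bigsetU_measurable => V _.
  exact: measurable_all_bad.
have -> : c x0 = \sum_(j < jm.+1) expR (- (q / 2)).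
  by rewrite sumr_const card_ord -[RHS]mulr_natl.
apply: measure_big_setU_le => [j|j _].
  by apply: bigsetU_measurable => V _; exact: measurable_all_bad.
have jjm : (j <= jm)%N by rewrite -ltnS.
have jP : (j <= jm <= k)%N by rewrite jjm.
apply: (@le_trans _ _ (\sum_(V in vacant_family j jm x0 (nblocks j))
    (16 ^+ (nblocks j * 2 ^ (j * d)))^-1)%:E).
  apply: measure_big_setU_le => [V|V VF]; first exact: measurable_all_bad.
  rewrite -(vacant_family_card R (leq_trans jjm jk) VF); exact: all_bad_prob.
rewrite lee_fin sumr_const -[leLHS]mulr_natl.
apply: (@le_trans _ _ ('C(2 ^ ((jm - j) * d), nblocks j)%:R * (16 ^+ (nblocks j * 2 ^ (j * d)))^-1)).
  by rewrite ler_wpM2r ?invr_ge0 ?exprn_ge0// ler_nat (card_vacant_family R).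
have n0 : (0 < 2 ^ (j * d))%N by rewrite expn_gt0.
have hE : nblocks j = (Num.truncn (expR (- (delta * (2 ^ (j * d))%:R)) * (2 ^ ((jm - j) * d))%:R)).+1.
  by rewrite /nblocks /threshold (natrX _ 2 ((jm - j) * d)).
apply: le_trans (binomial_tail n0 dP hE) _.
rewrite ler_expR lerN2 ler_pM2r ?invr_gt0//; exact: hq.
Qed.

End Scale.

End Percolation.

(** This is where [alpha < d] acts; [U] is the point at which both powers balance, and [C] covers
    what lies below it. *)
Lemma powR_absorb (R : realType) (A delta alpha : R) (d : nat) :
  0 <= A -> 0 < delta -> 0 < alpha < d%:R ->
  exists C : R, forall u : R, 1 <= u -> A * u `^ alpha <= delta * u ^+ d + C.
Proof.
move=> A0 d0 /andP[a0 ad].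
have b0 : 0 < d%:R - alpha by rewrite subr_gt0.
pose U := (A / delta) `^ (d%:R - alpha)^-1.
exists (A * U `^ alpha) => u u1.
have u0 : 0 < u by exact: lt_le_trans u1.
have [uU|/ltW Uu] := leP u U.
  apply: (@le_trans _ _ (A * U `^ alpha)).
    by rewrite ler_wpM2l// ge0_ler_powR// ?nnegrE ?(ltW a0) ?(ltW u0) ?powR_ge0.
  by rewrite lerDr mulr_ge0 ?exprn_ge0 ?ltW.
apply: (@le_trans _ _ (delta * u ^+ d)); last by rewrite lerDl mulr_ge0 ?powR_ge0.
have -> : u ^+ d = u `^ (d%:R - alpha) * u `^ alpha.
  rewrite -powRD ?subrK ?powR_mulrn ?(ltW u0)//.
  by rewrite (gt_eqF u0) implybT.
rewrite mulrA ler_wpM2r ?powR_ge0// mulrC -ler_pdivrMr//.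
have q0 : 0 <= A / delta by rewrite divr_ge0// ltW.
rewrite (_ : A / delta = U `^ (d%:R - alpha)); last first.
  by rewrite /U -powRrM mulVf ?gt_eqF// powRr1.
by rewrite ge0_ler_powR// ?nnegrE ?(ltW b0) ?(ltW u0) ?powR_ge0.
Qed.

(** With [u = 2 ^ j], half of [delta * u ^ d] absorbs the inverse rate by [powR_absorb]; the other
    half beats [u ^ d.+2], which leaves a summable [1 / u]. The bound is uniform in [m], hence in
    [L]. *)
Lemma level_sum_bounded (R : realType) (c1 alpha delta : R) (d : nat) : (0 < d)%N ->
  0 <= c1 -> 0 < delta -> 0 < alpha < d%:R ->
  exists2 C : R, 1 <= C & forall m : nat,
    let g j := 2 ^+ (d.+1 * j) * expR ((c1 * 2 ^+ j.+1) `^ alpha) in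
    g 0%N + \sum_(j < m) g j.+1 * expR (- (delta * (2 ^ (j * d))%:R)) <= C.
Proof.
move=> d0 c10 del0 aP; have a0 : 0 < alpha by case/andP: aP.
have del2 : 0 < delta / 2 by rewrite divr_gt0.
pose A := (4 * c1) `^ alpha.
have [C hC] := powR_absorb (powR_ge0 _ _ : 0 <= A) del2 aP.
pose D := 2 ^+ d.+1 * ((d.+2)`!%:R * (2 / delta) ^+ d.+2) * expR C.
pose g j := 2 ^+ (d.+1 * j) * expR ((c1 * 2 ^+ j.+1) `^ alpha).
have g0 : 0 <= g 0%N by apply: mulr_ge0; [exact: exprn_ge0|exact: expR_ge0].
have q0 : 0 <= 2 / delta by rewrite divr_ge0// ltW.
have D0 : 0 <= D.
  apply: mulr_ge0; last exact: expR_ge0.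
  by apply: mulr_ge0; [exact: exprn_ge0|apply: mulr_ge0 => //; exact: exprn_ge0].
have term j : g j.+1 * expR (- (delta * (2 ^ (j * d))%:R)) <= D * (2 ^+ j)^-1.
  pose u : R := 2 ^+ j.
  have u1 : 1 <= u by rewrite exprn_ege1// ler1n.
  have u0 : 0 < u by exact: lt_le_trans u1.
  have un0 : u != 0 by rewrite gt_eqF.
  have ud : (2 ^ (j * d))%:R = u ^+ d :> R by rewrite natrX exprM.
  have e1 : (c1 * 2 ^+ j.+2) `^ alpha = A * u `^ alpha.
    by rewrite /A -powRM ?mulr_ge0 ?(ltW u0)// !exprS /u; congr (_ `^ _); ring.
  have e2 : 2 ^+ (d.+1 * j.+1) = 2 ^+ d.+1 * u ^+ d.+1 :> R.
    by rewrite mulnS exprD mulnC exprM.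
  rewrite /g e1 e2 ud -[leLHS]mulrA -expRD.
  have y0 : 0 <= delta / 2 * u by apply: mulr_ge0; exact: ltW.
  have h1 : (delta / 2 * u) ^+ d.+2 / d.+2`!%:R <= expR (delta / 2 * u).
    by apply: le_trans (expR_ge1Dxn d.+1 y0); rewrite lerDr.
  have h2 : u ^+ d.+2 <= d.+2`!%:R * (2 / delta) ^+ d.+2 * expR (delta / 2 * u).
    have f0 : 0 < d.+2`!%:R :> R by rewrite ltr0n fact_gt0.
    have := ler_wpM2l (_ : 0 <= d.+2`!%:R * (2 / delta) ^+ d.+2) h1.
    rewrite mulr_ge0 ?(exprn_ge0 _ q0)// => /(_ isT); apply: le_trans.
    rewrite le_eqVlt; apply/orP; left; apply/eqP; rewrite !exprMn !exprVn; field.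
    by rewrite !expf_neq0 ?gt_eqF//.
  have h3 : delta / 2 * u <= delta / 2 * u ^+ d.
    by rewrite ler_pM2l// ler_eXnr.
  have h4 : u ^+ d.+1 <= d.+2`!%:R * (2 / delta) ^+ d.+2 * expR (delta / 2 * u ^+ d) * u^-1.
    rewrite ler_pdivlMr// -exprSr; apply: le_trans h2 _.
    by rewrite ler_wpM2l ?ler_expR// mulr_ge0 ?(exprn_ge0 _ q0).
  rewrite -mulrA; apply: (@le_trans _ _ (2 ^+ d.+1 * (d.+2`!%:R * (2 / delta) ^+ d.+2 *
      expR (delta / 2 * u ^+ d) * u^-1 * expR (C - delta / 2 * u ^+ d)))).
    rewrite ler_wpM2l ?exprn_ge0// ler_pM ?exprn_ge0 ?expR_ge0 ?(ltW u0)// ler_expR.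
    by have := hC u u1; lra.
  rewrite expRD expRN /D -/u le_eqVlt; apply/orP; left; apply/eqP; field.
  by rewrite un0 gt_eqF ?expR_gt0.
exists (g 0%N + 2 * D + 1) => [|m /=]; first by rewrite lerDr addr_ge0// mulr_ge0.
rewrite -/(g 0%N); apply: (@le_trans _ _ (g 0%N + 2 * D)); last by rewrite lerDl.
rewrite lerD2l; apply: (@le_trans _ _ (\sum_(j < m) D * (2 ^+ j)^-1)).
  by apply: ler_sum => j _; exact: term.
rewrite -big_distrr/= mulrC ler_wpM2r//.
suff -> : \sum_(j < m) (2 ^+ j)^-1 = 2 - 2 * (2 ^+ m)^-1 :> R.
  by rewrite lerBlDr lerDl mulr_ge0// invr_ge0 exprn_ge0.
elim: m => [|m IH]; first by rewrite big_ord0 expr0 invr1; ring.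
rewrite big_ord_recr/= IH exprS invfM; field.
by rewrite expf_neq0// pnatr_eq0.
Qed.

Lemma borel_cantelli_large (R : realType) (d : nat) (P : probability (Omega R d) R)
    (F : nat -> set (Omega R d)) (c : R) :
  (forall L, measurable (F L)) -> (forall L, (P (F L) <= (c / L.+1%:R ^+ 2)%:E)%E) ->
  as_large P (fun xi L => ~ F L xi).
Proof.
move=> mF hF.
have c0 : 0 <= c.
  have := le_trans (measure_ge0 P (F 0%N)) (hF 0%N).
  by rewrite lee_fin expr1n divr1.
have fin : (\sum_(n <oo) P (F n) < +oo)%E.
  apply: (@le_lt_trans _ _ (2 * c)%:E); last exact: ltry.
  apply: lime_le; first by apply: is_cvg_nneseries => n _ _; exact: measure_ge0.
  apply: nearW => n; apply: (@le_trans _ _ (\sum_(0 <= i < n) (c / i.+1%:R ^+ 2)%:E)%E).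
    by apply: lee_sum => i _.
  rewrite sumEFin lee_fin big_mkord -big_distrr/= mulrC ler_wpM2r//.
  case: n => [|n]; first by rewrite big_ord0.
  apply: (@le_trans _ _ (2 - n.+1%:R^-1)); last by rewrite lerBlDr lerDl invr_ge0.
  elim: n => [|n IH]; first by rewrite big_ord1 expr1n invr1; lra.
  rewrite big_ord_recr/=; apply: le_trans (lerD IH (lexx _)) _.
  have a1 : 0 < n.+1%:R :> R by rewrite ltr0n.
  rewrite -[n.+2%:R]natr1; move: (n.+1%:R : R) a1 => a a1.
  rewrite -subr_ge0 (_ : _ - _ = (a * (a + 1) ^+ 2)^-1).
    by rewrite invr_ge0 mulr_ge0 ?sqr_ge0 ?ltW.
  by field; rewrite !gt_eqF// ltr_wpDr.
have lim0 := lim_sup_set_cvg0 mF fin.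
have mlim : measurable (lim_sup_set F).
  by apply: bigcap_measurableType => n _; apply: bigcup_measurable => j _; exact: mF.
exists (~` lim_sup_set F); split.
- exact: measurableC.
- by rewrite (probability_setC P mlim) lim0 sube0.
move=> xi; rewrite /lim_sup_set setC_bigcap => -[n _ hn]; exists n => L nL FL.
by apply: hn; exists L.
Qed.

(** * The dyadic scale of the box *)

Section Scale.
Variables (R : realType) (K : R).
Hypothesis K_gt0 : 0 < K.

(** For [L >= 11 * K], the exponent that puts the side of the cells between [11 * K] and
    [22 * K]. *)
Definition scale (L : nat) : nat := trunc_log 2 (Num.truncn (L%:R / (11 * K))).

Lemma scale_bounds L : 11 * K <= L%:R ->
  11 * K * 2 ^+ scale L <= L%:R /\ L%:R < 22 * K * 2 ^+ scale L.
Proof.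
move=> hL; have K11 : 0 < 11 * K by rewrite mulr_gt0.
have q0 : 0 <= L%:R / (11 * K) by rewrite divr_ge0// ltW.
have /andP[t1 t2] := truncn_itv q0.
have tpos : (0 < Num.truncn (L%:R / (11 * K)))%N.
  by rewrite truncn_gt0 ler_pdivlMr// mul1r.
have l1 := trunc_logP (isT : (1 < 2)%N) tpos.
have l2 := trunc_log_ltn (Num.truncn (L%:R / (11 * K))) (isT : (1 < 2)%N).
rewrite -/(scale L) in l1 l2; split.
  rewrite mulrC -ler_pdivlMr//; apply: le_trans t1.
  by rewrite -natrX ler_nat.
rewrite (_ : 22 * K * _ = 2 ^+ (scale L).+1 * (11 * K)); last by rewrite exprS; ring.
rewrite -ltr_pdivrMr//; apply: lt_le_trans t2 _.
by rewrite -natrX ler_nat.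
Qed.

Lemma scale_large (k0 : nat) : exists L0 : nat, forall L, (L0 <= L)%N ->
  11 * K <= L%:R /\ (k0 <= scale L)%N.
Proof.
have h22 : 0 <= 22 * K * 2 ^+ k0 by rewrite !mulr_ge0 ?exprn_ge0// ltW.
exists (Num.truncn (22 * K * 2 ^+ k0)).+1 => L hL.
have h1 : 22 * K * 2 ^+ k0 <= L%:R.
  apply: le_trans (_ : (Num.truncn (22 * K * 2 ^+ k0)).+1%:R <= _); last by rewrite ler_nat.
  by have /andP[_ /ltW] := truncn_itv h22.
have h2 : 11 * K <= L%:R.
  apply: le_trans h1; apply: (@le_trans _ _ (22 * K * 1)); first by move: K_gt0 => ?; lra.
  by rewrite ler_wpM2l ?exprn_ege1 ?ler1n// mulr_ge0// ltW.
split=> //; have [_ h3] := scale_bounds h2.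
have := le_lt_trans h1 h3; rewrite ltr_pM2l ?mulr_gt0//.
rewrite ltr_eXn2l ?ltr1n//; exact: ltnW.
Qed.
End Scale.

(** By [block_exponent], [fail_prob] applies with [q = 2 * (d + 4) * k]: the exponential is at most
    [2 ^ -((d + 4) * k)], and [2 ^ (k * d)] centres and at most [2 ^ k] levels leave [4 ^ -k], of
    order [L ^ -2], to spare. *)
Lemma percolation_large (R : realType) (d B : nat) (P : probability (Omega R d) R) :
  (0 < d)%N -> (0 < B)%N -> A1 P ->
  let delta : R := d%:R / (8 * B%:R * (d + 4)%:R) in
  exists2 K : R, 0 < K &
    as_large P (fun xi L => ~ fail K L (scale K L) (scale K L %/ B) delta xi).
Proof.
move=> d0 B0 hA1 delta.
have [|K [K0 dom]] := hA1 2^-1; first by apply/andP; split; lra.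
have vac := vacant_prob (dom _ (@coin_bernoulli R d)).
exists K => //.
have [k0 hk0] := @block_exponent R d B d0 B0.
have [L0 hL0] := scale_large K0 (maxn k0 1).
have deltaP : 0 <= delta <= 2^-1.
  have Bp : 1 <= B%:R :> R by rewrite ler1n.
  have d4 : 0 < (d + 4)%:R :> R by rewrite ltr0n addn_gt0 d0.
  have Bp0 : 0 < B%:R :> R by exact: lt_le_trans Bp.
  have den : 0 < 8 * B%:R * (d + 4)%:R :> R by rewrite !mulr_gt0.
  apply/andP; split; first by rewrite divr_ge0// ltW.
  rewrite ler_pdivrMr//.
  by rewrite natrD; have : 0 <= d%:R :> R by []; nra.
(* Small [L] are discarded so that the probability bound holds for every [L]. *)
pose F L : set (Omega R d) := if (L0 <= L)%N then fail K L (scale K L) (scale K L %/ B) delta else set0.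
have mF L : measurable (F L).
  by rewrite /F; case: ifP => // _; exact: measurable_fail.
have FP L : (P (F L) <= (4 * (22 * K) ^+ 2 / L.+1%:R ^+ 2)%:E)%E.
  rewrite /F; case: ifPn => [/hL0[h11 hk]|_]; last first.
    rewrite measure0 lee_fin; apply: divr_ge0; last exact: sqr_ge0.
    by apply: mulr_ge0 => //; exact: sqr_ge0.
  set k := scale K L in hk *; have [h1 h2] := scale_bounds K0 h11.
  have p2 : 0 < 2 ^+ k :> R by rewrite exprn_gt0.
  have sge : 11 * K <= side R L k by rewrite /side ler_pdivlMr.
  have jk : (k %/ B <= k)%N by exact: leq_div.
  apply: (@le_trans _ _ (2 ^+ (k * d) * (k %/ B).+1%:R * expR (- ((2 * (d + 4) * k)%:R / 2)))%:E).
    apply: fail_prob => // j jjm.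
    apply: (hk0 k (2 ^ (j * d))%N) => //.
    - by apply: leq_trans hk; exact: leq_maxl.
    - by rewrite ler_peMr// ler1n.
    - rewrite -/delta -/(threshold d delta j).
      have q0 : 0 <= threshold d delta j * 2 ^+ ((k %/ B - j) * d).
        by rewrite mulr_ge0 ?exprn_ge0// expR_ge0.
      have /andP[_ /ltW] := truncn_itv q0; rewrite -/(nblocks d (k %/ B) delta j) => hn.
      apply: (@le_trans _ _ ((2 ^ (j * d))%:R * (threshold d delta j * 2 ^+ ((k %/ B - j) * d)))).
        by rewrite mulrCA natrX -exprD -mulnDl subnKC.
      by rewrite ler_wpM2l.
  rewrite lee_fin.
  have e1 : expR (- ((2 * (d + 4) * k)%:R / 2)) <= (2 ^+ ((d + 4) * k))^-1 :> R.
    rewrite (_ : _ / 2 = ((d + 4) * k)%:R); last by rewrite -mulnA natrM mulrAC mulfV ?mul1r.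
    rewrite expRN lef_pV2 ?posrE ?expR_gt0 ?exprn_gt0//.
    rewrite -[X in expR X]mul1r expRM_natr lerXn2r ?nnegrE ?expR_ge0//.
    exact: expR1_ge2.
  have e2 : (k %/ B).+1%:R <= 2 ^+ k :> R.
    rewrite -natrX ler_nat; apply: leq_ltn_trans jk _; exact: ltn_expl.
  have e3 : 2 ^+ (k * d) * (k %/ B).+1%:R * expR (- ((2 * (d + 4) * k)%:R / 2)) <= (4 ^+ k)^-1 :> R.
    apply: (@le_trans _ _ (2 ^+ (k * d) * 2 ^+ k * (2 ^+ ((d + 4) * k))^-1)).
      apply: ler_pM; rewrite ?mulr_ge0 ?exprn_ge0 ?expR_ge0//.
      by rewrite ler_wpM2l// exprn_ge0.
    have -> : 4 ^+ k = 2 ^+ (2 * k) :> R by rewrite exprM; congr (_ ^+ _); rewrite -natrX.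
    rewrite -exprD ler_pdivrMr ?exprn_gt0// mulrC ler_pdivlMr ?exprn_gt0//.
    by rewrite -exprD ler_weXn2l ?ler1n//; nia.
  apply: le_trans e3 _; rewrite ler_pdivlMr ?exprn_gt0// mulrC ler_pdivrMr ?exprn_gt0//.
  have L1 : (0 < L)%N.
    by rewrite -(ltr_nat R); apply: lt_le_trans h11; rewrite mulr_gt0.
  have l1 : L.+1%:R <= 2 * L%:R :> R by rewrite -natrM ler_nat; lia.
  have e4 : L.+1%:R <= 2 * (22 * K * 2 ^+ k) by apply: le_trans l1 _; rewrite ler_pM2l// ltW.
  have -> : 4 * (22 * K) ^+ 2 * 4 ^+ k = (2 * (22 * K * 2 ^+ k)) ^+ 2.
    have -> : 4 ^+ k = (2 ^+ k) ^+ 2 :> R by rewrite -exprM mulnC exprM; congr (_ ^+ _); rewrite -natrX.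
    by ring.
  by rewrite lerXn2r ?nnegrE// !mulr_ge0 ?exprn_ge0// ltW.
have [Om0 [mOm POm hOm]] := borel_cantelli_large mF FP.
exists Om0; split=> // xi /hOm[L1 hL1]; exists (maxn L0 L1) => L; rewrite geq_max => /andP[l0 l1].
by have := hL1 L l1; rewrite /F l0.
Qed.

(** * Cells, representatives and jump rates *)

Lemma same_cube_dist (d k j : nat) (x y : {ffun 'I_d -> 'I_(2 ^ k)}) i :
  same_cube j x y -> (x i < y i + 2 ^ j)%N.
Proof.
move=> /forallP/(_ i)/eqP e; rewrite (divn_eq (x i) (2 ^ j)) (divn_eq (y i) (2 ^ j)) e.
by rewrite -addnA ltn_add2l (leq_trans (ltn_pmod _ (expn_gt0 2 j)))// leq_addl.
Qed.

Lemma cube_inj (R : realType) (d : nat) (K : R) (c c' : 'rV[int]_d) y : 0 < K ->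
  cube K c y -> cube K c' y -> c = c'.
Proof.
move=> K0 h h'; apply/rowP => j.
have /andP[a1 a2] := h j; have /andP[b1 b2] := h' j.
have l (u v : int) : K * u%:~R < K * v%:~R + K -> u <= v.
  by rewrite -[X in _ + X]mulr1 -mulrDr ltr_pM2l// -(intrD _ v 1) ltr_int ltzD1.
by apply/eqP; rewrite eq_le (l _ _ (le_lt_trans a1 b2)) (l _ _ (le_lt_trans b1 a2)).
Qed.

Section Cells.
Variables (R : realType) (d : nat) (alpha K : R) (xi : config R d) (L k : nat).
Variable s : seq 'rV[R]_d.
Local Notation T := {ffun 'I_d -> 'I_(2 ^ k)}.
Local Notation D := (side R L k).
Hypothesis d_gt0 : (0 < d)%N.
Hypothesis K_gt0 : 0 < K.
Hypothesis side_ge : 11 * K <= D.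
Hypothesis sE : [set` s] = cpts xi `&` @LamL R d L.

Let D_gt0 : 0 < D. Proof. by apply: lt_le_trans side_ge; rewrite mulr_gt0. Qed.

Let side_pow : D * 2 ^+ k = L%:R.
Proof. by rewrite /side divfK// expf_neq0// pnatr_eq0. Qed.

(** The box is closed: points on its far faces are truncated into the last cell, hence the weak
    upper inequality in [cell_bounds]. *)
Lemma cell_subproof (t : nat) : (minn t (2 ^ k).-1 < 2 ^ k)%N.
Proof. by rewrite gtn_min prednK ?expn_gt0// leqnn orbT. Qed.

Definition cell (y : 'rV[R]_d) : T :=
  [ffun j => Ordinal (cell_subproof (Num.truncn ((y ord0 j + L%:R / 2) / D)))].

Lemma cell_bounds (y : 'rV[R]_d) j : @LamL R d L y ->
  D * (cell y j)%:R <= y ord0 j + L%:R / 2 <= D * (cell y j)%:R + D.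
Proof.
move=> /(_ j)/andP[y1 y2]; rewrite ffunE /=.
set z := (_ / D); have zE : y ord0 j + L%:R / 2 = D * z by rewrite [RHS]mulrC divfK// gt_eqF.
have z0 : 0 <= z by rewrite divr_ge0 ?(ltW D_gt0)//; lra.
have z1 : z <= 2 ^+ k.
  by rewrite ler_pdivrMr// [leRHS]mulrC side_pow; lra.
have /andP[t1 t2] := truncn_itv z0.
rewrite zE -[X in _ + X]mulr1 -mulrDr !ler_pM2l// natr1.
case: (leqP (Num.truncn z) (2 ^ k).-1) => h; apply/andP; split => //.
- exact: ltW.
- by apply: le_trans t1; rewrite ler_nat ltnW.
- by rewrite prednK ?expn_gt0// natrX.
Qed.

Lemma cell_eq (x : T) (y : 'rV[R]_d) :
  (forall j, D * (x j)%:R <= y ord0 j + L%:R / 2 < D * (x j)%:R + D) -> cell y = x.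
Proof.
move=> h; apply/ffunP => j; apply: val_inj; rewrite ffunE /=.
have /andP[h1 h2] := h j.
rewrite (@truncn_def _ _ (x j)).
  by apply/minn_idPl; rewrite -ltnS prednK ?expn_gt0.
rewrite ler_pdivlMr// [_ * D]mulrC h1/= ltr_pdivrMr// [ltRHS]mulrC -(natr1 (x j)) mulrDr mulr1//.
Qed.

Lemma pt_mem (a : 'I_(size s)) : cpts xi (pt a) /\ @LamL R d L (pt a).
Proof.
have : [set` s] (pt a) by rewrite /= /pt mem_nth.
by rewrite sE.
Qed.

Lemma pt_exists y : cpts xi y -> @LamL R d L y -> exists a : 'I_(size s), pt a = y.
Proof.
move=> h1 h2; have : [set` s] y by rewrite sE.
move=> /= ys; have hi : (index y s < size s)%N by rewrite index_mem.
by exists (Ordinal hi); rewrite /pt/= nth_index.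
Qed.

Lemma occupied_pair x : occupied K L xi x ->
  exists a b : 'I_(size s), [/\ a != b, cell (pt a) = x & cell (pt b) = x].
Proof.
move=> /asboolP; rewrite /bad => /not_orP[g0 g1].
have pick (u : bool) : ~ group K L x u xi -> exists t a, [/\ (t < 5)%N,
    cube K (kcell K L x (t + u * 5)) (pt (s := s) a) & cell (pt a) = x].
  move=> /existsNP[t /not_implyP[t5 /contrapT[y [y1 y2]]]].
  have t10 : (t + u * 5 < 10)%N by case: u {g0 g1 y2} => //; lia.
  have hp := kcell_pos K_gt0 side_ge t10 y2.
  have yL : @LamL R d L y.
    move=> j; have /andP[h1 h2] := hp j.
    have b0 : 0 <= D * (x j)%:R by apply: mulr_ge0 => //; exact: ltW.
    have b1 : D * (x j)%:R + D <= L%:R.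
      rewrite -side_pow -[X in _ + X]mulr1 -mulrDr ler_pM2l// natr1 -natrX ler_nat.
      exact: ltn_ord.
    by apply/andP; split; lra.
  have [a aE] := pt_exists y1 yL.
  by exists t, a; split=> //; rewrite aE//; exact: cell_eq.
have [t0 [a [t05 ca xa]]] := pick false g0.
have [t1 [b [t15 cb xb]]] := pick true g1.
exists a, b; split=> //; apply/eqP => ab; move: ca cb; rewrite -ab => ca cb.
have := cube_inj K_gt0 ca cb; rewrite mul0n addn0 mul1n => e.
have [| |_ ] := kcell_inj d_gt0 K_gt0 side_ge _ _ e; lia.
Qed.

(** Points whose cells are less than [m] apart along each axis lie within distance [c1 * m]. *)
Definition c1 : R := Num.sqrt d%:R * (22 * K).

Lemma c1_ge0 : 0 <= c1.
Proof. by rewrite mulr_ge0 ?sqrtr_ge0// mulr_ge0// ltW. Qed.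

Hypothesis alpha_gt0 : 0 < alpha.
Hypothesis side_lt : D < 22 * K.

Lemma kern_ge (a b : 'I_(size s)) (m : nat) :
  (forall j, (cell (pt a) j < cell (pt b) j + m)%N /\ (cell (pt b) j < cell (pt a) j + m)%N) ->
  expR (- ((c1 * m%:R) `^ alpha)) <= kern alpha (pt a) (pt b).
Proof.
move=> hm; rewrite ler_expR lerN2 ge0_ler_powR ?(ltW alpha_gt0)//.
- by rewrite nnegrE sqrtr_ge0.
- by rewrite nnegrE mulr_ge0// c1_ge0.
rewrite /c1 -mulrA; apply: enorm_le => [|j]; first by rewrite !mulr_ge0// ltW.
rewrite !mxE.
have /andP[a1 a2] := cell_bounds j (pt_mem a).2.
have /andP[b1 b2] := cell_bounds j (pt_mem b).2.
have [h1 h2] := hm j.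
have l (u v : nat) : (u < v + m)%N -> D * u%:R + D <= D * v%:R + D * m%:R.
  by move=> uv; rewrite -[X in _ + X <= _]mulr1 -!mulrDr ler_pM2l// natr1 -natrD ler_nat.
have Dm : D * m%:R <= 22 * K * m%:R by rewrite ler_wpM2r// ltW.
have := l _ _ h1; have := l _ _ h2.
by rewrite ler_norml => ? ?; apply/andP; split; lra.
Qed.

End Cells.

(** * Mass of a cube, from (A2) *)

Section Mass.
Variables (R : realType) (d : nat) (alpha K : R) (xi : config R d) (L k : nat).
Variable s : seq 'rV[R]_d.
Local Notation T := {ffun 'I_d -> 'I_(2 ^ k)}.
Local Notation D := (side R L k).
Local Notation cl a := (cell L k (pt (s := s) a)).
Hypothesis K_gt0 : 0 < K.
Hypothesis side_ge : 11 * K <= D.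
Hypothesis us : uniq s.
Hypothesis sE : [set` s] = cpts xi `&` @LamL R d L.

Lemma pt_inj : injective (pt (s := s)).
Proof.
move=> a b /eqP; rewrite /pt nth_uniq// => /eqP ab; exact: val_inj.
Qed.

Lemma esum_ge_pt (A : set 'rV[R]_d) (Q : pred 'I_(size s)) (G : 'rV[R]_d -> \bar R) :
  (forall a, Q a -> A (pt a)) -> (\sum_(a | Q a) G (pt a) <= \esum_(y in A) G y)%E.
Proof.
move=> QA; apply: esum_ge; pose l := [seq pt a | a <- enum Q].
have ul : uniq l by rewrite map_inj_uniq ?enum_uniq//; exact: pt_inj.
exists [set` l].
  split; first exact: finite_seq.
  by move=> y /= /mapP[a]; rewrite mem_enum => Qa ->; exact: QA.
by rewrite -fsbig_seq// /l big_map big_enum; exact: lexx.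
Qed.

Definition row_sum (a : 'I_(size s)) : R := \sum_(b < size s) kern alpha (pt a) (pt b).

Lemma row_sum_le_RA (V : set 'rV[R]_d) (Q : pred 'I_(size s)) :
  (forall a, Q a -> V (pt a)) -> ((\sum_(a | Q a) row_sum a)%:E <= RA alpha (cpts xi) V)%E.
Proof.
move=> QV; rewrite /RA -sumEFin.
apply: (@le_trans _ _ (\sum_(a | Q a) \esum_(y in cpts xi) (kern alpha (pt a) y)%:E)%E).
  apply: lee_sum => a _; rewrite /row_sum -sumEFin.
  apply: (@esum_ge_pt _ predT (fun y => (kern alpha (pt a) y)%:E)) => b _.
  exact: (pt_mem sE b).1.
apply: (@esum_ge_pt _ Q (fun y => (\esum_(z in cpts xi) (kern alpha y z)%:E)%E)) => a Qa.
by split; [exact: (pt_mem sE a).1|exact: QV].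
Qed.

(** A dyadic cube of side at most [m0 * ell] meets at most [m0.+1 ^ d] cubes of the lattice of step
    [ell], on which (A2) bounds the mass; [off] locates a point among them. *)
Lemma mass_cover (ell b : R) (m0 jm : nat) (w : 'I_(size s) -> R) (x : T) :
  0 < ell -> 0 <= b -> (forall a, w a <= row_sum a) ->
  (forall v, (exists y, cube ell v y /\ @LamL R d L y) ->
    (RA alpha (cpts xi) (cube ell v) <= b%:E)%E) ->
  D * 2 ^+ jm <= m0%:R * ell ->
  \sum_a w a * kerT R (fun=> jm) (cl a) x <= m0.+1%:R ^+ d * b * (2 ^+ (jm * d))^-1.
Proof.
move=> ell0 b0 wS hRA hm0.
have D0 : 0 < D by apply: lt_le_trans side_ge; rewrite mulr_gt0.
pose lo j : R := D * (2 ^ jm * (x j %/ 2 ^ jm))%:R - L%:R / 2.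
pose fl (z : R) : int := Num.floor (z / ell).
pose off (a : 'I_(size s)) : {ffun 'I_d -> 'I_m0.+1} :=
  [ffun j => inord (absz (fl (pt a ord0 j) - fl (lo j)))].
pose v (o : {ffun 'I_d -> 'I_m0.+1}) : 'rV[int]_d := \row_j (fl (lo j) + (o j)%:Z).
have fl_cube z : ell * (fl z)%:~R <= z < ell * (fl z)%:~R + ell.
  have /andP[f1 f2] := floor_itv (z / ell).
  rewrite /fl; apply/andP; split; first by rewrite mulrC -ler_pdivlMr.
  by rewrite -[X in _ + X]mulr1 -mulrDr mulrC -ltr_pdivrMr//; rewrite intrD in f2.
have fl_mono z z' : z <= z' -> fl z <= fl z'.
  by move=> zz; apply: le_floor; rewrite ler_pM2r ?invr_gt0.
have flD z : fl (z + m0%:R * ell) = fl z + m0%:Z.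
  by rewrite /fl mulrDl mulfK ?gt_eqF// pmulrn floorDrz ?intr_int// intrKfloor.
have inV a : same_cube jm (cl a) x -> cube ell (v (off a)) (pt a).
  move=> sc j; have /andP[p1 p2] := cell_bounds K_gt0 side_ge j (pt_mem sE a).2.
  have := sc => /forallP/(_ j)/eqP q.
  have q1 : D * (2 ^ jm * (x j %/ 2 ^ jm))%:R <= D * (cl a j)%:R.
    by rewrite ler_pM2l// ler_nat -q mulnC leq_trunc_div.
  have q2 : D * (cl a j)%:R + D <= D * (2 ^ jm * (x j %/ 2 ^ jm))%:R + D * 2 ^+ jm.
    rewrite -[X in _ + X <= _]mulr1 -!mulrDr ler_pM2l// natr1 -natrX -natrD ler_nat -q.
    by rewrite -mulnSr mulnC ltn_ceil// expn_gt0.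
  have l1 : lo j <= pt a ord0 j by rewrite /lo; lra.
  have l2 : pt a ord0 j <= lo j + m0%:R * ell by rewrite /lo; lra.
  have f1 := fl_mono _ _ l1; have f2 := fl_mono _ _ l2; rewrite flD in f2.
  rewrite /v /off mxE ffunE inordK.
    by rewrite gez0_abs ?subr_ge0// [fl (lo j) + _]addrC subrK; exact: fl_cube.
  by rewrite ltnS -lez_nat gez0_abs ?subr_ge0// lerBlDl.
rewrite (eq_bigr (fun a => if same_cube jm (cl a) x then w a * (2 ^+ (jm * d))^-1 else 0)); last first.
  by move=> a _; rewrite kerT_cst; case: ifP => _; rewrite ?mulr0.
rewrite -big_mkcond/= -big_distrl/= ler_wpM2r ?invr_ge0 ?exprn_ge0//.
apply: (@le_trans _ _ (\sum_(a | same_cube jm (cl a) x) row_sum a)); first by apply: ler_sum.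
rewrite (partition_big off predT)//=.
apply: (@le_trans _ _ (\sum_(o : {ffun 'I_d -> 'I_m0.+1}) b)); last first.
  by rewrite sumr_const card_ffun !card_ord -[leLHS]mulr_natl natrX.
apply: ler_sum => o _.
(* The bound is assumed only for lattice cubes that meet the box; a point [a0] of the class
   certifies this. *)
have [a0 /andP[a0x /eqP a0o]|no] := pickP (fun a => same_cube jm (cl a) x && (off a == o)); last first.
  by rewrite big_pred0.
rewrite -lee_fin; apply: le_trans (hRA (v o) _).
  by apply: row_sum_le_RA => a /andP[ax /eqP <-]; exact: inV.
by exists (pt a0); split; [rewrite -a0o; exact: inV|exact: (pt_mem sE a0).2].
Qed.

End Mass.

(** * The mixing time *)

Section Weights.
Variables (R : realType) (d : nat) (alpha : R) (s : seq 'rV[R]_d) (i : nat).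
Hypothesis alpha_gt0 : 0 < alpha.
Implicit Types a b : 'I_(size s).

Lemma kernC (x y : 'rV[R]_d) : kern alpha x y = kern alpha y x.
Proof.
rewrite /kern; suff -> : enorm (x - y) = enorm (y - x) by [].
rewrite /enorm (eq_bigr (fun j => (y - x) ord0 j ^+ 2))// => j _.
by rewrite !mxE -sqrrN opprB.
Qed.

Lemma kern_diag (x : 'rV[R]_d) : kern alpha x x = 1.
Proof.
rewrite /kern subrr /enorm big1 => [|j _]; last by rewrite mxE expr0n.
by rewrite sqrtr0 powR0 ?gt_eqF// oppr0 expR0.
Qed.

Lemma w2_ge0 a : 0 <= w2 alpha a.
Proof. by apply: sumr_ge0 => b _; exact: expR_ge0. Qed.

(** One bound for the three models: the diagonal term of [row_sum] is 1 and the others make up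
    [w2]. *)
Lemma wt_le_row_sum a : wt i alpha a <= row_sum alpha a.
Proof.
have -> : row_sum alpha a = 1 + w2 alpha a by rewrite /row_sum (bigD1 a)//= kern_diag.
have w0 := w2_ge0 a.
rewrite /wt; case: ifP => _; first by rewrite lerDl.
case: ifP => _; first by rewrite lerDr.
by rewrite ge_max lerDl w0 lerDr ler01.
Qed.

Lemma le_wt c a b : c <= 1 -> b != a -> c <= kern alpha (pt a) (pt b) -> c <= wt i alpha a.
Proof.
move=> c_le1 ba hc; have w2c : c <= w2 alpha a.
  apply: le_trans hc _; rewrite /w2 (bigD1 b)//= lerDl.
  by apply: sumr_ge0 => z _; exact: expR_ge0.
rewrite /wt; case: ifP => // _; case: ifP => // _.
by rewrite le_max c_le1.
Qed.

Lemma heatE t a b : heat i alpha s t a b = mexp (gen i alpha s) t a b.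
Proof.
rewrite mxE /mexp; congr (limn _); apply/funext => N.
rewrite /pseries /series/= big_mkord; apply: eq_bigr => m _.
by rewrite mulrC [RHS]mulrAC -mulrA.
Qed.

Lemma gen_row a : \sum_b gen i alpha s a b = 0.
Proof.
rewrite (bigD1 a)//= mxE eqxx addrC; apply/eqP; rewrite subr_eq0; apply/eqP.
by apply: eq_bigr => b ba; rewrite mxE eq_sym (negbTE ba).
Qed.

End Weights.

Lemma ltn_double_pow (u v m : nat) : (u < v + 2 ^ m)%N -> (v < u + 2 ^ m)%N ->
  (u < v + 2 ^ m.+1)%N /\ (v < u + 2 ^ m.+1)%N.
Proof. by rewrite expnS; lia. Qed.

(** Representatives of adjacent cells: the strict inequalities absorb the unit distance between the
    cells. *)
Lemma ltn_double_pow_adj (u v x y m m' : nat) : (m' <= m)%N ->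
  (u < x + 2 ^ m)%N -> (x < u + 2 ^ m)%N -> (v < y + 2 ^ m')%N -> (y < v + 2 ^ m')%N ->
  (x <= y.+1)%N -> (y <= x.+1)%N -> (u < v + 2 ^ m.+1)%N /\ (v < u + 2 ^ m.+1)%N.
Proof.
move=> mm; have : (2 ^ m' <= 2 ^ m)%N by rewrite leq_exp2l.
by rewrite expnS; lia.
Qed.

(** * Mixing for a fixed good configuration *)

Section Deterministic.
Variables (R : realType) (d : nat) (alpha K C1 C2 : R).

(** Inverse of the rate bound [kern_ge] at [m = 2 ^ j.+1], the separation given by
    [ltn_double_pow_adj]. *)
Definition level_cost (j : nat) : R := expR ((c1 d K * 2 ^+ j.+1) `^ alpha).
Definition rep_weight : R := expR (- ((c1 d K * 1%:R) `^ alpha)).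
Definition nashS : R := 6 * C3 d C1 C2.
Definition nashQ : R := 4 / clow C1 rep_weight.
(** Twice [mixT] divided by [4 ^ k]: the first two terms bound the starting phase through
    [k <= 2 ^ k], the third is the sum over scales, the last is [La]. *)
Definition mix_const : R :=
  2 * nashS * (2 * d%:R + C1 / nashQ + 2 * d.+1%:R + (2 * C2 * nashQ + 1)).

Variables (xi : config R d) (L k jm i : nat) (s : seq 'rV[R]_d).
Local Notation T := {ffun 'I_d -> 'I_(2 ^ k)}.
Local Notation occ := (occupied K L (k := k) xi).
Local Notation lev := (level occ).
Hypothesis d_gt0 : (0 < d)%N.
Hypothesis alpha_gt0 : 0 < alpha.
Hypothesis K_gt0 : 0 < K.
Hypothesis C1_ge1 : 1 <= C1.
Hypothesis C2_gt0 : 0 < C2.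
Hypothesis side_ge : 11 * K <= side R L k.
Hypothesis side_lt : side R L k < 22 * K.
Hypothesis sE : [set` s] = cpts xi `&` @LamL R d L.
Hypothesis jmP : (jm * (3 * d + 2) <= 2 * (k %/ 2))%N.
Hypothesis nonempty : forall x : T, ~~ empty occ jm x.
Hypothesis av_cost : forall x : T,
  av (fun=> jm) (fun y => 2 ^+ (d.+1 * lev y) * level_cost (lev y)) x <= C1.
Hypothesis mass : forall (w : 'I_(size s) -> R) (x : T),
  (forall a, w a <= row_sum alpha a) ->
  \sum_a w a * kerT R (fun=> jm) (cell L k (pt a)) x <= C2.

Let n := size s.
Let X (a : 'I_n) : T := cell L k (pt a).
Let r (a b : 'I_n) : R := kern alpha (pt a) (pt b).
Let w (a : 'I_n) : R := wt i alpha a.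

Let j0k : (k %/ 2 <= k)%N. Proof. exact: leq_div. Qed.
Let jmj0 : (jm <= k %/ 2)%N. Proof. by move: jmP; move: (k %/ 2)%N => j0; clear; nia. Qed.
Let jmk : (jm <= k)%N. Proof. exact: leq_trans jmj0 j0k. Qed.

Let lev_le x : (lev x <= jm)%N. Proof. exact: level_le. Qed.

Let cost_ge1 j : 1 <= level_cost j.
Proof. by rewrite /level_cost -expR0 ler_expR powR_ge0. Qed.

Let near a b (m : nat) : (forall j, (X a j < X b j + 2 ^ m.+1)%N /\ (X b j < X a j + 2 ^ m.+1)%N) ->
  1 <= level_cost m * r a b.
Proof.
move=> /(kern_ge K_gt0 side_ge sE alpha_gt0 side_lt) h.
rewrite -ler_pdivrMl ?expR_gt0// mulr1 -expRN; apply: le_trans h.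
by rewrite natrX.
Qed.

Let rep_exists x : exists a, same_cube (lev x) (X a) x /\ exists b, b != a /\ X b = X a.
Proof.
have /forallPn[y] := level_nonempty jmk (nonempty x).
rewrite negb_imply negbK => /andP[xy oy].
have [a [b [ab xa xb]]] := occupied_pair d_gt0 K_gt0 side_ge sE oy.
exists a; rewrite /X xa same_cubeC; split=> //.
by exists b; rewrite eq_sym.
Qed.

Lemma mixing_time_le : (mixing_time i alpha s <= (mix_const * 4 ^+ k)%:E)%E.
Proof.
have [p pP] := choice rep_exists.
have p_cube x : same_cube (lev x) (X (p x)) x := (pP x).1.
have C1_gt0 : 0 < C1 by exact: lt_le_trans C1_ge1.
have rep0 : 0 < rep_weight by exact: expR_gt0.
have p_adj x y : adj x y -> (lev y <= lev x)%N -> 1 <= level_cost (lev x) * r (p x) (p y).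
  move=> [j0 [xy1 xy2]] yx; apply: near => j.
  have a1 := same_cube_dist j (p_cube x); have a2 := same_cube_dist j (p_cube y).
  have b1 : (x j < X (p x) j + 2 ^ lev x)%N by apply: same_cube_dist; rewrite same_cubeC.
  have b2 : (y j < X (p y) j + 2 ^ lev y)%N by apply: same_cube_dist; rewrite same_cubeC.
  have [xy yx'] : (x j <= (y j).+1)%N /\ (y j <= (x j).+1)%N.
    have [->|jj0] := eqVneq j j0; last by rewrite (xy1 j jj0) leqnSn.
    by case: xy2 => ->; rewrite leqnn; split=> //; exact: leqW.
  exact: ltn_double_pow_adj yx a1 b1 a2 b2 xy yx'.
have p_own a : 1 <= level_cost (lev (X a)) * r a (p (X a)).
  apply: near => j; have a1 := same_cube_dist j (p_cube (X a)).
  have b1 : (X a j < X (p (X a)) j + 2 ^ lev (X a))%N by apply: same_cube_dist; rewrite same_cubeC.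
  exact: ltn_double_pow.
have w_cost a : 1 <= level_cost (lev (X a)) * w a.
  rewrite -ler_pdivrMl ?expR_gt0// mulr1.
  (* In the second model [w] needs another point nearby: the representative, or, if [a] represents
     its own cell, its companion in that cell. *)
  have [b [ba hb]] : exists b, b != a /\ 1 <= level_cost (lev (X a)) * r a b.
    have [pa|pa] := eqVneq (p (X a)) a; last by exists (p (X a)).
    have [b [bpa xb]] := (pP (X a)).2; rewrite pa in bpa xb.
    exists b; split; first exact: bpa.
    by apply: near => j; rewrite xb -addn1 leq_add2l expn_gt0.
  apply: (le_wt i _ ba); first by rewrite invf_le1 ?expR_gt0.
  by rewrite -[leLHS]mulr1 ler_pdivrMl ?expR_gt0.
have w_gt0 a : 0 < w a.
  have h : 0 < level_cost (lev (X a)) * w a by exact: lt_le_trans (w_cost a).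
  by rewrite pmulr_rgt0 ?expR_gt0 in h.
have w_rep x : rep_weight <= w (p x).
  have [b [bp xb]] := (pP x).2; apply: (le_wt i _ bp).
    by rewrite /rep_weight -expR0 ler_expR oppr_le0 powR_ge0.
  apply: (kern_ge K_gt0 side_ge sE alpha_gt0 side_lt) => j.
  by rewrite -/(X b) -/(X (p x)) xb addn1.
have r_ge0 a b : 0 <= r a b by exact: expR_ge0.
have mass_w x : \sum_a w a * kerT R (fun=> jm) (X a) x <= C2.
  by apply: mass => a; exact: wt_le_row_sum.
have w_ge0 a := ltW (w_gt0 a).
have C2_ge0 := ltW C2_gt0.
have nashE f J : (k %/ 2 <= J <= k)%N -> \sum_a w a * f a ^+ 2 <= nashS * 4 ^+ J * energy r f +
    nashQ * (2 ^+ (J * d))^-1 * (\sum_a w a * `|f a|) ^+ 2.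
  move=> /andP[J0 Jk].
  apply: (nash r_ge0 w_ge0 cost_ge1 jmk p_cube p_adj p_own lev_le C1_ge1 C2_ge0 rep0 av_cost mass_w w_rep).
    by rewrite (leq_trans jmj0 J0).
  by apply: leq_trans jmP _; rewrite leq_mul2l.
have C3_gt0 : 0 < C3 d C1 C2.
  have h1 : 0 <= 8 * d%:R ^+ 2 :> R by apply: mulr_ge0 => //; exact: sqr_ge0.
  have h2 : 0 <= 2 * d%:R ^+ 2 * 4 ^+ (d + 2) :> R.
    by apply: mulr_ge0; [apply: mulr_ge0 => //; exact: sqr_ge0|exact: exprn_ge0].
  by rewrite /C3; apply: mulr_gt0; [rewrite !mulr_gt0|rewrite -addrA ltr_pwDl// addr_ge0].
have S_gt0 : 0 < nashS by rewrite mulr_gt0.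
have Q_gt0 : 0 < nashQ by apply: divr_gt0 => //; exact: clow_gt0.
have gapE f : exists c, \sum_a w a * (f a - c) ^+ 2 <= nashS * 4 ^+ k * energy r f.
  have jmP' : (jm * (3 * d + 2) <= 2 * k)%N by apply: leq_trans jmP _; rewrite leq_mul2l.
  have [c hc] := poincare r_ge0 w_ge0 cost_ge1 jmk p_cube p_adj p_own lev_le C1_ge1 C2_ge0 rep0
    av_cost mass_w f jmP'.
  exists c; apply: le_trans hc _; rewrite ler_wpM2r ?energy_ge0//.
  by rewrite ler_wpM2r ?exprn_ge0// /nashS ler_peMl ?(ltW C3_gt0) ?ler1n.
have mass_tot := total_mass_le jmk mass_w.
have th0 : 0 <= C1 / nashQ by apply: divr_ge0; exact: ltW.
(* [1 / w] is at most [C1 * 2 ^ (jm * d)] and the target is [nashQ * 2 ^ -(k * d)]; as [jm <= k],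
   their ratio is at most [2 ^ (2 * k * d) * (C1 / nashQ)], hence at most [expR Th]. *)
pose Th : R := (2 * k * d)%:R + C1 / nashQ.
have Th_ge0 : 0 <= Th by rewrite addr_ge0.
pose La : R := 2 * C2 * nashQ + 1.
have CQ0 : 0 <= 2 * C2 * nashQ by apply: mulr_ge0; [apply: mulr_ge0|exact: ltW].
have La_ge0 : 0 <= La by rewrite addr_ge0.
have w_inv a : (w a)^-1 <= expR Th * (nashQ * (2 ^+ (k * d))^-1).
  have h1 : (w a)^-1 <= level_cost (lev (X a)).
    by rewrite -[leLHS]mul1r ler_pdivrMr.
  have h2 : level_cost (lev (X a)) <= C1 * 2 ^+ (jm * d).
    rewrite -ler_pdivrMr ?exprn_gt0//; apply: le_trans (av_cost (X a)).
    rewrite /av (bigD1 (X a))//= kerT_cst same_cubexx.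
    apply: (@le_trans _ _ ((2 ^+ (jm * d))^-1 * (2 ^+ (d.+1 * lev (X a)) * level_cost (lev (X a))))).
      rewrite mulrC ler_wpM2l ?invr_ge0 ?exprn_ge0// ler_peMl ?expR_ge0//.
      by rewrite exprn_ege1// ler1n.
    rewrite lerDl; apply: sumr_ge0 => b _; apply: mulr_ge0; first exact: kerT_ge0.
    by apply: mulr_ge0; [exact: exprn_ge0|exact: expR_ge0].
  apply: le_trans h1 _; apply: le_trans h2 _.
  rewrite mulrA ler_pdivlMr ?exprn_gt0// -mulrA -exprD -ler_pdivrMr//.
  rewrite mulrAC mulrC /Th expRD; apply: ler_pM; rewrite ?exprn_ge0//.
    apply: (@le_trans _ _ (2 ^+ (2 * k * d))).
      by rewrite ler_weXn2l ?ler1n// -mulnDl leq_mul2r mul2n -addnn leq_add2r jmk orbT.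
    rewrite -[X in expR X]mul1r expRM_natr lerXn2r ?nnegrE ?expR_ge0//.
    exact: expR1_ge2.
  by apply: le_trans (expR_ge1Dx _); rewrite lerDr.
have La_ineq : 2 * C2 * nashQ <= expR (La - 1).
  by rewrite /La addrK; apply: le_trans (expR_ge1Dx _); rewrite lerDr.
have A_off a b : a != b -> gen i alpha s a b = r a b / w a.
  by move=> ab; rewrite mxE (negbTE ab).
have rC a b : r a b = r b a by exact: kernC.
have mix := mixing w_gt0 r_ge0 rC A_off (@gen_row R d alpha s i) S_gt0 Q_gt0 Th_ge0 La_ge0 j0k nashE gapE
  mass_tot w_inv La_ineq.
set t := mixT d k (k %/ 2) nashS Th La in mix.
have t_le : t + t <= mix_const * 4 ^+ k.
  have p4 : 4 ^+ (k %/ 2) <= 2 ^+ k :> R.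
    have -> : 4 ^+ (k %/ 2) = 2 ^+ (2 * (k %/ 2)) :> R.
      by rewrite exprM; congr (_ ^+ _); rewrite -natrX.
    by rewrite ler_weXn2l ?ler1n// mulnC leq_trunc_div.
  have k2 : k%:R <= 2 ^+ k :> R by rewrite -natrX ler_nat ltnW// ltn_expl.
  have one2 : 1 <= 2 ^+ k :> R by rewrite exprn_ege1// ler1n.
  have ThLe : Th <= 2 ^+ k * (2 * d%:R + C1 / nashQ).
    rewrite /Th mulrDr; apply: lerD; last by rewrite ler_peMl.
    by rewrite !natrM mulrAC mulrC ler_wpM2r.
  have first : 4 ^+ (k %/ 2) * Th <= 4 ^+ k * (2 * d%:R + C1 / nashQ).
    apply: (@le_trans _ _ (2 ^+ k * (2 ^+ k * (2 * d%:R + C1 / nashQ)))).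
      by apply: ler_pM => //; exact: exprn_ge0.
    by rewrite mulrA -exprMn (_ : 2 * 2 = 4)// -natrM.
  rewrite /t /mixT /phase /mix_const -/La.
  rewrite [leRHS](_ : _ = 2 * (nashS * (4 ^+ k * (2 * d%:R + C1 / nashQ) + 2 * d.+1%:R * 4 ^+ k) +
    nashS * 4 ^+ k * La)); last by ring.
  rewrite [leLHS](_ : _ = 2 * (nashS * (4 ^+ (k %/ 2) * Th + 2 * d.+1%:R * 4 ^+ k) +
    nashS * 4 ^+ k * La)); last by ring.
  by rewrite ler_pM2l// lerD2r ler_pM2l// lerD2r.
have t_gt0 : 0 < t + t.
  have h4 : 0 < 4 ^+ k :> R by exact: exprn_gt0.
  have h5 : 0 <= 4 ^+ (k %/ 2) * Th by apply: mulr_ge0 => //; exact: exprn_ge0.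
  have h6 : 0 <= nashS * 4 ^+ k * La by apply: mulr_ge0 => //; apply: mulr_ge0; exact: ltW.
  have h8 : 0 < 2 * d.+1%:R * 4 ^+ k :> R by rewrite !pmulr_rgt0.
  have h9 : 0 < nashS * (4 ^+ (k %/ 2) * Th + 2 * d.+1%:R * 4 ^+ k).
    by apply: mulr_gt0 => //; exact: ltr_wpDl.
  have h7 : 0 < t by exact: ltr_pwDl.
  by rewrite addr_gt0.
apply: (@le_trans _ _ (t + t)%:E); last by rewrite lee_fin.
apply: ereal_inf_lbound; exists (t + t) => //; split=> // a b.
by rewrite heatE /nu; exact: mix.
Qed.

End Deterministic.

Lemma as_large_and (R : realType) (d : nat) (P : probability (Omega R d) R)
    (Q1 Q2 : config R d -> nat -> Prop) :
  as_large P Q1 -> as_large P Q2 -> as_large P (fun xi L => Q1 xi L /\ Q2 xi L).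
Proof.
move=> [A [mA PA hA]] [B [mB PB hB]].
exists (A `&` B); split; first exact: measurableI.
  have mC : measurable (~` (A `&` B)) by apply: measurableC; exact: measurableI.
  have PC (E : set (Omega R d)) : measurable E -> P E = 1%E -> P (~` E) = 0%E.
    by move=> mE PE; rewrite (probability_setC P mE) PE subee.
  have : P (~` (A `&` B)) = 0%E.
    apply/eqP; rewrite eq_le measure_ge0 andbT setCI.
    apply: le_trans (measureU2 _ (measurableC mA) (measurableC mB)) _.
    have := PC _ mA PA; have := PC _ mB PB => PB' PA'.
    by rewrite -[leLHS]/(P (~` A) + P (~` B))%E PA' PB' adde0.
  by rewrite (probability_setC P (measurableI _ _ mA mB)) => /eqP; rewrite sube_eq// add0e => /eqP.
move=> xi [/hA[L1 h1] /hB[L2 h2]]; exists (maxn L1 L2) => L.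
by rewrite geq_max => /andP[/h1 ? /h2 ?].
Qed.

Lemma av_empty (R : realType) (d k : nat) (occ : pred {ffun 'I_d -> 'I_(2 ^ k)}) j x :
  (j <= k)%N -> av (fun=> j) (fun y => (empty occ j y)%:R : R) x = (empty occ j x)%:R.
Proof.
move=> jk; rewrite -[RHS](av_const _ x (fun=> jk)); apply: eq_bigr => y _.
rewrite kerT_cst; case: ifP => xy; last by rewrite !mul0r.
by rewrite (empty_eq _ xy).
Qed.

(** * Comparison of [L ^ (1 / B)] with the dyadic side [2 ^ (k %/ B)] *)

Section MesoScale.
Variables (R : realType) (K : R) (B L k : nat).
Hypothesis K_gt0 : 0 < K.
Hypothesis B_gt0 : (0 < B)%N.
Hypothesis L_ge : 11 * K * 2 ^+ k <= L%:R.
Hypothesis L_lt : L%:R < 22 * K * 2 ^+ k.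

Let eps : R := B%:R^-1.
Let eps_ge0 : 0 <= eps. Proof. by rewrite invr_ge0. Qed.
Let eps_le1 : eps <= 1. Proof. by rewrite invf_le1 ?ler1n ?ltr0n. Qed.

Let pow_eps : (2 ^+ k) `^ eps = 2 `^ (k%:R / B%:R) :> R.
Proof. by rewrite -powR_mulrn// -powRrM. Qed.

Definition meso_ratio : R := Num.min 1 (11 * K).

Lemma meso_ratio_gt0 : 0 < meso_ratio.
Proof. by rewrite lt_min ltr01 mulr_gt0. Qed.

Lemma meso_ge : meso_ratio * 2 ^+ (k %/ B) <= L%:R `^ eps.
Proof.
have k0 := meso_ratio_gt0; have Bp : 0 < B%:R :> R by rewrite ltr0n.
apply: (@le_trans _ _ ((11 * K * 2 ^+ k) `^ eps)); last first.
  by rewrite ge0_ler_powR// nnegrE// !mulr_ge0 ?exprn_ge0// ltW.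
rewrite powRM ?mulr_ge0 ?exprn_ge0 ?(ltW K_gt0)//.
apply: ler_pM; [exact: ltW|exact: exprn_ge0| |].
  apply: (@le_trans _ _ (meso_ratio `^ eps)).
    by apply: ger1_powR => //; rewrite k0 ge_min lexx.
  by rewrite ge0_ler_powR ?nnegrE ?(ltW k0) ?mulr_ge0 ?(ltW K_gt0)// ge_min lexx orbT.
rewrite pow_eps -powR_mulrn// ler_powR ?ler1n//.
by rewrite ler_pdivlMr// -natrM ler_nat leq_trunc_div.
Qed.

Lemma meso_le : L%:R `^ eps <= 2 * (22 * K + 1) * 2 ^+ (k %/ B).
Proof.
have Bp : 0 < B%:R :> R by rewrite ltr0n.
have K22 : 0 <= 22 * K by rewrite mulr_ge0// ltW.
apply: (@le_trans _ _ ((22 * K * 2 ^+ k) `^ eps)).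
  by rewrite ge0_ler_powR ?nnegrE ?(ltW L_lt)// mulr_ge0 ?exprn_ge0.
rewrite powRM ?exprn_ge0// [2 * _]mulrC -mulrA -exprS.
apply: ler_pM; rewrite ?powR_ge0//.
  apply: (@le_trans _ _ ((22 * K + 1) `^ eps)).
    by rewrite ge0_ler_powR ?nnegrE ?addr_ge0// lerDl.
  by rewrite ler1_powR// lerDr.
rewrite pow_eps -powR_mulrn// ler_powR ?ler1n//.
by rewrite ler_pdivrMr// -natrM ler_nat ltnW// ltn_ceil.
Qed.

End MesoScale.

Theorem theorem1p2 (R : realType) (d : nat) (alpha : R)
    (P : probability (Omega R d) R) :
  (2 <= d)%N -> 0 < alpha < d%:R -> A1 P -> A2 alpha P ->
  exists C : R, forall i : nat, (1 <= i <= 3)%N ->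
    as_large P (fun xi L =>
      forall s : seq 'rV[R]_d, uniq s -> [set` s] = cpts xi `&` @LamL R d L ->
        (mixing_time i alpha s <= (C * L%:R ^+ 2)%:E)%E).
Proof.
move=> d2 alphaP hA1 hA2.
have d0 : (0 < d)%N by exact: leq_trans d2.
have alpha0 : 0 < alpha by case/andP: alphaP.
(* makes the loss [2 ^ (k %/ B * (3 * d + 2))] below scale [L ^ (1 / B)] at most [4 ^ (k %/ 2)] *)
pose B := (2 * (3 * d + 2))%N.
have B0 : (0 < B)%N by rewrite muln_gt0 addn_gt0 orbT.
have Bp : 0 < B%:R :> R by rewrite ltr0n.
pose delta : R := d%:R / (8 * B%:R * (d + 4)%:R).
have delta0 : 0 < delta.
  by rewrite divr_gt0 ?ltr0n// !mulr_gt0// ltr0n addn_gt0 d0.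
have [K K0 perc] := percolation_large d0 B0 hA1.
have [|CA meso] := hA2 B%:R^-1.
  by rewrite invr_gt0 Bp invf_lt1// ltr1n /B; lia.
have [C1 C1_ge1 hC1] := level_sum_bounded d0 (c1_ge0 d K0) delta0 alphaP.
(* Number of (A2) cubes, of side at least [meso_ratio K * 2 ^ jm], needed to span a dyadic cube of
   side below [22 * K * 2 ^ jm]. *)
pose m0 := (Num.truncn (22 * K / meso_ratio K)).+1.
pose C2 : R := m0.+1%:R ^+ d * (`|CA| * (2 * (22 * K + 1)) ^+ d) + 1.
have K22 : 0 <= 22 * K by rewrite mulr_ge0// ltW.
have C2_gt0 : 0 < C2.
  apply: ltr_wpDl => //; apply: mulr_ge0; first exact: exprn_ge0.
  by apply: mulr_ge0 => //; apply: exprn_ge0; rewrite mulr_ge0// addr_ge0.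
exists (`|mix_const d alpha K C1 C2| / (11 * K) ^+ 2) => i iP.
have [Om0 [mOm POm hOm]] := as_large_and perc meso.
exists Om0; split=> // xi /hOm[L1 hL1].
have [L2 hL2] := scale_large K0 0.
exists (maxn L1 L2) => L; rewrite geq_max => /andP[/hL1[nofail RAle] /hL2[L11 _]] s us sE.
set k := scale K L in nofail.
have [Lge Llt] := scale_bounds K0 L11; rewrite -/k in Lge Llt.
have p2 : 0 < 2 ^+ k :> R by rewrite exprn_gt0.
have side_ge : 11 * K <= side R L k by rewrite /side ler_pdivlMr.
have side_lt : side R L k < 22 * K by rewrite /side ltr_pdivrMr.
have jmk : (k %/ B <= k)%N by exact: leq_div.
have few (x0 : {ffun 'I_d -> 'I_(2 ^ k)}) j : (j <= k %/ B)%N ->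
    av (fun=> (k %/ B)%N) (fun x => (empty (occupied K L xi) j x)%:R) x0 <= threshold d delta j.
  exact: not_fail jmk nofail.
have thr_lt1 j : threshold d delta j < 1 :> R.
  by rewrite /threshold -expR0 ltr_expR oppr_lt0 mulr_gt0// ltr0n expn_gt0.
(* At the top level the density of empty cubes is 0 or 1, and the threshold is below 1. *)
have nonempty x : ~~ empty (occupied K L (k := k) xi) (k %/ B) x.
  apply/negP => e; have := le_lt_trans (few x _ (leqnn _)) (thr_lt1 _).
  by rewrite av_empty// e ltxx.
have jmP : (k %/ B * (3 * d + 2) <= 2 * (k %/ 2))%N.
  have h := leq_trunc_div k B; rewrite /B in h *.
  apply: (@leq_trans (k %/ 2)); last by rewrite mul2n -addnn leq_addl.
  by rewrite leq_divRL// -mulnA [(_ * 2)%N]mulnC.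
have ell0 : 0 < L%:R `^ B%:R^-1 :> R.
  by apply: lt_le_trans (meso_ge K0 B0 Lge); rewrite mulr_gt0 ?meso_ratio_gt0// exprn_gt0.
have main : (mixing_time i alpha s <= (mix_const d alpha K C1 C2 * 4 ^+ k)%:E)%E.
  apply: (mixing_time_le i d0 alpha0 K0 C1_ge1 C2_gt0 side_ge side_lt sE jmP nonempty).
    move=> x; apply: le_trans (hC1 (k %/ B)%N).
    apply: (av_level_le (g := fun j => 2 ^+ (d.+1 * j) * level_cost d alpha K j)
      (b := threshold d delta)) => // [j|y|j jm].
    - by apply: mulr_ge0; [exact: exprn_ge0|exact: expR_ge0].
    - exact: level_le.
    - by apply: few; exact: ltnW.
  move=> w x wS.
  apply: (@le_trans _ _ (m0.+1%:R ^+ d * (`|CA| * L%:R `^ (B%:R^-1 * d%:R)) *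
      (2 ^+ (k %/ B * d))^-1)).
    apply: (mass_cover K0 side_ge us sE x ell0 _ wS) => [|v hv|].
    - by rewrite mulr_ge0 ?powR_ge0.
    - apply: le_trans (RAle v hv) _; rewrite lee_fin ler_wpM2r ?powR_ge0//.
      exact: ler_norm.
    apply: (@le_trans _ _ (22 * K * 2 ^+ (k %/ B))).
      by rewrite ler_wpM2r ?exprn_ge0// ltW.
    apply: (@le_trans _ _ (m0%:R * (meso_ratio K * 2 ^+ (k %/ B)))).
      rewrite mulrA ler_wpM2r ?exprn_ge0// -ler_pdivrMr ?meso_ratio_gt0//.
      have q0 : 0 <= 22 * K / meso_ratio K by rewrite divr_ge0// ltW// meso_ratio_gt0.
      by have /andP[_ /ltW] := truncn_itv q0.
    by rewrite ler_wpM2l//; exact: meso_ge.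
  rewrite ler_pdivrMr ?exprn_gt0// powRrM powR_mulrn ?powR_ge0// exprM.
  apply: (@le_trans _ _ (m0.+1%:R ^+ d * (`|CA| * (2 * (22 * K + 1)) ^+ d) * (2 ^+ (k %/ B)) ^+ d)).
    rewrite -!mulrA ler_wpM2l ?exprn_ge0// ler_wpM2l// -exprMn.
    rewrite lerXn2r ?nnegrE ?powR_ge0 ?mulrA ?mulr_ge0 ?exprn_ge0 ?addr_ge0//.
    exact: meso_le.
  by rewrite ler_wpM2r ?exprn_ge0// lerDl.
apply: le_trans main _; rewrite lee_fin.
apply: (@le_trans _ _ (`|mix_const d alpha K C1 C2| * 4 ^+ k)).
  by rewrite ler_wpM2r ?exprn_ge0// ler_norm.
rewrite -mulrA ler_wpM2l// mulrC ler_pdivlMr ?exprn_gt0 ?mulr_gt0//.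
have -> : 4 ^+ k = (2 ^+ k) ^+ 2 :> R.
  by rewrite -exprM mulnC exprM; congr (_ ^+ _); rewrite -natrX.
rewrite -exprMn lerXn2r ?nnegrE//; last by rewrite mulrC.
by rewrite mulr_ge0 ?(ltW p2)// mulr_ge0// ltW.
Qed.
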